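(* For every $1<r<\infty$ there exist a $C^r$ map $f:I\to I$ of a compact interval $I$ and an ergodic $f$-invariant Borel probability measure $\mu$ with $h_\mu(f)>0$ such that $\mu$ is not a point of upper semi-continuity of the metric entropy $\nu\mapsto h_\nu(f)$ (or of the folding entropy $\nu\mapsto F_f(\nu)$) on the set of $f$-invariant Borel probability measures with the weak$^*$ topology.
   Context: $h_\nu(f)$ is the Kolmogorov–Sinai entropy. Folding entropy: let $\epsilon=\{\{x\}\}_{x\in I}$ be the partition into points and $f^{-1}\epsilon=\{f^{-1}\{x\}\}_{x\in I}$ the partition into preimage sets. For a Borel probability measure $\nu$ on $I$, $F_f(\nu)=H_\nu(\epsilon\mid f^{-1}\epsilon)=\int_I H_{\tilde\nu_x}(\epsilon)\,d(f\nu)(x)$, where $f\nu=\nu\circ f^{-1}$ is the image measure, $\{\tilde\nu_x\}$ is the disintegration of $\nu$ along the sets $f^{-1}\{x\}$, and $H_{\tilde\nu_x}(\epsilon)$ is the entropy of the partition into points with respect to $\tilde\nu_x$ (equal to $-\sum_y \tilde\nu_x(\{y\})\log\tilde\nu_x(\{y\})$ if $\tilde\nu_x$ is purely atomic and $+\infty$ otherwise). *)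

(* Defs.v *)
From HB Require Import structures.
From mathcomp Require Import all_boot all_order all_algebra.
From mathcomp Require Import all_classical all_reals all_analysis.

Set Implicit Arguments.
Unset Strict Implicit.
Unset Printing Implicit Defensive.

Import Order.TTheory GRing.Theory Num.Theory.
Import numFieldNormedType.Exports.

Local Open Scope classical_set_scope.
Local Open Scope ring_scope.

(* An interval map f : [a, b] -> [a, b] is represented by a Borel function
   R -> R that maps [a, b] into itself, and a Borel probability on [a, b] by a
   Borel probability on R giving mass 1 to [a, b].  Since [a, b] is then forward
   invariant and of full measure, the values of f outside [a, b] affect
   none of the notions below. *)

Section regularity.
Context {R : realType}.
Implicit Types (a b x : R) (f g : R -> R).

(* Derivative relative to [a, b]: it is one-sided at a and at b. *)
Definition has_derivative_on a b g x (l : R) :=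
  (fun y => (g y - g x) / (y - x)) @ (within `[a, b] x^') --> l.

(* C^r regularity on [a, b] for real r >= 1: with k the integer part of r,
   f has k successive derivatives D 1, ..., D k on [a, b], and D k is continuous
   and Hoelder of exponent r - k.  If r is an integer then the exponent is 0, the
   Hoelder bound follows from continuity, and this is the usual class C^k. *)
Definition Cr_on (r : R) a b f :=
  let k := Num.truncn r in
  exists D : nat -> R -> R,
    [/\ {in `[a, b], D 0%N =1 f},
        forall i, (i < k)%N ->
          {in `[a, b], forall x, has_derivative_on a b (D i) x (D i.+1 x)},
        {within `[a, b], continuous (D k)} &
        exists C : R, {in `[a, b] &, forall x y,
          `|D k x - D k y| <= C * `|x - y| `^ (r - k%:R)}].

End regularity.

Section metric_entropy.
Context d {T : measurableType d} {R : realType}.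
Implicit Types (mu : probability T R) (f : T -> T).

Definition invariant_measure f mu :=
  forall A, measurable A -> mu (f @^-1` A) = mu A.

Definition ergodic f mu :=
  forall A, measurable A -> f @^-1` A = A -> mu A = 0%E \/ mu A = 1%E.

(* A finite measurable partition is given by the map sending a point to the
   label of its atom. *)
Definition measurable_partition k (p : T -> 'I_k) :=
  forall i, measurable (p @^-1` [set i]).

(* The atoms of the join of the f^{-i} p, i < n. *)
Definition cylinder f k (p : T -> 'I_k) n (w : {ffun 'I_n -> 'I_k}) :=
  [set x | forall i : 'I_n, p (iter i f x) = w i].

(* Note that ln 0 = 0, so atoms of measure zero do not contribute. *)
Definition join_entropy mu f k (p : T -> 'I_k) n : R :=
  - \sum_(w : {ffun 'I_n -> 'I_k})
      fine (mu (cylinder f p w)) * ln (fine (mu (cylinder f p w))).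

Definition partition_entropy mu f k (p : T -> 'I_k) : \bar R :=
  limn (fun n => (join_entropy mu f p n / n%:R)%:E).

Definition ks_entropy f mu : \bar R :=
  ereal_sup [set h | exists k (p : T -> 'I_k),
    measurable_partition p /\ h = partition_entropy mu f p].

End metric_entropy.

Section folding_entropy.
Context {R : realType}.
Local Notation B := (measurableTypeR R).
Implicit Types (mu m : probability B R) (f : B -> B).

Definition point_entropy (m : set B -> \bar R) : \bar R :=
  if `[< exists2 C : set B, countable C & m C = 1%E >] then
    (\esum_(y in [set: B]) (- (fine (m [set y]) * ln (fine (m [set y]))))%:E)%E
  else +oo%E.

Definition disintegration f mu (k : R.-pker B ~> B) :=
  (forall A, measurable A -> mu A = \int[pushforward mu f]_x k x A)%E /\
  {ae pushforward mu f, forall x, k x (f @^-1` [set x]) = 1%E}.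

(* Disintegrations exist and are unique almost everywhere (R is standard Borel),
   so the set below is a singleton and the default value 0 is never used. *)
Definition folding_entropy f mu : \bar R :=
  xget 0%E [set h | exists2 k : R.-pker B ~> B, disintegration f mu k &
    h = (\int[pushforward mu f]_x point_entropy (k x))%E].

End folding_entropy.

Section weak_star.
Context {R : realType}.
Local Notation B := (measurableTypeR R).
Variables (a b : R) (f : B -> B).

Record invariant_prob := InvariantProb {
  prob_of :> probability B R ;
  prob_carried : prob_of [set` `[a, b]] = 1%E ;
  prob_invariant : invariant_measure f prob_of }.

HB.instance Definition _ := gen_eqMixin invariant_prob.
HB.instance Definition _ := gen_choiceMixin invariant_prob.

Definition test_function :=
  {phi : R -> R | {within `[a, b], continuous phi}}.

Definition integrals (nu : invariant_prob) :
    prod_topology (fun _ : test_function => R) :=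
  fun phi => \int[nu]_(x in `[a, b]) sval phi x.

(* The invariant probabilities with the coarsest topology that makes
   nu |-> \int phi dnu continuous for every continuous phi on [a, b]. *)
Definition weak_star_invariant := initial_topology integrals.
HB.instance Definition _ := Topological.on weak_star_invariant.

End weak_star.

Definition upper_semicontinuous_at (R : realType) (X : topologicalType)
    (h : X -> \bar R) (x : X) :=
  forall c : R, (h x < c%:E)%E -> \forall y \near x, (h y < c%:E)%E.

(* Main.v *)
(** The map [f] has two affine full branches, near 0 and near 1, of slope
    [lam = L ^ p]; their invariant Cantor set carries the (1/2, 1/2)-Bernoulli
    measure [mu], whose entropy and folding entropy are below 3 whatever [L] is.
    Near 1/2, [f] oscillates like [xinf + t ^ p * sin (1 / t)], where [xinf] is the
    point of the Cantor set whose coding is the Champernowne sequence, which is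
    normal.  The cylinder of length [k] around [xinf] has diameter [lam ^- k], so
    it is crossed by [N = L ^ (k - 1)] laps of the oscillation at scale [1 / N],
    and each such lap is mapped onto [0, 1] by the [(k + 1)]-st iterate of [f].
    The uniform self-similar measure of these [N] full branches, averaged over
    the tower of height [k + 1], is an invariant measure [nu_k] with entropy and
    folding entropy at least [ln N / (k + 1)], about [ln L].  Except when it
    returns to 1/2, an orbit in the tower shadows the Champernowne coding, so
    [nu_k] converges to [mu] by normality. *)

From HB Require Import structures.
Require Import Defs.
From mathcomp Require Import all_boot all_order all_algebra.
From mathcomp Require Import all_classical all_reals all_analysis.
From mathcomp Require Import measurable_realfun.
From mathcomp Require Import ring lra zify.
Set Implicit Arguments.
Unset Strict Implicit.
Unset Printing Implicit Defensive.
Import Order.TTheory GRing.Theory Num.Theory.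
Import numFieldNormedType.Exports.
Local Open Scope classical_set_scope.
Local Open Scope ring_scope.

(** * Self-similar measures on the line *)

(** The exponent [p = 2n + 1] comes from smoothness: each derivative of [t^p sin (1 / t)] costs two
    powers of [t]. Using [p] again in the slope makes the number of laps independent of it:
    amplitude [N^-p] against diameter [L^(-pk)] leaves [N] near [L^k], with [L] free. Crude bounds
    are then enough: [3 ln 2] and 2 for [mu], 3 for the [nu_k]; the requirement [ln L >= 9] reflects
    that [(k - 1) / (k + 1)] is at least 1/3. A lap is not shown to be monotone. Its inverse branch
    is a first crossing, monotone but only left continuous, so self-similar measures are built as
    images of Lebesgue measure by a coding that increases to its limit. Convergence rests on lower
    bounds for the masses of cylinders: the limiting masses sum to 1, which leaves no room for an
    excess elsewhere. For the folding entropy, [nu_k] has to be an average of its images under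
    inverse branches of [f] itself, so the position in the tower must be read off the orbit. *)

Lemma probability_of_measure d (T : measurableType d) (R : realType)
    (m : {measure set T -> \bar R}) :
  m setT = 1%E -> exists P : probability T R, forall A, P A = m A.
Proof.
move=> m1.
have [x _] : [set: T] !=set0.
  by apply/set0P/eqP => T0; move: m1; rewrite T0 measure0 => /eqP; rewrite eq_sym onee_eq0.
have b1 : (m setT == 0%E) || (m setT == +oo%E) = false by rewrite m1 onee_eq0.
(* [mnormalize] divides by the total mass, here 1; the Dirac mass is its fallback for mass 0 or
   infinity, which is why a point of [T] was extracted. *)
exists (mnormalize m (dirac x)) => A.
suff : @mnormalize d T R m (dirac x) A = m A by [].
by unfold mnormalize; rewrite b1 m1/= invr1 mule1.
Qed.

Section lebesgue.
Context {R : realType}.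
Local Notation B := (measurableTypeR R).
Local Notation leb := (@lebesgue_measure R).

Lemma lebesgue_scale_shift (N : nat) (c : R) (A : set B) : (0 < N)%N ->
  measurable A ->
  leb A = ((N%:R^-1)%:E * leb ((fun y => (c + y) / N%:R)%R @^-1` A))%E.
Proof.
move=> N0 mA.
have N0' : 0 < N%:R :> R by rewrite ltr0n.
pose h (y : B) : B := (c + y) / N%:R.
have mh : measurable_fun setT h.
  by apply: measurable_funM => //; apply: measurable_funD.
have Ni : 0 <= (N%:R^-1 : R) by rewrite invr_ge0 ltW.
apply: (@lebesgue_measure_unique R (mscale (NngNum Ni) (pushforward leb h))) => //.
move=> _ [[a b]] _ <-.
rewrite lebesgue_measure_itv/= /mscale/= /pushforward.
have -> : h @^-1` `]a, b]%classic = `]N%:R * a - c, N%:R * b - c]%classic.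
  by apply/seteqP; split => x; rewrite /h /= !in_itv/= ltr_pdivlMr// ler_pdivrMr// => /andP[h1 h2]; apply/andP; split; lra.
rewrite lebesgue_measure_itv/= !lte_fin ltrD2r ltr_pM2l//.
case: ifPn => ab; last by rewrite mule0.
rewrite -EFinB -EFinB -EFinM; congr EFin; field.
by rewrite gt_eqF.
Qed.

End lebesgue.

Section self_similar.
Context {R : realType} (N : nat) (b : 'I_N -> R -> R).
Local Notation B := (measurableTypeR R).
Local Notation leb := (@lebesgue_measure R).
Hypothesis N0 : (0 < N)%N.
Hypothesis b_homo : forall i, {homo b i : x y / x <= y}.
Hypothesis b01 : forall i (x : R), 0 <= x <= 1 -> 0 <= b i x <= 1.
Hypothesis b_left : forall i (u : nat -> R) (l : R), nondecreasing_seq u ->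
  u @ \oo --> l -> (fun n => b i (u n)) @ \oo --> b i l.

(* The coding sends the point with base [N] digits [i1, i2, ...] to the limit of
   [b i1 (b i2 (... 0))], which is nondecreasing in the number of digits. *)
Fixpoint coding_approx n (x : R) : R :=
  if n is n'.+1 then
    \sum_(i < N) \1_(`[i%:R, i.+1%:R[ : set R) (N%:R * x) *
                 b i (coding_approx n' (N%:R * x - i%:R))
  else 0.

Let N0' : 0 < N%:R :> R. Proof. by rewrite ltr0n. Qed.

Let indE (i : nat) (x : R) :
  \1_(`[i%:R, i.+1%:R[ : set R) x = ((i%:R <= x < i.+1%:R)%R%:R : R).
Proof. by rewrite indicE mem_setE in_itv/=. Qed.

Let approxS n (i : 'I_N) (y : R) : 0 <= y < 1 ->
  coding_approx n.+1 ((i%:R + y) / N%:R) = b i (coding_approx n y).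
Proof.
move=> /andP[y0 y1] /=.
have -> : N%:R * ((i%:R + y) / N%:R) = i%:R + y :> R by field; rewrite gt_eqF.
rewrite (bigD1 i)//= big1 ?addr0.
  rewrite indE; have -> : (i%:R <= i%:R + y < i.+1%:R) = true.
    by rewrite -natr1; apply/andP; split; lra.
  by rewrite mul1r; congr (b i (coding_approx _ _)); ring.
move=> j ji; rewrite indE; have [/andP[h1 h2]|_] := boolP (_ <= _ < _); last by rewrite mul0r.
exfalso; move/negP: ji; apply; apply/eqP/val_inj => /=.
have h3 : j%:R < i.+1%:R :> R by rewrite -natr1; lra.
have h4 : i%:R < j.+1%:R :> R by lra.
rewrite ltr_nat in h3; rewrite ltr_nat in h4; apply/eqP; rewrite eqn_leq.
by rewrite -ltnS h3 -ltnS h4.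
Qed.

Let approx_out n (x : R) : ~~ (0 <= x < 1) -> coding_approx n x = 0.
Proof.
case: n => //= n xN; rewrite big1// => i _; rewrite indE.
have [/andP[h1 h2]|_] := boolP (_ <= _ < _); last by rewrite mul0r.
exfalso; move/negP: xN; apply; apply/andP; split.
  by rewrite -(pmulr_rge0 _ N0'); apply: le_trans h1.
rewrite -(ltr_pM2l N0') mulr1; apply: (lt_le_trans h2).
by rewrite ler_nat.
Qed.

Lemma unit_digit (x : R) : 0 <= x < 1 ->
  exists (i : 'I_N) (y : R), 0 <= y < 1 /\ x = (i%:R + y) / N%:R.
Proof.
move=> /andP[x0 x1].
have Nx0 : 0 <= N%:R * x by rewrite mulr_ge0// ltW.
have /andP[h1 h2] := truncn_itv Nx0.
have iN : (Num.truncn (N%:R * x) < N)%N.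
  rewrite -(ltr_nat R); apply: le_lt_trans h1 _.
  by rewrite -[ltRHS]mulr1 ltr_pM2l.
exists (Ordinal iN), (N%:R * x - (Num.truncn (N%:R * x))%:R); split.
  by rewrite -natr1 in h2; apply/andP; split; lra.
by rewrite /=; field; rewrite gt_eqF.
Qed.

Let approx01 n x : 0 <= coding_approx n x <= 1.
Proof.
elim: n x => [|n IH] x; first by rewrite /= lexx ler01.
have [x01|xN] := boolP (0 <= x < 1); last by rewrite approx_out// lexx ler01.
by have [i [y [y01 ->]]] := unit_digit x01; rewrite approxS//; apply: b01.
Qed.

Let approx_nd x : nondecreasing_seq (coding_approx ^~ x).
Proof.
apply/nondecreasing_seqP => n; elim: n x => [|n IH] x.
  by have /andP[] := approx01 1 x.
have [x01|xN] := boolP (0 <= x < 1); last by rewrite !approx_out.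
by have [i [y [y01 ->]]] := unit_digit x01; rewrite !approxS//; apply: b_homo.
Qed.

Let measurable_b i : measurable_fun [set: B] (b i : B -> B).
Proof. by apply: nondecreasing_measurable => // x y _ _; apply: b_homo. Qed.

Let measurable_approx n : measurable_fun [set: B] (coding_approx n : B -> B).
Proof.
elim: n => [|n IH]; first exact: measurable_cst.
apply: measurable_sum => i; apply: measurable_funM.
  apply: (measurableT_comp (f := (\1_(`[i%:R, i.+1%:R[%classic : set B) : B -> R)) (g := (fun x : B => N%:R * x : B))).
    exact: measurable_indic.
  exact: measurable_funM.
apply: (measurableT_comp (measurable_b i)).
apply: (measurableT_comp IH).
by apply: measurable_funB => //; exact: measurable_funM.
Qed.

(** The approximations increase with [n], so they converge pointwise, and the functional equation
    passes to the limit by left continuity of the [b i]. First crossings, which may jump on the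
    right, satisfy this hypothesis. *)
Lemma self_similar_coding : exists pi : B -> B,
  [/\ measurable_fun [set: B] pi, forall x, 0 <= pi x <= 1 &
      forall (i : 'I_N) (y : R), 0 <= y < 1 ->
        pi ((i%:R + y) / N%:R) = b i (pi y)].
Proof.
pose pi (x : R) : R := limn (coding_approx ^~ x).
have cv x : (coding_approx ^~ x) @ \oo --> pi x.
  apply: (@nondecreasing_is_cvgn _ (coding_approx ^~ x)) => //.
  by exists 1 => _ [n _ <-]; have /andP[] := approx01 n x.
exists pi; split.
- apply: (@measurable_fun_cvg _ _ _ _ (fun n => coding_approx n)) => // x _; exact: cv.
- move=> x; apply/andP; split.
    by apply: limr_ge; [exact: cv|apply: nearW => n; have /andP[] := approx01 n x].
  by apply: limr_le; [exact: cv|apply: nearW => n; have /andP[] := approx01 n x].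
- move=> i y y01; apply: cvg_lim => //.
  rewrite -cvg_shiftS /=.
  under eq_fun do rewrite -/(coding_approx _.+1 _) approxS//.
  exact: b_left.
Qed.

(** Splitting [[0, 1[] according to the first base [N] digit and rescaling each of the [N] cells
    turns the functional equation of [pi] into self-similarity of the image of Lebesgue measure. *)
Lemma self_similar_measure (pi : B -> B) : measurable_fun [set: B] pi ->
  (forall (i : 'I_N) (y : R), 0 <= y < 1 -> pi ((i%:R + y) / N%:R) = b i (pi y)) ->
  exists P : probability B R,
    (forall A, P A = leb (pi @^-1` A `&` `[0%R, 1%R[)) /\
    forall A, measurable A -> P A = ((N%:R^-1)%:E * \sum_(i < N) P (b i @^-1` A))%E.
Proof.
move=> mpi piS.
have mpiC C : measurable C -> measurable (pi @^-1` C).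
  by move=> mC; rewrite -[X in measurable X]setTI; exact: mpi.
have m01 : measurable (`[0%R, 1%R[ : set B) by exact: measurable_itv.
have [|P PE] := @probability_of_measure _ _ R
  (measure_function_pushforward__canonical__measure_function_Measure (mrestr leb m01) mpi).
  rewrite /= /pushforward /mrestr preimage_setT setTI lebesgue_measure_itv/=.
  by rewrite lte_fin ltr01 sube0.
exists P; split => [A|A mA]; first by rewrite PE.
have PE' C : P C = leb (pi @^-1` C `&` `[0%R, 1%R[) by rewrite PE.
have mbC i : measurable (b i @^-1` A).
  by rewrite -[X in measurable X]setTI; exact: measurable_b.
rewrite PE'.
pose D (i : 'I_N) : set B := `[(i%:R / N%:R : R), i.+1%:R / N%:R[%classic.
have mD i : measurable (D i) by exact: measurable_itv.
have dig i y : (0 <= y < 1) = (((i%:R + y) / N%:R) \in (`[i%:R / N%:R, i.+1%:R / N%:R[ : interval R)).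
  rewrite in_itv/= ler_pM2r ?invr_gt0// ltr_pM2r ?invr_gt0// -natr1.
  by rewrite lerDl ltrD2l.
have -> : pi @^-1` A `&` `[0%R, 1%R[ = \big[setU/set0]_(i < N) (pi @^-1` A `&` D i).
  rewrite -bigcup_seq.
  apply/seteqP; split => x /=.
    move=> [Ax]; rewrite in_itv/= => x01; have [i [y [y01 xE]]] := unit_digit x01.
    by exists i; [exact: mem_index_enum|split => //; rewrite /D /= xE -dig].
  move=> [i _ [Ax]]; rewrite /D/= !in_itv/= => /andP[h1 h2]; split => //; apply/andP; split.
    by apply: le_trans h1; rewrite divr_ge0// ltW.
  by apply: (lt_le_trans h2); rewrite ler_pdivrMr// mul1r ler_nat.
rewrite measure_bigsetU_ord//=; last 2 first.
- by move=> i; apply: measurableI => //; exact: mpiC.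
- apply/trivIsetP => i j _ _ ij; apply/seteqP; split => x //= -[[_ +] [_ +]].
  rewrite /D/= !in_itv/= => /andP[h1 h2] /andP[h3 h4].
  have {}h1 := le_lt_trans h1 h4; have {}h3 := le_lt_trans h3 h2.
  move: h1 h3; rewrite !ltr_pM2r ?invr_gt0// !ltr_nat !ltnS => h1 h3.
  by move/negP: ij; apply; apply/eqP/val_inj/eqP; rewrite eqn_leq h1 h3.
rewrite ge0_sume_distrr//; apply: eq_bigr => i _.
rewrite (@lebesgue_scale_shift _ N i%:R)//; last by apply: measurableI => //; exact: mpiC.
rewrite PE'; congr (_ * leb _)%E; apply/seteqP; split => y /=.
  move=> [Ay Dy]; move: Dy; rewrite /D/= -dig => y01; split; last by rewrite in_itv.
  by rewrite -piS.
by rewrite in_itv/= => -[Ay y01]; split; [rewrite piS|rewrite /D/= -dig].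
Qed.

End self_similar.

(** * Entropy of finite partitions *)

Section finite_entropy.
Context {R : realType}.

Lemma ln_prod (I : Type) (r : seq I) (F : I -> R) : (forall i, 0 < F i) ->
  ln (\prod_(i <- r) F i) = \sum_(i <- r) ln (F i).
Proof.
move=> F0; elim: r => [|i r IH]; first by rewrite !big_nil ln1.
by rewrite !big_cons lnM ?posrE ?IH ?prodr_gt0.
Qed.

(** Termwise this is [ln t <= t - 1] at [t = q a / p a]. The third hypothesis counters the
    convention [ln 0 = 0], by which a zero of [q] would make the right-hand side too small. *)
Lemma gibbs_inequality (A : finType) (p q : A -> R) :
  (forall a, 0 <= p a) -> (forall a, 0 <= q a) ->
  (forall a, 0 < p a -> 0 < q a) -> \sum_a q a <= \sum_a p a ->
  - \sum_a p a * ln (p a) <= - \sum_a p a * ln (q a).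
Proof.
move=> p0 q0 pq qp; rewrite lerN2 -subr_ge0 -sumrB.
apply: (@le_trans _ _ (\sum_a (p a - q a))); first by rewrite sumrB subr_ge0.
apply: ler_sum => a _.
have := p0 a; rewrite le_eqVlt => /predU1P[<-|pa].
  by rewrite !mul0r subr0 sub0r oppr_le0.
have qa := pq _ pa.
rewrite -mulrBr -lerN2 opprB -mulrN opprB.
have h : ln (q a / p a) <= q a / p a - 1.
  rewrite -[X in ln X](subrK 1) addrC; apply: le_ln1Dx.
  by rewrite ltrBrDr addrC subrr divr_gt0.
rewrite ln_div ?posrE// in h.
apply: (le_trans (ler_wpM2l (p0 a) h)).
by rewrite mulrBr mulr1 mulrCA mulfV ?mulr1 ?gt_eqF.
Qed.

Lemma cvg_invn : (fun n => n%:R^-1 : R) @ \oo --> (0 : R).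
Proof.
apply/(@gtr0_cvgV0 _ _ _ _ (fun n => n%:R : R)); last exact: cvgr_idn.
by near=> n; rewrite ltr0n; near: n; exact: nbhs_infty_gt.
Unshelve. all: by end_near. Qed.

(** Dividing [n] by a fixed [K] bounds [u n] by [(n / K) * u K] up to a bounded remainder, so the
    limit is the infimum of the quotients. *)
Lemma fekete (u : nat -> R) : (forall n, 0 <= u n) ->
  (forall n m, u (n + m)%N <= u n + u m) ->
  cvgn (fun n => u n / n%:R).
Proof.
move=> u0 usub.
(* The index is shifted because [u 0 / 0] would be the junk value 0. *)
pose E := [set u n.+1 / n.+1%:R | n in setT].
have lE : has_lbound E.
  by exists 0 => _ [n _ <-]; rewrite divr_ge0.
have infE : has_inf E by split => //; exists (u 1%N / 1%:R), 0%N.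
apply/cvg_ex; exists (inf E); apply/cvgrPdist_lt => e e0.
have e20 : 0 < e / 2 by rewrite divr_gt0.
have [_ [k _ <-] hk] := inf_adherent e20 infE.
set K := k.+1 in hk.
have K0 : 0 < K%:R :> R by rewrite ltr0n.
pose M := \sum_(i < K) u i.
have M0 : 0 <= M by apply: sumr_ge0.
have uqr q s : u (q * K + s)%N <= q%:R * u K + u s.
  elim: q => [|q IH]; first by rewrite mul0n mul0r add0n add0r.
  rewrite mulSn -addnA; apply: (le_trans (usub _ _)).
  by rewrite -natr1 mulrDl mul1r; lra.
have [n0 hn0] : exists n0, forall n, (n0 <= n)%N -> M <= (e / 2) * n%:R.
  exists (Num.truncn (M / (e / 2))).+1 => n hn.
  rewrite mulrC -ler_pdivrMr//; apply: ltW.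
  have /andP[_ h2] := truncn_itv (divr_ge0 M0 (ltW e20)).
  by apply: (lt_le_trans h2); rewrite ler_nat.
near=> n.
have n_gt0 : (0 < n)%N by near: n; exact: nbhs_infty_gt.
have n0n : (n0 <= n)%N by near: n; exact: nbhs_infty_ge.
have nR : 0 < n%:R :> R by rewrite ltr0n.
have h1 : inf E <= u n / n%:R.
  by apply: ge_inf => //; exists n.-1 => //; rewrite prednK.
rewrite distrC ger0_norm ?subr_ge0// ltrBlDr ltr_pdivrMr//.
have un : u n <= (n %/ K)%:R * u K + M.
  rewrite {1}(divn_eq n K); apply: (le_trans (uqr _ _)); rewrite lerD2l.
  have lt_nK : (n %% K < K)%N by rewrite ltn_mod.
  rewrite /M (bigD1 (Ordinal lt_nK))//= lerDl; exact: sumr_ge0.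
have qn : (n %/ K)%:R <= n%:R / K%:R :> R.
  by rewrite ler_pdivlMr// -natrM ler_nat leq_trunc_div.
have h2 := hn0 _ n0n.
have uK0 := u0 K.
have h3 : (n %/ K)%:R * u K <= n%:R * (u K / K%:R).
  by rewrite mulrCA mulrC; apply: ler_wpM2l.
have h4 : n%:R * (u K / K%:R) < n%:R * (inf E + e / 2) by rewrite ltr_pM2l.
have -> : (e + inf E) * n%:R = n%:R * (inf E + e / 2) + e / 2 * n%:R by lra.
lra.
Unshelve. all: by end_near. Qed.

End finite_entropy.

(** * Shannon entropy of labels with values in a finite type *)

Section label_entropy.
Context d {T : measurableType d} {R : realType} (P : probability T R).
Implicit Types (A B : finType).

Definition law A (X : T -> A) (a : A) : R := fine (P (X @^-1` [set a])).

Definition measurable_label A (X : T -> A) :=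
  forall a, measurable (X @^-1` [set a]).

Definition label_entropy A (X : T -> A) : R :=
  - \sum_a law X a * ln (law X a).

Lemma measurable_label_event A (X : T -> A) (S : pred A) :
  measurable_label X -> measurable [set x | S (X x)].
Proof.
move=> mX.
have -> : [set x | S (X x)] = \bigcup_(a in [set a | S a]) (X @^-1` [set a]).
  by apply/seteqP; split => [x Sx|x [a Sa /= ->]//]; exists (X x).
apply: fin_bigcup_measurable => // ; exact: finite_finset.
Qed.

Lemma measurable_label_comp A B (X : T -> A) (g : A -> B) :
  measurable_label X -> measurable_label (g \o X).
Proof.
move=> mX b.
rewrite (_ : _ @^-1` _ = [set x | (fun a => g a == b) (X x)]).
  exact: (measurable_label_event (fun a => g a == b)).
by apply/seteqP; split => x /= /eqP.
Qed.

Lemma measurable_label_pair A B (X : T -> A) (Y : T -> B) :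
  measurable_label X -> measurable_label Y ->
  measurable_label (fun x => (X x, Y x)).
Proof.
move=> mX mY [a b].
rewrite (_ : _ @^-1` _ = X @^-1` [set a] `&` Y @^-1` [set b]).
  exact: measurableI.
by apply/seteqP; split => x /= => [[-> ->]|[-> ->]].
Qed.

Lemma measurable_label_ffun (I : finType) A (X : T -> I -> A) :
  (forall i, measurable_label (X ^~ i)) ->
  measurable_label (fun x => [ffun i => X x i]).
Proof.
move=> mX w.
rewrite (_ : _ @^-1` _ = \bigcap_(i in [set: I]) (X ^~ i @^-1` [set w i])).
  by apply: fin_bigcap_measurable => // i _; exact: mX.
apply/seteqP; split => [x /= <- i _ /=|x /= h]; first by rewrite ffunE.
by apply/ffunP => i; rewrite ffunE h.
Qed.

Lemma law_ge0 A (X : T -> A) a : 0 <= law X a.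
Proof. by rewrite /law fine_ge0. Qed.

Lemma lawE A (X : T -> A) a : measurable_label X ->
  (law X a)%:E = P (X @^-1` [set a]).
Proof. by move=> mX; rewrite /law fineK// fin_num_measure. Qed.

Lemma law_event A (X : T -> A) (S : pred A) : measurable_label X ->
  \sum_(a | S a) law X a = fine (P [set x | S (X x)]).
Proof.
move=> mX.
suff H (s : seq A) : uniq s ->
    (\sum_(a <- s) law X a)%:E = P [set x | X x \in s].
  rewrite -big_filter -[LHS]/(fine (\sum_(a <- _) law X a)%:E) H ?filter_uniq ?index_enum_uniq//.
  congr (fine (P _)); apply/seteqP; split => x /=; rewrite mem_filter mem_index_enum andbT//.
elim: s => [_|a s IH /= /andP[as_ us]].
  rewrite big_nil (_ : [set _ | _] = set0) ?measure0//.
  by apply/seteqP; split => x.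
rewrite big_cons EFinD IH// lawE// -measureU//.
- congr (P _); apply/seteqP; split => x /=; rewrite in_cons.
    by move=> [->|->]; rewrite ?eqxx ?orbT.
  by move=> /orP[/eqP|]; auto.
- exact: measurable_label_event.
- by apply/seteqP; split => x //= -[-> ]; rewrite (negbTE as_).
Qed.

Lemma law_sum A (X : T -> A) : measurable_label X -> \sum_a law X a = 1.
Proof.
move=> mX; rewrite (law_event predT)// (_ : [set _ | _] = setT) ?probability_setT//.
by apply/seteqP; split.
Qed.

Lemma law_le1 A (X : T -> A) a : measurable_label X -> law X a <= 1.
Proof.
move=> mX; rewrite -(law_sum mX) (bigD1 a)//= lerDl.
by apply: sumr_ge0 => *; exact: law_ge0.
Qed.

Lemma law_comp A B (X : T -> A) (g : A -> B) b : measurable_label X ->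
  law (g \o X) b = \sum_(a | g a == b) law X a.
Proof.
move=> mX; rewrite (law_event (fun a => g a == b))//.
by congr (fine (P _)); apply/seteqP; split => x /= /eqP.
Qed.

Lemma sum_law_comp A B (X : T -> A) (g : A -> B) (F : B -> R) :
  measurable_label X ->
  \sum_b law (g \o X) b * F b = \sum_a law X a * F (g a).
Proof.
move=> mX; rewrite [RHS](partition_big g predT)//=; apply: eq_bigr => b _.
by rewrite law_comp// mulr_suml; apply: eq_bigr => a /eqP ->.
Qed.

Lemma law_comp_ge A B (X : T -> A) (g : A -> B) a : measurable_label X ->
  law X a <= law (g \o X) (g a).
Proof.
move=> mX; rewrite law_comp// (bigD1 a)//= lerDl.
by apply: sumr_ge0 => *; exact: law_ge0.
Qed.

Lemma label_entropy_comp A B (X : T -> A) (g : A -> B) : measurable_label X ->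
  label_entropy (g \o X) <= label_entropy X.
Proof.
move=> mX; rewrite /label_entropy lerN2 sum_law_comp//.
apply: ler_sum => a _; have := law_ge0 X a.
rewrite le_eqVlt => /predU1P[<-|la]; first by rewrite !mul0r.
rewrite ler_pM2l// ler_ln ?posrE//; first exact: law_comp_ge.
exact: lt_le_trans (law_comp_ge _ _ _).
Qed.

Lemma label_entropy_ge0 A (X : T -> A) : measurable_label X -> 0 <= label_entropy X.
Proof.
move=> mX; rewrite oppr_ge0; apply: sumr_le0 => a _.
by rewrite mulr_ge0_le0 ?law_ge0// ln_le0// law_le1.
Qed.

Lemma label_entropy_ge A (X : T -> A) (e : R) : measurable_label X ->
  (forall a, law X a <= e) -> - ln e <= label_entropy X.
Proof.
move=> mX le; rewrite /label_entropy lerN2.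
rewrite -[leRHS]mul1r -(law_sum mX) mulr_suml; apply: ler_sum => a _.
have := law_ge0 X a; rewrite le_eqVlt => /predU1P[<-|la]; first by rewrite !mul0r.
by rewrite ler_pM2l// ler_ln ?posrE// (lt_le_trans la).
Qed.

(** Gibbs' inequality with [q] as a coding law: [- ln (q a)] is a code length for [a], and the
    entropy is at most the mean length. *)
Lemma label_entropy_le A (X : T -> A) (q : A -> R) : measurable_label X ->
  (forall a, 0 < q a) -> \sum_a q a <= 1 ->
  label_entropy X <= \sum_a law X a * - ln (q a).
Proof.
move=> mX q0 q1; under eq_bigr do rewrite mulrN.
rewrite sumrN; apply: gibbs_inequality => //.
- by move=> a; exact: law_ge0.
- by move=> a; exact: ltW.
- by rewrite law_sum.
Qed.

(** Gibbs' inequality for the joint law against the product of its marginals. *)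
Lemma label_entropy_pair A B (X : T -> A) (Y : T -> B) :
  measurable_label X -> measurable_label Y ->
  label_entropy (fun x => (X x, Y x)) <= label_entropy X + label_entropy Y.
Proof.
move=> mX mY; set Z := fun x => (X x, Y x).
have mZ : measurable_label Z by exact: measurable_label_pair.
have EX : X = fst \o Z by [].
have EY : Y = snd \o Z by [].
apply: (@le_trans _ _ (- \sum_ab law Z ab * ln (law X ab.1 * law Y ab.2))).
  apply: gibbs_inequality.
  - by move=> ?; exact: law_ge0.
  - by move=> ?; rewrite mulr_ge0 ?law_ge0.
  - move=> ab ab0; rewrite mulr_gt0//.
      by apply: (lt_le_trans ab0); rewrite EX; exact: law_comp_ge.
    by apply: (lt_le_trans ab0); rewrite EY; exact: law_comp_ge.
  - rewrite law_sum// -(pair_bigA _ (fun a b => law X a * law Y b))/=.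
    under eq_bigr do rewrite -mulr_sumr law_sum// mulr1.
    by rewrite law_sum.
rewrite /label_entropy -opprD lerN2 EX EY !sum_law_comp// -big_split/= -EX -EY.
apply: ler_sum => ab _; rewrite -mulrDr.
have := law_ge0 Z ab; rewrite le_eqVlt => /predU1P[<-|ab0]; first by rewrite !mul0r.
rewrite lnM// ?posrE.
  by apply: (lt_le_trans ab0); rewrite EX; exact: law_comp_ge.
by apply: (lt_le_trans ab0); rewrite EY; exact: law_comp_ge.
Qed.

End label_entropy.

(** * Entropy of itineraries under an invariant measure *)

Section process_entropy.
Context d {T : measurableType d} {R : realType} (P : probability T R).
Context (f : T -> T) (mf : measurable_fun setT f) (Pf : invariant_measure f P).

Definition itinerary A (p : T -> A) n (x : T) : {ffun 'I_n -> A} :=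
  [ffun i : 'I_n => p (iter i f x)].

Lemma measurable_iter n : measurable_fun setT (iter n f).
Proof. by elim: n => [|n IH]; [exact: measurable_id|exact: (measurableT_comp mf IH)]. Qed.

Lemma measurable_preimage_iter n A : measurable A -> measurable (iter n f @^-1` A).
Proof. by move=> mA; rewrite -[X in measurable X]setTI; exact: measurable_iter. Qed.

Lemma invariant_iter n A : measurable A -> P (iter n f @^-1` A) = P A.
Proof.
move=> mA; elim: n => [//|n IH]; rewrite -[RHS]IH -[RHS]Pf; last exact: measurable_preimage_iter.
by congr (P _); apply/seteqP; split => x; rewrite /= -iterSr.
Qed.

Lemma measurable_itinerary (A : finType) (p : T -> A) n :
  measurable_label p -> measurable_label (itinerary p n).
Proof.
move=> mp; apply: measurable_label_ffun => i a.
exact: measurable_preimage_iter (mp a).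
Qed.

Lemma law_iter (A : finType) (X : T -> A) n a : measurable_label X ->
  law P (X \o iter n f) a = law P X a.
Proof. by move=> mX; rewrite /law -(invariant_iter n (mX a)). Qed.

Lemma cylinderE k (p : T -> 'I_k) n w : cylinder f p w = itinerary p n @^-1` [set w].
Proof.
apply/seteqP; split => x /=.
  by move=> h; apply/ffunP => i; rewrite ffunE.
by move=> <- i; rewrite ffunE.
Qed.

Lemma join_entropyE k (p : T -> 'I_k) n :
  join_entropy P f p n = label_entropy P (itinerary p n).
Proof. by rewrite /join_entropy; under eq_bigr do rewrite cylinderE. Qed.

Lemma join_entropy_ge0 k (p : T -> 'I_k) n :
  measurable_partition p -> 0 <= join_entropy P f p n.
Proof.
by move=> mp; rewrite join_entropyE; apply/label_entropy_ge0/measurable_itinerary.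
Qed.

(** A long itinerary glues that of [x] and that of [iter n f x]; by invariance the second one has
    the law of an itinerary of length [m]. *)
Lemma join_entropyD k (p : T -> 'I_k) n m : measurable_partition p ->
  join_entropy P f p (n + m) <= join_entropy P f p n + join_entropy P f p m.
Proof.
move=> mp; rewrite !join_entropyE.
pose glue (uv : {ffun 'I_n -> 'I_k} * {ffun 'I_m -> 'I_k}) : {ffun 'I_(n + m) -> 'I_k} :=
  [ffun i => match fintype.split i with inl j => uv.1 j | inr j => uv.2 j end].
pose Y := itinerary p m \o iter n f.
have mX := measurable_itinerary (n:=n) mp.
have mY : measurable_label Y.
  by move=> a; exact: (measurable_preimage_iter n (measurable_itinerary mp a)).
have -> : itinerary p (n + m) = glue \o (fun x => (itinerary p n x, Y x)).
  apply/funext => x; apply/ffunP => i; rewrite !ffunE/=.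
  by case: splitP => j ij; rewrite ffunE/= ij// addnC iterD.
apply: (le_trans (label_entropy_comp _ _ _)); first exact: measurable_label_pair.
apply: (le_trans (label_entropy_pair _ _ _)) => //.
suff -> : label_entropy P Y = label_entropy P (itinerary p m) by [].
congr (- _); apply: eq_bigr => a _.
by rewrite !(law_iter _ _ (measurable_itinerary (n:=m) mp)).
Qed.

Lemma cvg_join_entropy k (p : T -> 'I_k) : measurable_partition p ->
  cvgn (fun n => join_entropy P f p n / n%:R).
Proof.
move=> mp; apply: fekete => *; first exact: join_entropy_ge0.
exact: join_entropyD.
Qed.

Lemma partition_entropyE k (p : T -> 'I_k) : measurable_partition p ->
  partition_entropy P f p = (limn (fun n => join_entropy P f p n / n%:R))%:E.
Proof. by move=> mp; rewrite -EFin_lim//; exact: cvg_join_entropy. Qed.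

Lemma partition_entropy_ge k (p : T -> 'I_k) (c C : R) : measurable_partition p ->
  (forall n, c * n%:R - C <= join_entropy P f p n) ->
  (c%:E <= partition_entropy P f p)%E.
Proof.
move=> mp h; rewrite partition_entropyE// lee_fin.
have cC : (fun n => c - C * n%:R^-1) @ \oo --> c.
  rewrite -[X in _ --> X]subr0 -[X in _ - X](mulr0 C).
  apply: cvgB; first exact: cvg_cst.
  by apply: cvgM; [exact: cvg_cst|exact: cvg_invn].
rewrite -(cvg_lim _ cC)//; apply: ler_lim.
- by apply/cvg_ex; exists c.
- exact: cvg_join_entropy.
near=> n; rewrite ler_pdivlMr ?ltr0n; last by near: n; exact: nbhs_infty_gt.
rewrite mulrBl -mulrA mulVf ?mulr1//.
by rewrite pnatr_eq0 -lt0n; near: n; exact: nbhs_infty_gt.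
Unshelve. all: by end_near. Qed.

Lemma partition_entropy_le k (p : T -> 'I_k) (c C : R) : measurable_partition p ->
  (forall n, join_entropy P f p n <= c * n%:R + C) ->
  (partition_entropy P f p <= c%:E)%E.
Proof.
move=> mp h; rewrite partition_entropyE// lee_fin.
have cC : (fun n => c + C * n%:R^-1) @ \oo --> c.
  rewrite -[X in _ --> X]addr0 -[X in _ + X](mulr0 C).
  apply: cvgD; first exact: cvg_cst.
  by apply: cvgM; [exact: cvg_cst|exact: cvg_invn].
rewrite -(cvg_lim _ cC)//; apply: ler_lim.
- exact: cvg_join_entropy.
- by apply/cvg_ex; exists c.
near=> n; rewrite ler_pdivrMr ?ltr0n; last by near: n; exact: nbhs_infty_gt.
rewrite mulrDl -mulrA mulVf ?mulr1//.
by rewrite pnatr_eq0 -lt0n; near: n; exact: nbhs_infty_gt.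
Unshelve. all: by end_near. Qed.

(* Gibbs' inequality against the law under which the symbols of [al] are fair
   coin tosses and [p] differs from its prediction [q] with probability 1/2,
   uniformly. *)
Lemma join_entropy_approx k (p : T -> 'I_k.+1) (al : T -> bool) l
    (q : {ffun 'I_l -> bool} -> 'I_k.+1) n :
  measurable_partition p -> measurable_label al ->
  join_entropy P f p n <= (n + l)%:R * ln 2 + n%:R *
    (ln 2 + fine (P [set x | p x != q (itinerary al l x)]) * ln (2 * k.+1%:R)).
Proof.
move=> mp mal; set e := fine _; rewrite join_entropyE.
pose Z x := (itinerary p n x, itinerary al (n + l) x).
have mX := measurable_itinerary (n:=n) mp.
have mU := measurable_itinerary (n:=n + l) mal.
have mZ : measurable_label Z by exact: measurable_label_pair.
apply: (@le_trans _ _ (label_entropy P Z)).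
  exact: (label_entropy_comp P fst mZ).
(* [K a b] is the probability of [a] when [b] is predicted; its uniform part keeps it positive. *)
pose K (a b : 'I_k.+1) : R := (a == b)%:R / 2 + (2 * k.+1%:R)^-1.
have k0 : 0 < k.+1%:R :> R by rewrite ltr0n.
have k20 : 0 < (2 * k.+1%:R)^-1 :> R by rewrite invr_gt0 mulr_gt0.
have K0 a b : 0 < K a b by rewrite /K ltr_wpDl// mulr_ge0// invr_ge0.
have add_lt (i : 'I_n) (j : 'I_l) : (i + j < n + l)%N.
  by rewrite -addSn leq_add// ltnW.
(* The prediction at time [i] reads [al] at the times [i] to [i + l - 1], so [n + l] symbols of [al]
   serve all times below [n]. *)
pose win (i : 'I_n) (u : {ffun 'I_(n + l) -> bool}) : {ffun 'I_l -> bool} :=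
  [ffun j => u (Ordinal (add_lt i j))].
pose Q (wu : {ffun 'I_n -> 'I_k.+1} * {ffun 'I_(n + l) -> bool}) : R :=
  2^-1 ^+ (n + l) * \prod_(i < n) K (wu.1 i) (q (win i wu.2)).
have K1 b : \sum_a K a b = 1.
  rewrite big_split/= -mulr_suml (bigD1 b)//= eqxx big1 ?addr0; last first.
    by move=> a /negbTE ->.
  rewrite sumr_const card_ord -mulr_natl mul1r; field.
  by rewrite addrC natr1 pnatr_eq0.
have pQ (wu : {ffun 'I_n -> 'I_k.+1} * {ffun 'I_(n + l) -> bool}) : 0 < \prod_(i < n) K (wu.1 i) (q (win i wu.2)) by exact: prodr_gt0.
have half0 : 0 < 2^-1 ^+ (n + l) :> R by rewrite exprn_gt0.
have Q0 wu : 0 < Q wu by rewrite /Q mulr_gt0.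
have Q1 : \sum_wu Q wu <= 1.
  rewrite -(pair_bigA _ (fun w u => Q (w, u)))/= exchange_big/=.
  rewrite (eq_bigr (fun=> 2^-1 ^+ (n + l))); last first.
    move=> u _; rewrite /Q/= -mulr_sumr.
    rewrite -(bigA_distr_bigA (fun i a => K a (q (win i u)))).
    by rewrite big1 ?mulr1// => i _; exact: K1.
  rewrite sumr_const card_ffun card_bool card_ord -(mulr_natl (2^-1 ^+ (n + l))) natrX -exprMn.
  by rewrite mulfV// expr1n.
apply: (le_trans (label_entropy_le P mZ Q0 Q1)).
(* The code length splits over time: [ln 2] for each symbol of [al], at most [ln 2] for a correct
   prediction, [ln (2 * k.+1%:R)] for a wrong one. *)
have lnQ wu : - ln (Q wu) <= (n + l)%:R * ln 2 +
    \sum_(i < n) (ln 2 + (wu.1 i != q (win i wu.2))%:R * ln (2 * k.+1%:R)).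
  have -> : - ln (Q wu) = (n + l)%:R * ln 2 +
      \sum_(i < n) - ln (K (wu.1 i) (q (win i wu.2))).
    rewrite [ln (Q wu)]lnM ?posrE// opprD sumrN ln_prod//; congr (_ + _).
    by rewrite lnXn ?invr_gt0// lnV ?posrE// mulNrn opprK mulr_natl.
  rewrite lerD2l.
  apply: ler_sum => i _; rewrite lerNl.
  have ln2 : 0 <= ln 2 :> R by rewrite ln_ge0// ler1n.
  rewrite /K; case: eqVneq => _ /=.
    rewrite mul0r addr0 -lnV ?posrE// ler_ln ?posrE ?invr_gt0//.
    by rewrite mul1r lerDl ltW.
  by rewrite mul0r add0r mul1r lnV ?posrE ?mulr_gt0// lerN2 lerDr.
apply: (@le_trans _ _ (\sum_wu law P Z wu * ((n + l)%:R * ln 2 +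
    \sum_(i < n) (ln 2 + (wu.1 i != q (win i wu.2))%:R * ln (2 * k.+1%:R))))).
  by apply: ler_sum => wu _; apply: ler_wpM2l; rewrite ?law_ge0.
under eq_bigr do rewrite mulrDr.
rewrite big_split/= -mulr_suml law_sum// mul1r lerD2l.
under eq_bigr do rewrite mulr_sumr.
rewrite exchange_big/=.
have -> : n%:R * (ln 2 + e * ln (2 * k.+1%:R)) =
    \sum_(i < n) (ln 2 + e * ln (2 * k.+1%:R)).
  by rewrite sumr_const card_ord mulr_natl.
apply: ler_sum => i _.
under eq_bigr do rewrite mulrDr.
rewrite big_split/= -mulr_suml law_sum// mul1r lerD2l.
under eq_bigr do rewrite mulrA.
rewrite -mulr_suml ler_wpM2r ?ln_ge0//.
  by rewrite -natrM ler1n muln_gt0.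
under eq_bigr do rewrite mulr_natr mulrb.
rewrite -big_mkcond/= (law_event P (fun wu : _ * {ffun 'I_(n + l) -> bool} =>
  (wu.1 : {ffun 'I_n -> 'I_k.+1}) i != q (win i wu.2)))//.
(* By invariance the prediction errs with the same probability at every time [i]. *)
have -> : e = fine (P (iter i f @^-1` [set x | p x != q (itinerary al l x)])).
  rewrite invariant_iter//.
  exact: (measurable_label_event (fun wu : 'I_k.+1 * {ffun 'I_l -> bool} => wu.1 != q wu.2)
    (measurable_label_pair mp (measurable_itinerary (n:=l) mal))).
have winE x : win i (itinerary al (n + l) x) = itinerary al l (iter i f x).
  by apply/ffunP => j; rewrite !ffunE/= addnC iterD.
rewrite le_eqVlt; apply/orP; left; apply/eqP; congr (fine (P _)).
by apply/seteqP; split => x /=; rewrite ffunE winE.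
Qed.

End process_entropy.

(** * The Bernoulli measure of the affine branches *)

Lemma compact_separated (R : realType) (K L : set R) :
  compact K -> compact L -> K `&` L = set0 ->
  exists2 e : R, 0 < e & forall x y, K x -> L y -> e <= `|x - y|.
Proof.
move=> cK cL KL0.
have clL : closed L by apply: compact_closed.
have /compact_near_coveringP ncK := cK.
have := ncK _ (0 : R)^'+ (fun e x => forall y, L y -> e <= `|x - y|) _.
have H : forall x, K x -> \forall x' \near x & e \near (0 : R)^'+, forall y, L y -> e <= `|x' - y|.
  move=> x Kx.
  have nLx : ~ L x by move=> Lx; have : (K `&` L) x by []; rewrite KL0.
  have oL : open (~` L) by rewrite openC.
  have [r r0 hr] : exists2 r : R, 0 < r & ball x r `<=` ~` L.
    by have /nbhs_ballP[r r0 hr] := open_nbhs_nbhs (conj oL nLx); exists r.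
  exists (ball x (r / 2), [set e | e < r / 2]).
    split; first by apply: nbhsx_ballx; rewrite divr_gt0.
    by apply: nbhs_right_lt; rewrite divr_gt0.
  move=> [x' e] /= [xx' er] y Ly; rewrite leNgt; apply/negP => lt_e.
  apply: (hr y) => //; rewrite /ball/=.
  rewrite /ball/= in xx'.
  have -> : x - y = (x - x') + (x' - y) by ring.
  apply: (le_lt_trans (ler_normD _ _)); lra.
move=> /(_ _ H) => hnear.
near (0 : R)^'+ => e; exists e; first by near: e; exact: nbhs_right_gt.
have hK : K `<=` (fun x => forall y, L y -> e <= `|x - y|) by near: e; exact: hnear.
by move=> x y /hK; apply.
Unshelve. all: by end_near. Qed.

Lemma measure_bigsetU_le d (T : measurableType d) (R : realType)
    (m : {measure set T -> \bar R}) (I : Type) (s : seq I) (F : I -> set T) :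
  (forall i, measurable (F i)) ->
  (m (\big[setU/set0]_(i <- s) F i) <= \sum_(i <- s) m (F i))%E.
Proof.
move=> mF; elim: s => [|i s IH]; first by rewrite !big_nil measure0.
rewrite !big_cons; apply: (@le_trans _ _ (m (F i) + m (\big[setU/set0]_(i <- s) F i))%E).
  by apply: measureU2 => //; exact: bigsetU_measurable.
exact: leeD2l.
Qed.

Lemma probability_eq_on d (T : measurableType d) (R : realType) (P : probability T R)
    (S A B : set T) : measurable S -> measurable A -> measurable B ->
  P S = 1%E -> (forall x, S x -> A x <-> B x) -> P A = P B.
Proof.
move=> mS mA mB PS AB.
have PSC : P (~` S) = 0%E by rewrite probability_setC// PS subee.
have H C : measurable C -> P C = P (C `&` S).
  move=> mC; rewrite (measureDI P mC mS) [X in (X + _)%E](_ : _ = 0%E) ?add0e//.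
  apply/eqP; rewrite -measure_le0 -PSC; apply: le_measure; rewrite ?inE//.
  - exact: measurableD.
  - exact: measurableC.
rewrite H// [RHS]H//; congr (P _); apply/seteqP.
by split => x [Cx Sx]; split => //; apply/AB.
Qed.

Section cantor_branches.
Context {R : realType}.
Variable lam : R.

(** The inverses of the two affine branches of the map, contracting towards their fixed points 0 and
    1. *)
Definition cbranch (b : bool) (y : R) : R := if b then 1 - (1 - y) / lam else y / lam.

(** It maps [[0, 1]] onto the cylinder of [w]. The first letter is applied last, so the dynamics
    deletes it and [iter j f] acts on codes as [drop j]. *)
Definition cword (w : seq bool) (y : R) : R := foldr cbranch y w.

Hypothesis lam8 : 8 <= lam.

Let lam0 : 0 < lam. Proof. by apply: lt_le_trans lam8. Qed.

Lemma cbranch01 b y : 0 <= y <= 1 -> 0 <= cbranch b y <= 1.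
Proof.
move=> /andP[y0 y1].
have h (z : R) : 0 <= z -> z <= 1 -> 0 <= z / lam <= 1.
  move=> z0 z1; rewrite divr_ge0 ?(ltW lam0)//= ler_pdivrMr// mul1r.
  by apply: (le_trans z1); have := lam8; lra.
rewrite /cbranch; case: b; last exact: h.
by have /andP[] := h (1 - y) ltac:(lra) ltac:(lra); move: (_ / _) => z h1 h2; apply/andP; split; lra.
Qed.

Lemma cbranch_side b y : 0 <= y <= 1 ->
  if b then 3 / 4 < cbranch b y else cbranch b y < 1 / 4.
Proof.
move=> /andP[y0 y1].
have h (z : R) : z <= 1 -> z / lam < 1 / 4.
  by move=> z1; rewrite ltr_pdivrMr//; have := lam8; lra.
rewrite /cbranch; case: b; last exact: h.
by have := h (1 - y) ltac:(lra); move: (_ / lam) => z; lra.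
Qed.

Lemma cbranch_homo b : {homo cbranch b : x y / x <= y}.
Proof.
move=> x y xy; rewrite /cbranch; case: b; last by rewrite ler_pM2r ?invr_gt0.
by rewrite lerD2l lerN2 ler_pM2r ?invr_gt0// lerD2l lerN2.
Qed.

Lemma cbranch_continuous b : continuous (cbranch b).
Proof.
move=> x; rewrite /cbranch; case: b.
  apply: cvgB; first exact: cvg_cst.
  by apply: cvgMl; apply: cvgB; [exact: cvg_cst|exact: cvg_id].
by apply: cvgMl; exact: cvg_id.
Qed.

Lemma cword01 w y : 0 <= y <= 1 -> 0 <= cword w y <= 1.
Proof. by move=> y01; elim: w => //= b w; exact: cbranch01. Qed.

Lemma cword_homo w : {homo cword w : x y / x <= y}.
Proof. by elim: w => //= b w IH x y xy; apply/cbranch_homo/IH. Qed.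

Lemma cword_continuous w : continuous (cword w).
Proof.
elim: w => [|b w IH] x /=; first exact: cvg_id.
exact: (continuous_comp (IH x) (@cbranch_continuous b _)).
Qed.

Lemma cwordB w x y : cword w x - cword w y = (x - y) / lam ^+ size w.
Proof.
elim: w => [|b w IH] /=; first by rewrite expr0 divr1.
have -> : cbranch b (cword w x) - cbranch b (cword w y) = (cword w x - cword w y) / lam.
  by rewrite /cbranch; case: b; field; rewrite gt_eqF.
by rewrite IH exprSr invfM mulrA.
Qed.

Lemma cword_cat u w y : cword (u ++ w) y = cword u (cword w y).
Proof. by rewrite /cword foldr_cat. Qed.

Variable f : measurableTypeR R -> measurableTypeR R.
Hypothesis fK : forall b y, 0 <= y <= 1 -> f (cbranch b y) = y.

Lemma iter_cword j w y : 0 <= y <= 1 -> (j <= size w)%N ->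
  iter j f (cword w y) = cword (drop j w) y.
Proof.
move=> y01; elim: j w => [|j IH] w jw; first by rewrite drop0.
case: w jw => // b w jw; rewrite iterSr [cword _ _]/= fK ?cword01//; exact: IH.
Qed.

Definition right_half (x : R) : bool := 1 / 2 < x.

Lemma right_half_cbranch b y : 0 <= y <= 1 -> right_half (cbranch b y) = b.
Proof.
move=> /(cbranch_side b); rewrite /right_half; case: b => h; first lra.
by apply/negbTE; rewrite -leNgt; lra.
Qed.

Lemma cword_surj w x : cword w 0 <= x <= cword w 1 ->
  exists2 y, 0 <= y <= 1 & x = cword w y.
Proof.
move=> /andP[x0 x1].
have pl : 0 < lam ^+ size w by rewrite exprn_gt0.
exists ((x - cword w 0) * lam ^+ size w).
  apply/andP; split; first by rewrite mulr_ge0 ?subr_ge0// ltW.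
  by rewrite -ler_pdivlMr// -[X in X / _]subr0 -cwordB lerD2r.
apply/eqP; rewrite -subr_eq0; apply/eqP.
have := cwordB w ((x - cword w 0) * lam ^+ size w) 0.
by rewrite subr0 mulfK ?gt_eqF//; lra.
Qed.

Hypothesis mf : measurable_fun setT f.
Local Notation B := (measurableTypeR R).
Local Notation leb := (@lebesgue_measure R).

Lemma measurable_right_half : measurable_label (right_half : B -> bool).
Proof.
move=> b; have -> : (right_half : B -> bool) @^-1` [set b] =
    if b then `]1 / 2, +oo[%classic else `]-oo, 1 / 2]%classic.
  rewrite /right_half; case: b; apply/seteqP; split => x /=; rewrite in_itv/= ?andbT//.
  - by move=> /negbT; rewrite -leNgt.
  - by move=> h; apply/negbTE; rewrite -leNgt.
by case: b; exact: measurable_itv.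
Qed.

Lemma measurable_cword w : measurable_fun [set: B] (cword w : B -> B).
Proof. by apply: nondecreasing_measurable => // x y; exact: cword_homo. Qed.

Lemma measurable_preimage_cword w (A : set B) : measurable A ->
  measurable ((cword w : B -> B) @^-1` A).
Proof. by move=> mA; rewrite -[X in measurable X]setTI; exact: measurable_cword. Qed.

(** The coding with [N = 2] is used; its binary digits are the [right_half] itinerary. The last
    clause says that itineraries generate modulo [mu]. It is proved in the digit space: atoms are
    approximated from inside by disjoint compact sets, and [l] common letters put two digit points
    within [2^-l] of each other. *)
Lemma cantor_measure : exists mu : probability B R,
  [/\ mu `[0, 1]%classic = 1%E,
      forall A, measurable A -> fine (mu A) =
        (fine (mu (cbranch false @^-1` A)) + fine (mu (cbranch true @^-1` A))) / 2 &
      forall k (p : B -> 'I_k.+1) (e : R), measurable_partition p -> 0 < e ->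
        exists l (q : {ffun 'I_l -> bool} -> 'I_k.+1),
          fine (mu [set x | p x != q (itinerary f right_half l x)]) <= e].
Proof.
pose b (i : 'I_2) := cbranch (i == 1 :> nat).
have b_homo i : {homo b i : x y / x <= y} by exact: cbranch_homo.
have b01 i (x : R) : 0 <= x <= 1 -> 0 <= b i x <= 1 by exact: cbranch01.
have b_left i (u : nat -> R) (l : R) : nondecreasing_seq u -> u @ \oo --> l ->
    (fun n => b i (u n)) @ \oo --> b i l.
  by move=> _ ul; apply: continuous_cvg => //; exact: cbranch_continuous.
have [pi [mpi pi01 piE]] := self_similar_coding (ltn0Sn 1) b_homo b01 b_left.
have [mu [muE muS]] := self_similar_measure (ltn0Sn 1) b_homo mpi piE.
have m01 : measurable (`[0, 1]%classic : set B) by exact: measurable_itv.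
have finmu A : measurable A -> mu A \is a fin_num by move=> mA; exact: fin_num_measure.
have mb i A : measurable A -> measurable ((b i : B -> B) @^-1` A).
  by move=> mA; exact: (measurable_preimage_cword [:: (i == 1 :> nat)] mA).
exists mu; split.
- rewrite muE (_ : _ `&` _ = `[0%R, 1%R[%classic); last first.
    by apply/seteqP; split => x /= => [[]//|]; split => //; rewrite in_itv/=; exact: pi01.
  by rewrite lebesgue_measure_itv/= lte_fin ltr01 sube0.
- move=> A mA; rewrite muS// big_ord_recl big_ord1 fineM ?fineD//; last first.
  - by rewrite fin_numD !finmu//; exact: mb.
  - by exact: finmu (mb _ _ mA).
  - by exact: finmu (mb _ _ mA).
  by rewrite mulrC.
move=> k p e mp e0.
have piS (i : 'I_2) (y : R) : 0 <= y < 1 ->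
    right_half (pi ((i%:R + y) / 2%:R)) = (i == 1 :> nat) /\
    f (pi ((i%:R + y) / 2%:R)) = pi y.
  by move=> y01; rewrite piE//; split; [exact: right_half_cbranch|exact: fK].
have itin_close l (x y : R) : 0 <= x < 1 -> 0 <= y < 1 ->
    (forall j, (j < l)%N -> right_half (iter j f (pi x)) = right_half (iter j f (pi y))) ->
    `|x - y| <= 2^-1 ^+ l.
  elim: l x y => [|l IH] x y x01 y01 h.
    by rewrite expr0 ler_norml; move: x01 y01 => /andP[? ?] /andP[? ?]; apply/andP; split; lra.
  have [i [x' [x'01 xE]]] := unit_digit (ltn0Sn 1) x01.
  have [i' [y' [y'01 yE]]] := unit_digit (ltn0Sn 1) y01.
  have [rx fx] := piS i x' x'01; have [ry fy] := piS i' y' y'01.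
  rewrite -xE in rx fx; rewrite -yE in ry fy.
  have ii' : i = i'.
    have := h 0%N isT; rewrite /= rx ry.
    by case: i {xE rx fx} => -[|[|//]] ?; case: i' {yE ry fy} => -[|[|//]] ? //= _; exact: val_inj.
  have := IH x' y' x'01 y'01.
  have -> : x - y = (x' - y') / 2 by rewrite xE yE ii'; field.
  move=> {}IH; rewrite normrM exprSr (@ger0_norm _ 2^-1)// ler_wpM2r//; apply: IH => j jl.
  by rewrite -fx -fy -!iterSr; exact: h.
pose A (i : 'I_k.+1) : set B := pi @^-1` (p @^-1` [set i]) `&` `[0%R, 1%R[%classic.
have mA i : measurable (A i).
  apply: measurableI; last exact: measurable_itv.
  by rewrite -[X in measurable X]setTI; exact: mpi.
have finA i : (leb (A i) < +oo)%E.
  apply: (@le_lt_trans _ _ (leb `[0%R, 1%R[%classic)).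
    by apply: le_measure; rewrite ?inE//; move=> x [].
  by rewrite lebesgue_measure_itv/= lte_fin ltr01 sube0 ltry.
have ek : 0 < e / k.+1%:R by rewrite divr_gt0.
(* Each atom may lose the mass [e / k.+1%:R], so that together they lose at most [e]. *)
have /choice[K KP] i := lebesgue_regularity_inner (mA i) (finA i) ek.
have [dl dl0 dlP] : exists2 dl : R, 0 < dl & forall i j x y, i != j ->
    K i x -> K j y -> dl <= `|x - y|.
  have H (ij : 'I_k.+1 * 'I_k.+1) : exists dl : R, 0 < dl /\ forall x y, ij.1 != ij.2 ->
      K ij.1 x -> K ij.2 y -> dl <= `|x - y|.
    have [cK1 KA1 _] := KP ij.1; have [cK2 KA2 _] := KP ij.2.
    have [<-|ne] := eqVneq ij.1 ij.2; first by exists 1; split.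
    have [|dl dl0 dlP] := compact_separated cK1 cK2.
      apply/seteqP; split => // x [/KA1[/= xi _] /KA2[/= xj _]].
      by move: ne; rewrite -xi -xj eqxx.
    by exists dl; split => // x y _; exact: dlP.
  have /choice[g gP] := H.
  exists (\big[Num.min/1]_ij g ij).
    by apply: lt_bigmin => // ij _; have [] := gP ij.
  move=> i j x y ij Kx Ky; apply: (@le_trans _ _ (g (i, j))); first exact: bigmin_le_cond.
  by have [_] := gP (i, j); apply.
have [l hl] : exists l, 2^-1 ^+ l < dl.
  exists (Num.truncn dl^-1).+1; set t := _.+1.
  have dli : 0 < dl^-1 by rewrite invr_gt0.
  have /andP[_ h] := truncn_itv (ltW dli).
  rewrite -[ltRHS]invrK exprVn ltf_pV2 ?posrE ?exprn_gt0//.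
  by apply: (lt_trans h); rewrite -natrX ltr_nat ltn_expl.
(* The prediction is the atom whose compact set contains a point with itinerary [u]; by the choice
   of [l] there is at most one. *)
pose q (u : {ffun 'I_l -> bool}) : 'I_k.+1 := odflt ord0
  [pick i | `[< exists2 x, K i x & itinerary f right_half l (pi x) = u >]].
exists l, q.
pose E := [set x | p x != q (itinerary f right_half l x)].
have mE : measurable E.
  exact: (measurable_label_event (fun wu : 'I_k.+1 * {ffun 'I_l -> bool} => wu.1 != q wu.2)
    (measurable_label_pair mp (measurable_itinerary mf (n:=l) measurable_right_half))).
have mAK i : measurable (A i `\` K i).
  apply: measurableD => //; have [cK _ _] := KP i.
  by apply: closed_measurable; exact: compact_closed.
have -> : e = fine (\sum_(i < k.+1) (e / k.+1%:R)%:E)%E.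
  by rewrite sumEFin/= sumr_const card_ord -[RHS]mulr_natr divfK ?pnatr_eq0.
rewrite fine_le ?finmu//; first by rewrite sumEFin.
rewrite -/E muE; apply: (@le_trans _ _ (\sum_(i < k.+1) leb (A i `\` K i))%E); last first.
  by apply: lee_sum => i _; have [_ _ /ltW] := KP i.
apply: (@le_trans _ _ (leb (\big[setU/set0]_(i < k.+1) (A i `\` K i)))); last first.
  exact: measure_bigsetU_le.
apply: le_measure; rewrite ?inE.
- apply: measurableI; last exact: measurable_itv.
  by rewrite -[X in measurable X]setTI; exact: mpi.
- exact: bigsetU_measurable.
move=> x [Ex x01]; rewrite -bigcup_seq; exists (p (pi x)); first exact: mem_index_enum.
split => // Kx; move: Ex; rewrite /E/= /q; case: pickP => [i|/(_ (p (pi x)))]; last first.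
  by move=> /negbT/asboolPn[]; exists x.
move=> /asboolP[y Ky ity] ne.
have := dlP _ _ _ _ ne Kx Ky; apply/negP; rewrite -ltNge.
apply: le_lt_trans hl; apply: itin_close; rewrite ?in_itv// in x01 *.
- by have [_ KA _] := KP i; have [_] := KA _ Ky; rewrite /= in_itv.
- by move=> j jl; move/ffunP: ity => /(_ (Ordinal jl)); rewrite !ffunE.
Qed.

End cantor_branches.

Lemma probability_fineK d (T : measurableType d) (R : realType) (P : probability T R) A :
  measurable A -> (fine (P A))%:E = P A.
Proof. by move=> mA; rewrite fineK// fin_num_measure. Qed.

Lemma ks_entropy_ge d (T : measurableType d) (R : realType) (P : probability T R)
    (f : T -> T) k (p : T -> 'I_k) (c C : R) :
  measurable_fun setT f -> invariant_measure f P -> measurable_partition p ->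
  (forall n, c * n%:R - C <= join_entropy P f p n) -> (c%:E <= ks_entropy f P)%E.
Proof.
move=> mf Pf mp h; apply: (le_trans (partition_entropy_ge mf Pf mp h)).
by apply: ereal_sup_ubound; exists k, p.
Qed.

(** * Invariance, ergodicity and entropy of the Bernoulli measure *)

Section cantor_dynamics.
Context {R : realType} (lam : R) (lam8 : 8 <= lam).
Local Notation B := (measurableTypeR R).
Variable f : B -> B.
Hypothesis fK : forall b y, 0 <= y <= 1 -> f (cbranch lam b y) = y.
Hypothesis mf : measurable_fun setT f.
Variable mu : probability B R.
Hypothesis mu01 : mu `[0, 1]%classic = 1%E.
Hypothesis muS : forall A, measurable A -> fine (mu A) =
  (fine (mu (cbranch lam false @^-1` A)) + fine (mu (cbranch lam true @^-1` A))) / 2.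
Hypothesis mu_approx : forall k (p : B -> 'I_k.+1) (e : R),
  measurable_partition p -> 0 < e ->
  exists l (q : {ffun 'I_l -> bool} -> 'I_k.+1),
    fine (mu [set x | p x != q (itinerary f (@right_half R) l x)]) <= e.

Let m01 : measurable (`[0, 1]%classic : set B). Proof. exact: measurable_itv. Qed.

Let eq_on (A C : set B) : measurable A -> measurable C ->
  (forall x, 0 <= x <= 1 -> A x <-> C x) -> mu A = mu C.
Proof.
move=> mA mC AC; apply: (probability_eq_on m01 mA mC mu01) => x /=.
by rewrite in_itv/=; exact: AC.
Qed.

Let mbranch b (A : set B) : measurable A -> measurable ((cbranch lam b : B -> B) @^-1` A).
Proof. by move=> mA; exact: (measurable_preimage_cword lam8 [:: b] mA). Qed.

Let mpre (A : set B) : measurable A -> measurable (f @^-1` A).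
Proof. by move=> mA; rewrite -[X in measurable X]setTI; exact: mf. Qed.

Lemma cantor_invariant : invariant_measure f mu.
Proof.
move=> A mA; rewrite -probability_fineK; last exact: mpre.
rewrite -[RHS]probability_fineK// muS; last exact: mpre.
have E b : mu (cbranch lam b @^-1` (f @^-1` A)) = mu A.
  apply: eq_on => //; first by apply: mbranch; exact: mpre.
  by move=> x x01 /=; rewrite fK.
by rewrite !E; congr EFin; field.
Qed.

(** The recursion on the word lets self-similarity of [mu] compute the measure one letter at a
    time. *)
Fixpoint cylinder_set (w : seq bool) : set B :=
  if w is b :: w' then [set x | right_half x = b /\ cylinder_set w' (f x)] else setT.

Lemma cylinder_setP w x : cylinder_set w x <->
  forall j, (j < size w)%N -> right_half (iter j f x) = nth false w j.
Proof.
elim: w x => [|b w IH] x //=; split => [[xb /IH h] [|j] jw //|h].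
  by rewrite iterSr; exact: h.
split; first exact: (h 0%N).
by apply/IH => j jw; rewrite -iterSr; exact: (h j.+1).
Qed.

Lemma measurable_cylinder_set w : measurable (cylinder_set w).
Proof.
elim: w => [|b w IH] /=; first exact: measurableT.
by apply: measurableI; [exact: measurable_right_half|exact: mpre].
Qed.

Lemma itinerary_cylinder_set l (u : {ffun 'I_l -> bool}) :
  itinerary f (@right_half R) l @^-1` [set u] = cylinder_set (fgraph u).
Proof.
apply/seteqP; split => x /=.
  move=> ux; apply/cylinder_setP => j; rewrite size_tuple card_ord => jl.
  by rewrite -[j]/(val (Ordinal jl)) nth_fgraph_ord -ux ffunE.
move=> /cylinder_setP h; apply/ffunP => j; rewrite ffunE h ?size_tuple ?card_ord//.
by rewrite nth_fgraph_ord.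
Qed.

(** An invariant [A] looks the same through both branches, and only the branch of the first letter
    meets the cylinder, so each letter halves the measure. *)
Lemma cantor_independent A w : measurable A -> f @^-1` A = A ->
  fine (mu (A `&` cylinder_set w)) = fine (mu A) / 2 ^+ size w.
Proof.
move=> mA fA; elim: w => [|b w IH]; first by rewrite /= setIT expr0 divr1.
have mAw : measurable (A `&` cylinder_set (b :: w)).
  by apply: measurableI => //; exact: measurable_cylinder_set.
have mAw' : measurable (A `&` cylinder_set w).
  by apply: measurableI => //; exact: measurable_cylinder_set.
have E c : mu (cbranch lam c @^-1` (A `&` cylinder_set (b :: w))) =
    if c == b then mu (A `&` cylinder_set w) else 0%E.
  have Ac x : 0 <= x <= 1 -> A (cbranch lam c x) <-> A x.
    by move=> x01; rewrite -{1}fA /= fK.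
  case: eqVneq Ac => [->|cb] Ac.
    apply: eq_on => //; first exact: mbranch.
    move=> x x01 /=; rewrite right_half_cbranch// fK//.
    by have := Ac x x01; tauto.
  rewrite -(measure0 mu); apply: eq_on => //; first exact: mbranch.
  move=> x x01 /=; rewrite right_half_cbranch//.
  by split => // -[_ [/eqP]]; rewrite (negbTE cb).
by rewrite muS// !E -[size (b :: w)]/((size w).+1) exprS invfM mulrCA -IH; case: b {mAw E} => /=;
   rewrite ?addr0 ?add0r mulrC.
Qed.

Lemma cantor_cylinder_set w : fine (mu (cylinder_set w)) = 2^-1 ^+ size w.
Proof.
by rewrite -[cylinder_set w]setTI cantor_independent// probability_setT/= mul1r exprVn.
Qed.

Lemma law_itinerary l u :
  law mu (itinerary f (@right_half R) l) u = 2^-1 ^+ l.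
Proof.
by rewrite /law itinerary_cylinder_set cantor_cylinder_set size_tuple card_ord.
Qed.

(** With [a] the mass of [A], the indicator of [A] is independent of all itineraries, so predicting
    it from one errs with probability at least [a (1 - a)]; by [mu_approx] the error can be made
    arbitrarily small. *)
Lemma cantor_ergodic : ergodic f mu.
Proof.
move=> A mA fA; set a := fine (mu A).
have muA : mu A = a%:E by rewrite probability_fineK.
have a0 : 0 <= a by rewrite fine_ge0.
have a1 : a <= 1 by rewrite -lee_fin -muA probability_le1.
suff : a * (1 - a) <= 0.
  move=> h; have : a * (1 - a) = 0.
    by apply/eqP; rewrite eq_le h mulr_ge0// subr_ge0.
  move=> /eqP; rewrite mulf_eq0 subr_eq0 => /orP[] /eqP E; [left|right].
    by rewrite muA E.
  by rewrite muA -E.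
apply/ler_addgt0Pr => e e0; rewrite add0r.
pose p (x : B) : 'I_2 := if `[< A x >] then ord_max else ord0.
have pE (b : 'I_2) : p @^-1` [set b] = if b == ord0 then ~` A else A.
  rewrite /p; apply/seteqP; split => x /=.
    by case: asboolP => Ax <-.
  case: ifPn => [/eqP -> Ax|b0 Ax].
    by case: asboolP.
  case: asboolP => // _; apply/val_inj; case: b b0 => -[|[|]]//.
have mp : measurable_partition p.
  by move=> b; rewrite pE; case: ifPn => _ //; exact: measurableC.
have [l [q Eq]] := mu_approx mp e0.
pose Z x := (p x, itinerary f (@right_half R) l x).
have mit := measurable_itinerary mf (n := l) (@measurable_right_half R).
have mZ : measurable_label Z by exact: measurable_label_pair.
apply: le_trans Eq.
rewrite -[leRHS](law_event mu (fun z : 'I_2 * {ffun 'I_l -> bool} => z.1 != q z.2) mZ).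
(* By independence this law is [a] or [1 - a] times [2^-l], and both [a] and [1 - a] are at least
   [a (1 - a)]. *)
have lawZ b u : a * (1 - a) * 2^-1 ^+ l <= law mu Z (b, u).
  have -> : law mu Z (b, u) = fine (mu (p @^-1` [set b])) * 2^-1 ^+ l.
    rewrite /law (_ : Z @^-1` _ = p @^-1` [set b] `&` cylinder_set (fgraph u)).
      rewrite cantor_independent//; first by rewrite size_tuple card_ord exprVn.
      by rewrite pE; case: ifPn => _ //; rewrite preimage_setC; congr (~` _).
    rewrite -itinerary_cylinder_set.
    by apply/seteqP; split => x; [move=> [hb hu]|move=> [<- <-]].
  rewrite ler_wpM2r ?exprn_ge0// pE; case: ifPn => _; last first.
    by rewrite -/a ler_piMr// gerBl.
  rewrite probability_setC// muA/= ler_piMl ?subr_ge0//.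
pose other (i : 'I_2) : 'I_2 := if i == ord0 then ord_max else ord0.
have otherP i : other i != i by rewrite /other; case: ifPn => [/eqP ->//|]; rewrite eq_sym.
apply: (@le_trans _ _ (\sum_(u : {ffun 'I_l -> bool}) law mu Z (other (q u), u))).
  apply: (@le_trans _ _ (\sum_(u : {ffun 'I_l -> bool}) a * (1 - a) * 2^-1 ^+ l)); last first.
    by apply: ler_sum => u _; exact: lawZ.
  rewrite sumr_const card_ffun card_bool card_ord -[leRHS]mulr_natr natrX -mulrA -exprMn.
  by rewrite mulVf// expr1n mulr1.
pose F b u := if b != q u then law mu Z (b, u) else 0.
rewrite [leRHS]big_mkcond [leRHS](eq_bigr (fun z => F z.1 z.2)); last by case.
rewrite -(pair_bigA _ F)/=.
rewrite exchange_big/=; apply: ler_sum => u _.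
rewrite (bigD1 (other (q u)))//= {1}/F otherP lerDl.
by apply: sumr_ge0 => b _; rewrite /F; case: ifPn => // _; exact: law_ge0.
Qed.

Lemma cantor_entropy_gt0 : (0 < ks_entropy f mu)%E.
Proof.
have ln2 : 0 < ln 2 :> R by rewrite ln_gt0// ltr1n.
apply: (@lt_le_trans _ _ (ln 2)%:E); first by rewrite lte_fin.
pose p (x : B) : 'I_2 := if right_half x then ord_max else ord0.
have mp : measurable_partition p.
  by move=> b; exact: (measurable_label_comp (fun c : bool => if c then ord_max else ord0 : 'I_2) (@measurable_right_half R)).
apply: (ks_entropy_ge (P := mu) mf cantor_invariant (C := 0) mp) => n.
rewrite join_entropyE subr0 mulrC.
have -> : n%:R * ln 2 = - ln (2^-1 ^+ n) :> R.
  by rewrite lnXn ?invr_gt0// lnV ?posrE// mulNrn opprK mulr_natl.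
apply: label_entropy_ge => [|w]; first exact: measurable_itinerary.
rewrite -(law_itinerary [ffun i => w i == ord_max]).
have mit := measurable_itinerary mf (n := n).
apply: fine_le; rewrite ?fin_num_measure//.
- exact: (mit _ _ mp).
- exact: (mit _ _ (@measurable_right_half R)).
apply: le_measure; rewrite ?inE.
- exact: (mit _ _ mp).
- exact: (mit _ _ (@measurable_right_half R)).
move=> x /= <-; apply/ffunP => i; rewrite !ffunE /p.
by case: (right_half _).
Qed.

(** The three terms are the letters of the itinerary, the coin tosses and the wrong predictions. The
    bound is crude but free of [lam], so it stays fixed while the branches become steeper. *)
Lemma cantor_entropy_le : (ks_entropy f mu <= (3 * ln 2)%:E)%E.
Proof.
have ln2 : 0 < ln 2 :> R by rewrite ln_gt0// ltr1n.
apply: ge_ereal_sup => _ [[|k] [p [mp ->]]]; first by have [] := p 0.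
have lnk : 0 < ln (2 * k.+1%:R) :> R by rewrite ln_gt0// -natrM ltr1n mulnS.
(* At this error rate the wrong predictions cost at most [ln 2] per unit of time. *)
have e0 : 0 < ln 2 / ln (2 * k.+1%:R) :> R by rewrite divr_gt0.
have [l [q Eq]] := mu_approx mp e0.
apply: (@partition_entropy_le _ _ _ mu f mf cantor_invariant _ p _ (l%:R * ln 2)) => // n.
apply: (le_trans (join_entropy_approx mf cantor_invariant q n mp (@measurable_right_half R))).
rewrite ler_pdivlMr// in Eq.
move: Eq; set E := fine _ => Eq.
have : n%:R * (E * ln (2 * k.+1%:R)) <= n%:R * ln 2 by rewrite ler_wpM2l.
by rewrite natrD; move: (ln (2 * _)) => L; lra.
Qed.

End cantor_dynamics.

(** * Folding entropy *)

Section integral_bounds.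
Context d {T : measurableType d} {R : realType}.
Local Open Scope ereal_scope.

(** The integral of a nonnegative function is a supremum over the simple functions below it, hence
    monotone without measurability. This is meant for [point_entropy (k x)], whose measurability in
    [x] is not established. *)
Lemma ge0_le_integral_nonmeasurable (m : {measure set T -> \bar R}) (f g : T -> \bar R) :
  (forall x, 0 <= f x) -> (forall x, f x <= g x) ->
  \int[m]_x f x <= \int[m]_x g x.
Proof.
move=> f0 fg; rewrite !ge0_integralTE//; last by move=> x; exact: le_trans (fg x).
apply: le_ereal_sup => _ [h hf <-]; exists h => // x.
exact: le_trans (fg x).
Qed.

Lemma integral_le_ae_bound (P : probability T R) (f : T -> \bar R) (c : R) :
  (0 <= c)%R -> (forall x, 0 <= f x) -> {ae P, forall x, f x <= c%:E} ->
  \int[P]_x f x <= c%:E.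
Proof.
move=> c0 f0 [N [mN PN subN]].
(* With the value [+oo] on the null set, [g] is measurable, dominates [f] everywhere and equals [c]
   almost everywhere. *)
pose g x := if x \in N then +oo else c%:E.
apply: (@le_trans _ _ (\int[P]_x g x)).
  apply: ge0_le_integral_nonmeasurable => // x; rewrite /g.
  case: ifPn => [_|]; first exact: leey.
  by rewrite notin_setE => xN; apply: contra_notT xN => fx; apply: subN; rewrite /= => h; rewrite h in fx.
rewrite (@ge0_ae_eq_integral _ _ _ P setT g (cst c%:E))//=.
- have := integral_cst P measurableT c%:E.
  move=> /= ->; rewrite -[leRHS]mule1.
  by apply: lee_wpmul2l => //; exact: probability_le1.
- apply: measurable_fun_ifT => //=.
  apply: (measurable_fun_bool true); rewrite setTI (_ : _ @^-1` _ = N)//.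
  by apply/seteqP; split => x /= => [/set_mem|/mem_set].
- by move=> x _; rewrite /g; case: ifPn => //; rewrite lee_fin.
- exists N; split => // x /= h; apply: contra_notP h => xN _.
  by rewrite /g memNset.
Qed.

Lemma integral_ge_ae_bound (P : probability T R) (f : T -> \bar R) (c : R) (D : set T) :
  measurable D -> (0 <= c)%R -> (forall x, 0 <= f x) ->
  {ae P, forall x, D x -> c%:E <= f x} -> c%:E * P D <= \int[P]_x f x.
Proof.
move=> mD c0 f0 [N [mN PN subN]].
have mDN : measurable (D `\` N) by exact: measurableD.
have -> : P D = P (D `\` N).
  rewrite (measureDI P mD mN) [X in _ + X](_ : _ = 0) ?adde0//.
  apply/eqP; rewrite -measure_le0 -PN; apply: le_measure; rewrite ?inE//.
  exact: measurableI.
rewrite -integral_cst// integral_mkcond.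
apply: ge0_le_integral_nonmeasurable => x; rewrite /patch; case: ifPn => //=.
rewrite inE => -[Dx Nx]; apply: contra_notT Nx => fx; apply: subN => /(_ Dx) h.
by rewrite h in fx.
Qed.

End integral_bounds.

Section point_entropy.
Context {R : realType}.
Local Notation B := (measurableTypeR R).
Implicit Types (m : probability B R).
Local Open Scope ereal_scope.

Lemma xlnx_bounds (x : R) : (0 <= x <= 1 -> 0 <= - (x * ln x) <= 1)%R.
Proof.
move=> /andP[x0 x1]; apply/andP; split.
  by rewrite oppr_ge0 mulr_ge0_le0// ln_le0.
move: x0; rewrite le_eqVlt => /predU1P[<-|x0]; first by rewrite mul0r oppr0.
have h : (ln x^-1 <= x^-1 - 1)%R.
  rewrite -[X in ln X](subrK 1%R) addrC; apply: le_ln1Dx.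
  by rewrite ltrBrDr addrC subrr invr_gt0.
rewrite lnV ?posrE// in h; rewrite -mulrN.
apply: (le_trans (ler_wpM2l (ltW x0) h)).
by rewrite mulrBr mulfV ?gt_eqF// mulr1 gerBl ltW.
Qed.

Lemma fine_probability01 m (A : set B) : measurable A -> (0 <= fine (m A) <= 1)%R.
Proof.
move=> mA; rewrite fine_ge0//= -lee_fin fineK ?fin_num_measure//.
exact: probability_le1.
Qed.

Lemma point_entropy_ge0 m : 0 <= point_entropy m.
Proof.
rewrite /point_entropy; case: ifP => // _; apply: esum_ge0 => x _.
by rewrite lee_fin; have /andP[] := xlnx_bounds (fine_probability01 m (measurable_set1 x)).
Qed.

(** At most two points carry mass, and each term [- t ln t] is at most 1 by [xlnx_bounds]. *)
Lemma point_entropy_le2 m (y z : B) : m [set y; z] = 1 -> point_entropy m <= 2%:E.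
Proof.
move=> myz; rewrite /point_entropy ifT; last first.
  by apply/asboolP; exists [set y; z] => //; apply: finite_set_countable.
set a := fun y : B => _%:E.
have a0 x : 0 <= a x.
  by rewrite lee_fin; have /andP[] := xlnx_bounds (fine_probability01 m (measurable_set1 x)).
have a1 x : a x <= 1.
  by rewrite lee_fin; have /andP[] := xlnx_bounds (fine_probability01 m (measurable_set1 x)).
have -> : \esum_(x in [set: B]) a x = \esum_(x in [set y; z]) a x.
  rewrite [RHS]esum_mkcond; apply: eq_esum => x _; case: ifPn => //.
  rewrite notin_setE => /= xyz.
  have -> : a x = 0; last by [].
  rewrite /a (_ : m [set x] = 0) ?mul0r ?oppr0//.
  apply/eqP; rewrite -measure_le0.
  have m2 : measurable [set y; z] by apply: measurableU.
  have : m (~` [set y; z]) = 0 by rewrite probability_setC// myz subee.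
  move=> <-; apply: le_measure; rewrite ?inE//; first exact: measurableC.
  by move=> _ /= ->.
have [->|yz] := eqVneq y z.
  by rewrite setUid esum_set1// (le_trans (a1 z))// lee_fin ler1n.
rewrite esum_fset//.
rewrite fsbigU//=; last by move=> x [/= -> zy]; move: yz; rewrite zy eqxx.
rewrite !fsbig_set1 (_ : 2%:E = 1 + 1)//; exact: leeD.
Qed.

Lemma countable_measure_esum (m : {measure set B -> \bar R}) (C : set B) :
  countable C -> m C = \esum_(y in C) m [set y].
Proof.
move=> /countable_bijP[I /card_esym/card_set_bijP[e eb]].
have IE : I = [set i | i \in I] by apply/seteqP; split => i; rewrite /= inE.
rewrite (reindex_esum _ _ _ _ eb) [X in esum X _]IE -nneseries_esum//.
have -> : C = \bigcup_(i in I) [set e i].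
  have [efun _ esurj] := eb; apply/seteqP; split => [x /esurj[i Ii <-]|x [i Ii /= ->]].
    by exists i.
  exact: efun.
rewrite measure_bigcup//.
  by have [_ inj _] := eb; apply/trivIsetP => i j Ii Ij ij; apply/seteqP; split => // x [/= -> /inj] E; move: ij; rewrite E ?inE ?eqxx.
Qed.

(** If [m] is carried by a countable set, the numbers [- ln (m [set y])], all at least [ln N], are
    averaged with weights of sum 1; otherwise the entropy is [+oo] by definition. *)
Lemma point_entropy_ge m (N : R) : (1 < N)%R ->
  (forall y, m [set y] <= (N^-1)%:E) -> (ln N)%:E <= point_entropy m.
Proof.
move=> N1 mN; have N0 : (0 < N)%R by rewrite (lt_trans _ N1).
have lN : (0 < ln N)%R by rewrite ln_gt0.
rewrite /point_entropy; case: asboolP => [[C cC mC]|_]; last exact: leey.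
set a := fun y : B => _%:E; set s := esum _ _.
have a0 x : 0 <= a x.
  by rewrite lee_fin; have /andP[] := xlnx_bounds (fine_probability01 m (measurable_set1 x)).
have key x : m [set x] * (ln N)%:E <= a x.
  have fx : m [set x] \is a fin_num by rewrite fin_num_measure.
  rewrite /a -[m [set x] in leLHS]fineK// lee_fin -mulrN.
  have := fine_ge0 (measure_ge0 m [set x]); rewrite le_eqVlt => /predU1P[<-|x0].
    by rewrite !mul0r.
  rewrite ler_pM2l// lerNr -lnV ?posrE// ler_ln ?posrE ?invr_gt0//.
  by rewrite -lee_fin fineK.
suff : 1 <= s * (ln N)^-1%:E by rewrite lee_pdivlMr// mul1e.
rewrite -mC countable_measure_esum//; apply: ge_ereal_sup => _ [X [finX XC] <-].
rewrite lee_pdivlMr// ge0_mule_fsuml//.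
apply: (@le_trans _ _ (\sum_(x \in X) a x)); first by apply: lee_fsum => // x _; exact: key.
by apply: ereal_sup_ubound; exists X => //; split.
Qed.

End point_entropy.

Section folding_entropy_upper.
Context {R : realType}.
Local Notation B := (measurableTypeR R).
Local Open Scope ereal_scope.

Lemma pker_probability (k : R.-pker B ~> B) x :
  exists m : probability B R, k x = m :> (set B -> \bar R).
Proof.
have [m mE] := probability_of_measure (@prob_kernel _ _ _ _ _ k x).
by exists m; apply/funext => A; rewrite mE.
Qed.

Section invariant.
Variables (f : B -> B) (P : probability B R).
Hypothesis mf : measurable_fun setT f.
Hypothesis Pf : invariant_measure f P.

Lemma integral_pushforward_invariant (g : B -> \bar R) (D : set B) :
  \int[pushforward P f]_(x in D) g x = \int[P]_(x in D) g x.
Proof. by apply: eq_measure_integral => A mA _; exact: Pf. Qed.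

Lemma ae_pushforward_invariant (Q : set B) :
  {ae pushforward P f, forall x, Q x} -> {ae P, forall x, Q x}.
Proof. by move=> [N [mN PN subN]]; exists N; split => //; rewrite -Pf. Qed.

Lemma disintegration_full (k : R.-pker B ~> B) (S : set B) : measurable S ->
  disintegration f P k -> P S = 1 -> {ae P, forall x, k x S = 1}.
Proof.
move=> mS [dk _] PS.
have mSC : measurable (~` S) by exact: measurableC.
have mk : measurable_fun setT (k ^~ (~` S)) by exact: measurable_kernel.
have : ae_eq P setT (k ^~ (~` S)) (cst 0).
  apply/ae_eq_integral_abs => //.
  under eq_integral do rewrite gee0_abs//.
  by rewrite -integral_pushforward_invariant -dk// probability_setC// PS subee.
apply: filterS => x /(_ I) /=; have [m ->] := pker_probability k x => mC.
by rewrite -[S]setCK probability_setC// mC sube0.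
Qed.

(** Almost every fibre measure is carried both by [S] and by the preimage of [x], hence by the
    points [y x] and [z x]. The default value of [xget] satisfies the bound as well. *)
Lemma folding_entropy_le2 (S : set B) (y z : B -> B) : measurable S -> P S = 1 ->
  (forall x t, f t = x -> S t -> t = y x \/ t = z x) ->
  folding_entropy f P <= 2%:E.
Proof.
move=> mS PS fyz; rewrite /folding_entropy; case: xgetP => [h -> [k dk ->]|_].
  rewrite integral_pushforward_invariant; apply: integral_le_ae_bound => //.
    by move=> x; have [m ->] := pker_probability k x; exact: point_entropy_ge0.
  have dS := disintegration_full mS dk PS.
  have [_ /ae_pushforward_invariant dF] := dk.
  apply: filterS2 dS dF => x.
  have [m ->] := pker_probability k x => mS1 mF1.
  apply: (@point_entropy_le2 _ _ (y x) (z x)).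
  have mF : measurable (f @^-1` [set x]).
    by rewrite -[X in measurable X]setTI; exact: mf.
  have m2 : measurable [set y x; z x] by exact: measurableU.
  apply/eqP; rewrite eq_le probability_le1//=.
  rewrite -mS1 (@probability_eq_on _ _ _ m (f @^-1` [set x]) S (f @^-1` [set x] `&` S))//.
  - apply: le_measure; rewrite ?inE//; first exact: measurableI.
    by move=> t [/= /fyz tyz /tyz].
  - exact: measurableI.
  - by move=> t tx; split => // -[].
by rewrite lee_fin.
Qed.

End invariant.

Lemma cantor_folding_le2 (lam : R) (f : B -> B) (mu : probability B R) :
  (8 <= lam)%R -> (forall b y, (0 <= y <= 1)%R -> f (cbranch lam b y) = y) ->
  measurable_fun setT f -> mu `[0%R, 1%R]%classic = 1 ->
  (forall A, measurable A -> fine (mu A) =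
    ((fine (mu (cbranch lam false @^-1` A)) + fine (mu (cbranch lam true @^-1` A))) / 2)%R) ->
  folding_entropy f mu <= 2%:E.
Proof.
move=> lam8 fK mf mu01 muS.
pose A b : set B := `[cbranch lam b 0, cbranch lam b 1]%classic.
have mA b : measurable (A b) by exact: measurable_itv.
have mS : measurable (A false `|` A true) by exact: measurableU.
apply: (folding_entropy_le2 mf (cantor_invariant lam8 fK mf mu01 muS) (S := A false `|` A true)
  (y := cbranch lam false) (z := cbranch lam true)) => //.
  rewrite -[LHS]fineK ?fin_num_measure// muS//.
  have E b : mu (cbranch lam b @^-1` (A false `|` A true)) = 1.
    have mb : measurable (cbranch lam b @^-1` (A false `|` A true) : set B).
      exact: (measurable_preimage_cword lam8 [:: b]).
    rewrite -(@probability_setT _ _ _ mu).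
    apply: (@probability_eq_on _ _ _ mu `[0%R, 1%R]%classic) => // x.
    rewrite /= in_itv/= => /andP[x0 x1]; split => // _.
    have : A b (cbranch lam b x) by rewrite /A /= in_itv/= !cbranch_homo.
    by case: (b); [right|left].
  by rewrite !E /=; congr EFin; field.
move=> x t ftx [] /(cword_surj lam8 (w := [:: _]))[y y01 tE].
  have {}tE : t = cbranch lam false y := tE.
  by left; rewrite -ftx tE fK.
have {}tE : t = cbranch lam true y := tE.
by right; rewrite -ftx tE fK.
Qed.

End folding_entropy_upper.

(** * Folding entropy of a measure that is an average of images under inverse branches *)

Section uniform_preimages.
Context {R : realType}.
Local Notation B := (measurableTypeR R).
Local Open Scope ereal_scope.
Variables (f : B -> B) (P : probability B R).
Hypothesis mf : measurable_fun setT f.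
Hypothesis Pf : invariant_measure f P.
Variables (N : nat) (g : 'I_N -> B -> B).
Hypothesis N1 : (1 < N)%N.
Hypothesis mg : forall i, measurable_fun setT (g i).
Hypothesis Pg : forall A, measurable A ->
  fine (P A) = (N%:R^-1 * \sum_i fine (P (g i @^-1` A)))%R.
Hypothesis gK : forall i, P [set x | f (g i x) = x] = 1.

Let N0 : (0 < N)%N. Proof. exact: ltnW. Qed.
Let NR : N%:R != 0%R :> R. Proof. by rewrite pnatr_eq0 -lt0n. Qed.
Let Ni : (0 <= N%:R^-1 :> R)%R. Proof. by rewrite invr_ge0. Qed.

Let mpreg i A : measurable A -> measurable (g i @^-1` A).
Proof. by move=> mA; rewrite -[X in measurable X]setTI; exact: mg. Qed.

Let mpref A : measurable A -> measurable (f @^-1` A).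
Proof. by move=> mA; rewrite -[X in measurable X]setTI; exact: mf. Qed.

Let measurable_gK i : measurable [set x | f (g i x) = x].
Proof.
rewrite (_ : [set x | _] = (fun x : B => (f (g i x) - x)%R : B) @^-1` [set 0%R]).
  rewrite -[X in measurable X]setTI; apply: measurable_funB => //.
  exact: (measurableT_comp mf (mg i)).
apply/seteqP; split => x /=; first by move=> ->; rewrite subrr.
by move/eqP; rewrite subr_eq0 => /eqP.
Qed.

(** [msum] is indexed by [nat], whence the conversion by [insub]; the value [x] is a dummy, since
    the sum stops at [N]. *)
Definition mean_dirac (x : B) : {measure set B -> \bar R} :=
  mscale (NngNum Ni)
    (msum (fun j : nat => dirac (if insub j is Some i then g i x else x)) N).

Lemma mean_diracE x A : mean_dirac x A = (N%:R^-1)%:E * \sum_i \d_(g i x) A.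
Proof.
rewrite /mean_dirac /mscale/= /msum; congr (_ * _); apply: eq_bigr => i _.
by rewrite valK.
Qed.

Let measurable_dirac i U : measurable U -> measurable_fun setT (fun x => \d_(g i x) U : \bar R).
Proof.
move=> mU; rewrite (_ : (fun x => _) = EFin \o (\1_U \o g i))//.
by apply/measurable_EFinP; apply: measurableT_comp => //; exact: measurable_indic.
Qed.

Let measurable_mean_dirac U : measurable U -> measurable_fun setT (mean_dirac ^~ U).
Proof.
move=> mU; rewrite (_ : mean_dirac ^~ U = fun x => (N%:R^-1)%:E * \sum_i \d_(g i x) U).
  by apply: measurable_funeM; apply: emeasurable_sum => i; exact: measurable_dirac.
by apply/funext => x; rewrite mean_diracE.
Qed.

HB.instance Definition _ := isKernel.Build _ _ B B R mean_dirac measurable_mean_dirac.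

Let mean_dirac1 x : mean_dirac x setT = 1.
Proof.
rewrite mean_diracE; under eq_bigr do rewrite diracT.
by rewrite sumEFin sumr_const card_ord -EFinM mulVf.
Qed.

HB.instance Definition _ := Kernel_isProbability.Build _ _ B B R mean_dirac mean_dirac1.

(** Self-similarity of [P] under the [g i] is the disintegration formula. The existence obtained
    here excludes the default value in [folding_entropy]. *)
Lemma mean_dirac_disintegration : disintegration f P mean_dirac.
Proof.
split.
  move=> A mA; rewrite integral_pushforward_invariant//.
  under eq_integral do rewrite mean_diracE.
  rewrite ge0_integralZl//; last first.
  - by move=> x _; apply: sume_ge0.
  - by apply: emeasurable_sum => i; exact: measurable_dirac.
  rewrite ge0_integral_sum//; last by move=> i; exact: measurable_dirac.
  rewrite -probability_fineK// Pg// EFinM -sumEFin; congr (_ * _); apply: eq_bigr => i _.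
  rewrite probability_fineK; last exact: mpreg.
  have -> : \int[P]_x \d_(g i x) A = \int[P]_x (\1_(g i @^-1` A) x)%:E by [].
  by rewrite integral_indic ?setIT//; exact: mpreg.
have : \forall x \near almost_everywhere P, forall i, f (g i x) = x.
  apply: filter_forall => i; exists (~` [set x | f (g i x) = x]); split => //.
  - exact: measurableC.
  - by rewrite probability_setC// gK subee.
move=> [Z [mZ PZ subZ]]; exists Z; split => //; first by rewrite -PZ; exact: Pf.
apply: subset_trans subZ => x /= kx gx; apply: kx.
rewrite mean_diracE (eq_bigr (fun=> 1)).
  by rewrite sumEFin sumr_const card_ord -EFinM mulVf.
by move=> i _; rewrite diracE mem_set//= gx.
Qed.

Variables (D : set B) (I : 'I_N -> set B).
Hypothesis mD : measurable D.
Hypothesis mI : forall i, measurable (I i).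
Hypothesis I_disj : forall i j, i != j -> I i `&` I j = set0.
Hypothesis gI : forall i x, D x -> I i (g i x).

(** Over [D] the sets [I i] separate the branches: [g i] alone reaches [I i], and it carries the
    share [1 / N]. *)
Let P_branch i C : measurable C -> C `<=` D ->
  fine (P (I i `&` f @^-1` C)) = (N%:R^-1 * fine (P C))%R.
Proof.
move=> mC CD; have mfC := mpref mC.
have mIC : measurable (I i `&` f @^-1` C) by exact: measurableI.
rewrite Pg//; congr (_ * _)%R; rewrite (bigD1 i)//= big1 ?addr0.
  congr fine; apply: (probability_eq_on (measurable_gK i)) => //; first exact: mpreg.
  move=> x /= gx; rewrite gx; split => [[]//|Cx]; split => //.
  by apply: gI; exact: CD.
move=> j ji; rewrite (_ : P _ = 0)// -(measure0 P).
apply: (probability_eq_on (measurable_gK j)) => //; first exact: mpreg.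
move=> x /= gx; rewrite gx; split => // -[Ii /CD Dx].
have : (I i `&` I j) (g j x) by split => //; exact: gI.
by rewrite I_disj// eq_sym.
Qed.

(** The kernel is arbitrary because [xget] may return the value given by any disintegration. Over
    every measurable [C] inside [D] both sides integrate to the mass of [I i] intersected with the
    preimage of [C]. *)
Lemma disintegration_branch (k : R.-pker B ~> B) i : disintegration f P k ->
  {ae P, forall x, D x -> k x (I i) = (N%:R^-1)%:E}.
Proof.
move=> [dk /(ae_pushforward_invariant Pf) kf].
have mk A : measurable A -> measurable_fun setT (k ^~ A) by exact: measurable_kernel.
have k01 x A : measurable A -> 0 <= k x A <= 1.
  by move=> mA; have [m ->] := pker_probability k x; rewrite measure_ge0 probability_le1.
have int : P.-integrable D (k ^~ (I i)).
  apply: (@le_integrable _ _ _ P D mD _ (EFin \o cst 1%R)) => //.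
  - exact: measurable_funTS (mk _ (mI i)).
  - by move=> x _; have /andP[h0 h1] := k01 x _ (mI i); rewrite gee0_abs//= normr1.
  - by apply: (integrableS measurableT) => //; exact: finite_measure_integrable_cst.
have : ae_eq P D (k ^~ (I i)) (cst (N%:R^-1)%:E).
  apply: integral_ae_eq => // C CD mC.
  have -> : \int[P]_(x in C) cst (N%:R^-1)%:E x = P (I i `&` f @^-1` C).
    rewrite integral_cst//; transitivity ((N%:R^-1)%:E * P C) => //.
    rewrite -(probability_fineK P mC) -EFinM -(P_branch i)//.
    by rewrite probability_fineK//; apply: measurableI => //; exact: mpref.
  rewrite dk; last by apply: measurableI => //; exact: mpref.
  rewrite integral_pushforward_invariant// [LHS]integral_mkcond.
  apply: ge0_ae_eq_integral => //.
  - by apply/(measurable_restrictT _ _).1 => //; exact: measurable_funTS (mk _ (mI i)).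
  - by apply: mk; apply: measurableI => //; exact: mpref.
  - by move=> x _; rewrite /patch; case: ifPn => // _; have /andP[] := k01 x _ (mI i).
  apply: filterS kf => x mx _; have [m kxE] := pker_probability k x.
  rewrite kxE in mx.
  have mfx : measurable (f @^-1` [set x]) by exact: mpref.
  have mfC := mpref mC.
  rewrite /patch kxE; case: ifPn => xC.
    apply: (probability_eq_on mfx) => //; first exact: measurableI.
    by move=> t /= tx; rewrite tx; split => [|[]//]; split => //; rewrite inE in xC.
  transitivity (m set0); first by rewrite measure0.
  apply: (probability_eq_on mfx) => //; first exact: measurableI.
  by move=> t /= tx; rewrite tx; split => // -[_]; rewrite notin_setE in xC.
by [].
Qed.

(** Over [D] a fibre measure spreads its mass evenly over the [N] disjoint sets [I i], so a point
    has mass at most [1 / N], and mass 0 outside their union. *)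
Lemma folding_entropy_ge : (ln N%:R)%:E * P D <= folding_entropy f P.
Proof.
have N1' : (1 < N%:R :> R)%R by rewrite ltr1n.
rewrite /folding_entropy; case: xgetP => [h -> [k dk ->]|noh]; last first.
  by exfalso; apply: (noh _); exists mean_dirac => //; exact: mean_dirac_disintegration.
rewrite integral_pushforward_invariant//.
apply: integral_ge_ae_bound => //; first by rewrite ln_ge0// ltW.
  by move=> x; have [m ->] := pker_probability k x; exact: point_entropy_ge0.
have : \forall x \near almost_everywhere P, forall i, D x -> k x (I i) = (N%:R^-1)%:E.
  by apply: filter_forall => i; exact: disintegration_branch.
apply: filterS => x + Dx; have [m ->] := pker_probability k x => mx.
apply: point_entropy_ge => // y.
have my : measurable [set y] by [].
have [[i Iy]|noI] := pselect (exists i, I i y).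
  by rewrite -(mx i Dx); apply: le_measure; rewrite ?inE// => _ ->.
have mU : measurable (\big[setU/set0]_i I i) by exact: bigsetU_measurable.
have U1 : m (\big[setU/set0]_i I i) = 1.
  rewrite measure_bigsetU_ord//; last first.
    by apply/trivIsetP => i j _ _; exact: I_disj.
  rewrite (eq_bigr (fun=> (N%:R^-1)%:E)) => [|i _]; last exact: mx.
  by rewrite sumEFin sumr_const card_ord -(mulr_natl (N%:R^-1)%R) mulfV.
apply: (@le_trans _ _ (m (~` \big[setU/set0]_i I i))).
  apply: le_measure; rewrite ?inE//; first exact: measurableC.
  by move=> _ /= ->; rewrite -bigcup_seq => -[i _ Iy]; apply: noI; exists i.
by rewrite probability_setC// U1 subee// lee_fin.
Qed.

End uniform_preimages.

(** * The tower over the oscillating laps *)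

Section first_crossing.
Context {R : realType} (f : R -> R) (a b : R).
Hypothesis fc : continuous f.
Hypothesis ab : a <= b.

(** This gives a monotone right inverse of [f] even if [f] is not monotone on [[a, b]]. Adjoining
    [b] keeps the infimum in [[a, b]] for every level [z], reached or not. *)
Definition first_crossing (z : R) : R :=
  inf ([set t | a <= t <= b /\ z <= f t] `|` [set b]).

Let E z := [set t | a <= t <= b /\ z <= f t] `|` [set b].

Let hE z : has_inf (E z).
Proof. by split; [exists b; right|exists a => t [[/andP[]]//|->]]. Qed.

Lemma first_crossing_itv z : a <= first_crossing z <= b.
Proof.
apply/andP; split; first by apply: lb_le_inf; [have [] := hE z|move=> t [[/andP[]]//|->]].
by apply: ge_inf; [have [] := hE z|right].
Qed.

Lemma first_crossing_le z t : a <= t <= b -> z <= f t -> first_crossing z <= t.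
Proof. by move=> tab zt; apply: ge_inf; [have [] := hE z|left]. Qed.

Lemma first_crossing_homo : {homo first_crossing : x y / x <= y}.
Proof.
move=> x y xy; apply: lb_le_inf; first by have [] := hE y.
move=> t [[tab yt]|->]; last by have /andP[] := first_crossing_itv x.
by apply: first_crossing_le => //; exact: le_trans yt.
Qed.

Lemma first_crossing_hits z : first_crossing z < b -> z <= f (first_crossing z).
Proof.
set s := first_crossing z => sb; rewrite leNgt; apply/negP => fz.
have hn : \forall t \near s, f t < z by exact: (cvgr_lt _ (@fc s)).
have /nbhs_ballP[e /= e0 he] : nbhs s [set t | f t < z] by [].
have d0 : 0 < Num.min e (b - s) by rewrite lt_min e0 subr_gt0.
have [t Et] := inf_adherent d0 (hE z).
have st : s <= t by apply: ge_inf => //; have [] := hE z.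
rewrite -/(first_crossing z) -/s -ltrBlDl lt_min ltrD2r => /andP[te tb].
case: Et => [[_ zt]|tE]; last by rewrite tE ltxx in tb.
have : f t < z by apply: he; rewrite /ball/= distrC ger0_norm ?subr_ge0.
by rewrite ltNge zt.
Qed.

Lemma first_crossingK z : f a <= z <= f b -> f (first_crossing z) = z.
Proof.
move=> /andP[az zb]; have /andP[sa sb] := first_crossing_itv z.
apply/eqP; rewrite eq_le; apply/andP; split; last first.
  case: (ltgtP (first_crossing z) b) sb => // [sb _|-> //]; exact: first_crossing_hits.
(* If [f] exceeded [z] at the first crossing, continuity would produce an earlier one. *)
rewrite leNgt; apply/negP => zs.
case: (ltgtP a (first_crossing z)) sa => // [sa _|sa]; last by rewrite -sa ltNge az in zs.
have hn : \forall t \near first_crossing z, z < f t by exact: (cvgr_gt _ (@fc (first_crossing z))).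
have /nbhs_ballP[e /= e0 he] : nbhs (first_crossing z) [set t | z < f t] by [].
set s := first_crossing z in sa sb zs he *.
pose t := Num.max a (s - e / 2).
have ts : t < s by rewrite gt_max sa gtrBl divr_gt0.
have : s <= t.
  apply: first_crossing_le; first by rewrite le_max lexx/= (le_trans (ltW ts)).
  apply/ltW/he; rewrite /ball/= ger0_norm ?subr_ge0 ?(ltW ts)//.
  by rewrite ltrBlDr -ltrBlDl lt_max; apply/orP; right; lra.
by rewrite leNgt ts.
Qed.

(** If the crossings converge below [b], the limit of [u n <= f (v n)] shows that their limit
    already reaches the level [l]; monotonicity gives the other inequality. *)
Lemma first_crossing_left (u : nat -> R) l : nondecreasing_seq u -> u @ \oo --> l ->
  (fun n => first_crossing (u n)) @ \oo --> first_crossing l.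
Proof.
move=> ndu ul.
have ule n : u n <= l.
  by rewrite -(cvg_lim _ ul)//; apply: nondecreasing_cvgn_le => //; apply/cvg_ex; exists l.
pose v n := first_crossing (u n).
have ndv : nondecreasing_seq v by move=> i j ij; apply/first_crossing_homo/ndu.
have cv : cvgn v.
  apply: nondecreasing_is_cvgn => //; exists b => _ [n _ <-].
  by have /andP[] := first_crossing_itv (u n).
have vle n : v n <= limn v by exact: nondecreasing_cvgn_le.
suff -> : first_crossing l = limn v by [].
apply/eqP; rewrite eq_le; apply/andP; split; last first.
  by apply: limr_le => //; apply: nearW => n; exact: first_crossing_homo.
have [|lb] := leP b (limn v).
  by apply: le_trans; have /andP[] := first_crossing_itv l.
apply: first_crossing_le.
  rewrite (ltW lb) andbT; apply: le_trans (vle 0%N).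
  by have /andP[] := first_crossing_itv (u 0%N).
have fv : f \o v @ \oo --> f (limn v) by apply: continuous_cvg => //; exact: fc.
rewrite -(cvg_lim _ ul)// -(cvg_lim _ fv)//; apply: ler_lim.
- by apply/cvg_ex; exists l.
- by apply/cvg_ex; exists (f (limn v)).
- by apply: nearW => n; apply: first_crossing_hits; exact: le_lt_trans (vle n) lb.
Qed.

End first_crossing.

Lemma fine_sum_prob d (T : measurableType d) (R : realType) (P : probability T R)
    (I : Type) (s : seq I) (F : I -> set T) : (forall i, measurable (F i)) ->
  fine (\sum_(i <- s) P (F i))%E = \sum_(i <- s) fine (P (F i)).
Proof.
move=> mF; under eq_bigr do rewrite -probability_fineK//.
by rewrite sumEFin.
Qed.

(** * The tower measure: invariance, frequencies, entropy and folding entropy *)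

Section tower.
Context {R : realType} (lam : R) (lam8 : 8 <= lam).
Local Notation B := (measurableTypeR R).
Variable f : B -> B.
Hypothesis fK : forall b y, 0 <= y <= 1 -> f (cbranch lam b y) = y.
Hypothesis mf : measurable_fun setT f.
Hypothesis fcont : continuous (f : R -> R).
Variables (w : seq bool) (N : nat) (l r : 'I_N -> R).
Hypothesis N0 : (0 < N)%N.
Hypothesis lr : forall i, [/\ 1 / 4 < l i, l i <= r i & r i < 3 / 4].
Hypothesis lap_disj : forall i j, i != j -> r i < l j \/ r j < l i.
Hypothesis flr : forall i, f (l i) <= cword lam w 0 /\ cword lam w 1 <= f (r i).

(** An inverse branch of the iterate of order [(size w).+1]: one step leads from the lap to the
    cylinder of [w], and the letters of [w] lead back to [[0, 1]]. *)
Definition lap (i : 'I_N) (y : R) : R := first_crossing f (l i) (r i) (cword lam w y).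

Local Notation k := (size w).

Let llr i : l i <= r i. Proof. by have [] := lr i. Qed.

Lemma lap_homo i : {homo lap i : x y / x <= y}.
Proof. by move=> x y xy; apply: first_crossing_homo => //; exact: cword_homo. Qed.

Lemma lap_itv i y : l i <= lap i y <= r i.
Proof. exact: first_crossing_itv. Qed.

Lemma lap_quarter i y : 1 / 4 < lap i y < 3 / 4.
Proof. by have [h1 h2 h3] := lr i; have /andP[h4 h5] := lap_itv i y; apply/andP; split; lra. Qed.

Lemma lap_left i (u : nat -> R) (z : R) : nondecreasing_seq u ->
  u @ \oo --> z -> (fun n => lap i (u n)) @ \oo --> lap i z.
Proof.
move=> ndu uz; apply: (@first_crossing_left _ f _ _ fcont (llr i) (fun n => cword lam w (u n))).
  by move=> a b ab; apply/cword_homo/ndu.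
by apply: continuous_cvg => //; exact: cword_continuous.
Qed.

Lemma measurable_lap i : measurable_fun [set: B] (lap i : B -> B).
Proof. by apply: nondecreasing_measurable => // x y; exact: lap_homo. Qed.

Lemma measurable_preimage_lap i (A : set B) : measurable A ->
  measurable ((lap i : B -> B) @^-1` A).
Proof. by move=> mA; rewrite -[X in measurable X]setTI; exact: measurable_lap. Qed.

Lemma f_lap i y : 0 <= y <= 1 -> f (lap i y) = cword lam w y.
Proof.
move=> /andP[y0 y1]; apply: first_crossingK => //.
have [h1 h2] := flr i; apply/andP; split.
  by apply: (le_trans h1); exact: cword_homo.
by apply: le_trans h2; exact: cword_homo.
Qed.

Lemma iter_lap j i y : 0 <= y <= 1 -> (j <= k)%N ->
  iter j.+1 f (lap i y) = cword lam (drop j w) y.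
Proof. by move=> y01 jk; rewrite iterSr f_lap// (iter_cword lam8 fK). Qed.

Lemma iter_lap_return i y : 0 <= y <= 1 -> iter k.+1 f (lap i y) = y.
Proof. by move=> y01; rewrite iter_lap// drop_size. Qed.

Lemma lap_measure : exists nu0 : probability B R,
  nu0 `[0, 1]%classic = 1%E /\
  forall A, measurable A -> fine (nu0 A) = N%:R^-1 * \sum_i fine (nu0 (lap i @^-1` A)).
Proof.
have b01 i (x : R) : 0 <= x <= 1 -> 0 <= lap i x <= 1.
  by move=> _; have /andP[h1 h2] := lap_quarter i x; apply/andP; split; lra.
have [pi [mpi pi01 piE]] := self_similar_coding N0 lap_homo b01 lap_left.
have [nu [nuE nuS]] := self_similar_measure N0 lap_homo mpi piE.
exists nu; split.
  rewrite nuE (_ : _ `&` _ = `[0%R, 1%R[%classic); last first.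
    by apply/seteqP; split => x /= => [[]//|]; split => //; rewrite in_itv/=; exact: pi01.
  by rewrite lebesgue_measure_itv/= lte_fin ltr01 sube0.
move=> A mA; rewrite nuS// fineM//; last first.
  by apply/sum_fin_numP => i _ _; rewrite fin_num_measure//; exact: measurable_preimage_lap.
by rewrite /= fine_sum_prob// => i; exact: measurable_preimage_lap.
Qed.

Variable nu0 : probability B R.
Hypothesis nu01 : nu0 `[0, 1]%classic = 1%E.
Hypothesis nu0S : forall A, measurable A ->
  fine (nu0 A) = N%:R^-1 * \sum_i fine (nu0 (lap i @^-1` A)).

Let NR : N%:R != 0 :> R. Proof. by rewrite pnatr_eq0 -lt0n. Qed.

Let eq_on (A C : set B) : measurable A -> measurable C ->
  (forall x, 0 <= x <= 1 -> A x <-> C x) -> nu0 A = nu0 C.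
Proof.
move=> mA mC AC; apply: (probability_eq_on _ mA mC nu01) => [|x /=].
  exact: measurable_itv.
by rewrite in_itv/=; exact: AC.
Qed.

Let fine_eq1 (A : set B) : measurable A -> (forall x, 0 <= x <= 1 -> A x) -> fine (nu0 A) = 1.
Proof.
move=> mA A1; rewrite (@eq_on A setT)//; first by rewrite probability_setT.
by move=> x /A1.
Qed.

Let mcword j (A : set B) : measurable A ->
  measurable ((cword lam (drop j w) : B -> B) @^-1` A).
Proof. exact: measurable_preimage_cword. Qed.

(** All laps give the same pullback, so the average in [nu0S] collapses to one term. *)
Lemma nu0_push (A C : set B) : measurable A -> measurable C ->
  (forall i y, 0 <= y <= 1 -> A (lap i y) <-> C y) -> fine (nu0 A) = fine (nu0 C).
Proof.
move=> mA mC AC; rewrite nu0S// (eq_bigr (fun=> fine (nu0 C))).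
  by rewrite sumr_const card_ord -(mulr_natl (fine (nu0 C))) mulKf.
move=> i _; congr fine; apply: eq_on => //; first exact: measurable_preimage_lap.
by move=> x x01; exact: AC.
Qed.

Lemma nu0_iter j (A : set B) : (j <= k)%N -> measurable A ->
  fine (nu0 (iter j.+1 f @^-1` A)) = fine (nu0 (cword lam (drop j w) @^-1` A)).
Proof.
move=> jk mA; apply: nu0_push.
- exact: (measurable_preimage_iter mf).
- exact: mcword.
- by move=> i y y01; rewrite /preimage/= -[f (iter j f _)]/(iter j.+1 f _) iter_lap.
Qed.

Lemma nu0_return (A : set B) : measurable A ->
  fine (nu0 (iter k.+1 f @^-1` A)) = fine (nu0 A).
Proof.
move=> mA; rewrite nu0_iter// drop_size; congr fine.
Qed.

Lemma nu0_quarter : fine (nu0 `]1 / 4, 3 / 4[%classic) = 1.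
Proof.
rewrite (@nu0_push _ setT)//; first by rewrite probability_setT.
by move=> i y _; split => // _; rewrite /= in_itv/=; exact: lap_quarter.
Qed.

Lemma tower_measure : exists nu : probability B R,
  forall A, measurable A ->
    fine (nu A) = k.+1%:R^-1 * \sum_(j < k.+1) fine (nu0 (iter j f @^-1` A)).
Proof.
have ki : 0 <= k.+1%:R^-1 :> R by rewrite invr_ge0.
pose m := mscale (NngNum ki) (msum (fun j =>
  measure_function_pushforward__canonical__measure_function_Measure nu0
    (measurable_iter mf j)) k.+1).
have mE A : m A = ((k.+1%:R^-1)%:E * \sum_(j < k.+1) nu0 (iter j f @^-1` A))%E by [].
have fineE A : measurable A ->
    (\sum_(j < k.+1) nu0 (iter j f @^-1` A))%E =
    (\sum_(j < k.+1) fine (nu0 (iter j f @^-1` A)))%:E.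
  move=> mA; rewrite -sumEFin; apply: eq_bigr => j _.
  by rewrite probability_fineK//; exact: (measurable_preimage_iter mf).
have [|nu nuE] := @probability_of_measure _ _ _ m.
  transitivity ((k.+1%:R^-1)%:E * \sum_(j < k.+1) nu0 (iter j f @^-1` setT))%E; first exact: mE.
  rewrite fineE// (eq_bigr (fun=> 1)).
    by rewrite sumr_const card_ord -EFinM mulVf ?pnatr_eq0.
  by move=> j _; rewrite preimage_setT probability_setT.
exists nu => A mA.
have -> : nu A = ((k.+1%:R^-1)%:E * \sum_(j < k.+1) nu0 (iter j f @^-1` A))%E.
  by rewrite nuE; exact: mE.
by rewrite fineE.
Qed.

Variable nu : probability B R.
Hypothesis nuE : forall A, measurable A ->
  fine (nu A) = k.+1%:R^-1 * \sum_(j < k.+1) fine (nu0 (iter j f @^-1` A)).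

Let k1 : k.+1%:R != 0 :> R. Proof. by rewrite pnatr_eq0. Qed.

Let miter j (A : set B) : measurable A -> measurable (iter j f @^-1` A).
Proof. exact: (measurable_preimage_iter mf). Qed.

(** The map shifts the levels of the tower, and the top level falls back on the base with law [nu0]
    by [nu0_return]. *)
Lemma tower_invariant : invariant_measure f nu.
Proof.
move=> A mA; have mfA : measurable (f @^-1` A) by exact: (miter 1).
rewrite -probability_fineK// -[RHS]probability_fineK// !nuE//; congr (_ * _)%:E.
rewrite big_ord_recr [RHS]big_ord_recl/= addrC; congr (_ + _).
  by rewrite -[RHS]nu0_return.
Qed.

Lemma tower_unit : nu `[0, 1]%classic = 1%E.
Proof.
have m01 : measurable (`[0, 1]%classic : set B) by exact: measurable_itv.
rewrite -probability_fineK// nuE// (eq_bigr (fun=> 1)).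
  by rewrite sumr_const card_ord mulVf.
move=> [[|j] jk] _; first by rewrite nu01.
transitivity (fine (nu0 (iter j.+1 f @^-1` `[0, 1]%classic))) => //.
rewrite nu0_iter//; last exact: ltnW.
apply: fine_eq1; first exact: mcword.
by move=> x x01; rewrite /= in_itv/=; exact: cword01.
Qed.

(** Level [j.+1] is coded by [drop j w], so it lies in the cylinder of [u] when [u] occurs at place
    [j]. The base is paired with the place [j = k], where only the empty word occurs. *)
Lemma tower_cylinder (u : seq bool) :
  k.+1%:R^-1 * \sum_(j < k.+1) (take (size u) (drop j w) == u)%:R <=
  fine (nu `[cword lam u 0, cword lam u 1]%classic).
Proof.
rewrite nuE; last exact: measurable_itv.
rewrite ler_wpM2l ?invr_ge0//.
rewrite big_ord_recr/= [leRHS]big_ord_recl/= addrC lerD//.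
  have [|_] := boolP (_ == _); last by rewrite fine_ge0.
  rewrite drop_size => /eqP <-.
  by rewrite fine_eq1//; exact: measurable_itv.
apply: ler_sum => j _; have [|_] := boolP (_ == _); last by rewrite fine_ge0.
move=> /eqP uE.
rewrite [X in nu0 X](_ : _ = iter j.+1 f @^-1` `[cword lam u 0, cword lam u 1]%classic)//.
rewrite nu0_iter//; last by first [exact: ltnW|exact: measurable_itv].
rewrite fine_eq1//; first by apply: mcword; exact: measurable_itv.
move=> x x01; rewrite /= in_itv/=.
have -> : cword lam (drop j w) x = cword lam u (cword lam (drop (size u) (drop j w)) x).
  by rewrite -{1}[drop j w](cat_take_drop (size u)) uE cword_cat.
have /andP[h0 h1] := cword01 lam8 (drop (size u) (drop j w)) x01.
by rewrite !cword_homo.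
Qed.

(** Under [nu0] the laps visited at successive returns are independent and uniform. From any level,
    a window of length [n] sees at least [q = n %/ k.+1] returns, so atoms of the join have mass at
    most [N^-q]. *)
Lemma tower_entropy : ((ln N%:R / k.+1%:R)%:E <= ks_entropy f nu)%E.
Proof.
pose p (x : B) : 'I_N.+1 := odflt ord_max
  (omap (widen_ord (leqnSn N)) [pick i | l i <= x <= r i]).
have p_lap i y : p (lap i y) = widen_ord (leqnSn N) i.
  rewrite /p; case: pickP => [j /=|/(_ i)]; last by rewrite lap_itv.
  have /andP[h1 h2] := lap_itv i y; move=> /andP[h3 h4].
  have [->//|ji] := eqVneq j i.
  by have [h|h] := lap_disj ji; exfalso; lra.
have mI i : measurable (`[l i, r i]%classic : set B) by exact: measurable_itv.
have mp : measurable_partition p.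
  pose L (x : B) := [ffun i => l i <= x <= r i].
  have mL : measurable_label L.
    apply: measurable_label_ffun => i c.
    rewrite (_ : _ @^-1` _ = if c then `[l i, r i]%classic else ~` `[l i, r i]%classic).
      by case: c => //; exact: measurableC.
    case: c; apply/seteqP; split => x; rewrite /= in_itv//=; first by move=> ->.
    by move/negP/negbTE.
  pose g (u : {ffun 'I_N -> bool}) : 'I_N.+1 :=
    odflt ord_max (omap (widen_ord (leqnSn N)) [pick i | u i]).
  rewrite (_ : p = g \o L); first exact: measurable_label_comp.
  apply/funext => x; rewrite /p /g /=; congr (odflt _ (omap _ _)).
  by apply: eq_pick => i; rewrite ffunE.
(* [nu0S] resolves the first label at the price of a factor [1 / N], and [iter_lap_return] restarts
   the induction after one return. *)
have ev_le q (h : nat -> 'I_N.+1) :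
    measurable [set x | forall s, (s < q)%N -> p (iter (k.+1 * s) f x) = h s] /\
    fine (nu0 [set x | forall s, (s < q)%N -> p (iter (k.+1 * s) f x) = h s]) <= N%:R^-1 ^+ q.
  elim: q h => [|q IH] h.
    rewrite (_ : [set _ | _] = setT); last by apply/seteqP; split.
    by rewrite probability_setT expr0.
  have [m1 le1] := IH (fun s => h s.+1).
  set A' := [set x | _] in m1 le1.
  set A := [set x | _].
  have AE : A = p @^-1` [set h 0%N] `&` iter k.+1 f @^-1` A'.
    apply/seteqP; split => x.
      move=> Ax; split; first by have := Ax 0%N isT; rewrite muln0.
      by move=> s sq; rewrite -iterD -mulnSr; exact: Ax.
    move=> [h0 h1] [_|s sq]; first by rewrite muln0.
    by rewrite mulnSr iterD; exact: h1.
  have mA : measurable A by rewrite AE; apply: measurableI; [exact: mp|exact: miter].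
  split => //; rewrite nu0S// exprS ler_wpM2l ?invr_ge0//.
  have [i hi|noi] := pickP (fun i => widen_ord (leqnSn N) i == h 0%N).
    rewrite (bigD1 i)//= [X in _ + X]big1 ?addr0; last first.
      move=> j ji; rewrite (_ : nu0 _ = 0%E)// -(measure0 nu0); apply: eq_on => //.
        exact: measurable_preimage_lap.
      move=> x x01; split => //; rewrite AE => -[/= pj _]; move: pj.
      rewrite p_lap -(eqP hi) => /(congr1 val)/= /val_inj E.
      by move: ji; rewrite E eqxx.
    apply: le_trans le1; rewrite (_ : nu0 (_ @^-1` _) = nu0 A')//; apply: eq_on => //.
      exact: measurable_preimage_lap.
    move=> x x01; rewrite AE /preimage/= p_lap -[f (iter k f _)]/(iter k.+1 f _) iter_lap_return//.
    by split => [[]//|]; split => //; exact/eqP.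
  rewrite big1 ?exprn_ge0 ?invr_ge0// => i _.
  rewrite (_ : nu0 _ = 0%E)// -(measure0 nu0); apply: eq_on => //.
    exact: measurable_preimage_lap.
  by move=> x x01; split => //; rewrite AE => -[/= /eqP + _]; rewrite p_lap noi.
have lnN : 0 <= ln N%:R :> R by rewrite ln_ge0// ler1n.
(* The constant [ln N] pays for the integer part in [q]. *)
apply: (ks_entropy_ge (C := ln N%:R) mf tower_invariant mp) => n.
set q := (n %/ k.+1)%N.
have nq : n%:R <= (q.+1 * k.+1)%:R :> R.
  by rewrite ler_nat ltnW// ltn_ceil.
apply: (@le_trans _ _ (q%:R * ln N%:R)).
  rewrite lerBlDr mulrAC ler_pdivrMr ?ltr0n//.
  apply: (le_trans (ler_wpM2l lnN nq)).
  by rewrite natrM -natr1 le_eqVlt; apply/orP; left; apply/eqP; ring.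
rewrite join_entropyE.
have -> : q%:R * ln N%:R = - ln (N%:R^-1 ^+ q) :> R.
  by rewrite lnXn ?invr_gt0 ?ltr0n// lnV ?posrE ?ltr0n// mulNrn opprK mulr_natl.
apply: label_entropy_ge => [|v]; first exact: (measurable_itinerary mf mp).
have mv := measurable_itinerary mf mp v.
rewrite /law nuE//.
suff H (j : 'I_k.+1) : fine (nu0 (iter j f @^-1` (itinerary f p n @^-1` [set v]))) <= N%:R^-1 ^+ q.
  apply: (@le_trans _ _ (k.+1%:R^-1 * \sum_(j < k.+1) N%:R^-1 ^+ q)).
    by rewrite ler_wpM2l ?invr_ge0// ler_sum.
  by rewrite sumr_const card_ord -(mulr_natl (N%:R^-1 ^+ q)) mulKf.
pose v' (s : nat) : 'I_N.+1 := if insub s is Some i then v i else ord_max.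
have v'E x t : (t < n)%N -> itinerary f p n (iter j f x) = v -> p (iter (t + j) f x) = v' t.
  by move=> tn xv; rewrite /v' insubT -xv ffunE/= iterD.
have qn : (q * k.+1 <= n)%N by exact: leq_trunc_div.
case: (posnP j) => [j0|j0].
  have [m1 le1] := ev_le q (fun s => v' (k.+1 * s)%N).
  apply: le_trans le1; apply: fine_le; rewrite ?fin_num_measure//; first exact: miter.
  apply: le_measure; rewrite ?inE//; first exact: miter.
  move=> x /= xv s sq; have := v'E x (k.+1 * s)%N _ xv; rewrite j0 addn0; apply.
  by apply: leq_trans qn; rewrite mulnC ltn_mul2r.
(* From a level [j > 0] the reading starts at the first return to the base, after [k.+1 - j] steps;
   [nu0_return] shifts the event back to [nu0]. *)
have [m1 le1] := ev_le q (fun s => v' (k.+1 * s.+1 - j)%N).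
rewrite -nu0_return// in le1.
apply: le_trans le1; apply: fine_le; rewrite ?fin_num_measure//; try exact: miter.
apply: le_measure; rewrite ?inE//; try exact: miter.
move=> x xv s sq; rewrite -iterD -mulnSr.
have jk : (j <= k.+1 * s.+1)%N by rewrite (leq_trans (ltnW (ltn_ord j)))// leq_pmulr.
have := v'E x (k.+1 * s.+1 - j)%N _ xv; rewrite subnK//; apply.
apply: leq_trans qn; apply: (@leq_trans (k.+1 * s.+1)).
  by rewrite ltn_subrL j0 muln_gt0.
by rewrite mulnC leq_mul2r sq orbT.
Qed.

Lemma towerE (A : set B) : measurable A -> fine (nu A) =
  k.+1%:R^-1 * \sum_(j < k.+1) fine (nu0 (cword lam (drop j w) @^-1` A)).
Proof.
move=> mA; rewrite nuE//; congr (_ * _).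
rewrite big_ord_recl [RHS]big_ord_recr/= addrC; congr (_ + _).
  by rewrite drop_size.
apply: eq_bigr => j _.
rewrite [X in nu0 X](_ : _ = iter j.+1 f @^-1` A)// nu0_iter//; exact: ltnW.
Qed.

Let quarter : set B := `]1 / 4, 3 / 4[%classic.

Let mquarter : measurable quarter. Proof. exact: measurable_itv. Qed.

Let first_visit s : set B :=
  [set x | quarter (iter s f x) /\ forall i, (i < s)%N -> ~ quarter (iter i f x)].

Let mfirst_visit s : measurable (first_visit s).
Proof.
rewrite (_ : first_visit s = iter s f @^-1` quarter `&`
  \bigcap_(i in `I_s) ~` (iter i f @^-1` quarter)).
  apply: measurableI; first exact: miter.
  by apply: bigcap_measurableType => i _; apply: measurableC; exact: miter.
by apply/seteqP; split => x [h1 h2]; split.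
Qed.

Let first_visit_uniq s t x : first_visit s x -> first_visit t x -> s = t.
Proof.
move=> [h1 h2] [h3 h4]; case: (ltngtP s t) => // [st|ts].
  by have := h4 _ st.
by have := h2 _ ts.
Qed.

(** As long as letters remain to be read, [cbranch_side] keeps the orbit below 1/4 or above 3/4. *)
Let cword_first_visit j y : (j <= k)%N -> 0 <= y <= 1 -> quarter y ->
  first_visit (k - j) (cword lam (drop j w) y).
Proof.
move=> jk y01 qy; have sz : size (drop j w) = (k - j)%N by rewrite size_drop.
split.
  by rewrite (iter_cword lam8 fK)// ?sz// -sz drop_size.
move=> i ik; rewrite (iter_cword lam8 fK)// ?sz; last exact: ltnW.
case E : (drop i (drop j w)) => [|c v].
  by move/(congr1 size): E; rewrite size_drop sz /= => /eqP; rewrite subn_eq0 leqNgt ik.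
have := cbranch_side lam8 c (cword01 lam8 v y01).
have -> : cword lam (c :: v) y = cbranch lam c (cword lam v y) by [].
rewrite /quarter /= in_itv/=.
by case: c {E} => h /andP[h1 h2]; lra.
Qed.

(** A point coded by [drop j.+1 w] has first visit time [s = k - j.+1], so the letter to prepend is
    number [k.-1 - s = j] of [w]. *)
Let pull_true : set B :=
  \bigcup_(s in [set s | (s < k)%N && nth false w (k.-1 - s)]) first_visit s.

Let mpull_true : measurable pull_true.
Proof. by apply: bigcup_measurable => s _. Qed.

(* An inverse branch of [f] on the support of [nu]: the first visit time to the
   central interval tells the position in the tower, hence the symbol to prepend. *)
Let pull (i : 'I_N) (x : B) : B :=
  if x \in first_visit k then first_crossing f (l i) (r i) x
  else cbranch lam (x \in pull_true) x.

Let measurable_mem (A : set B) : measurable A -> measurable_fun setT (fun x => x \in A).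
Proof.
move=> mA; apply: (measurable_fun_bool true); rewrite setTI (_ : _ @^-1` _ = A)//.
by apply/seteqP; split => x /= => [/set_mem|/mem_set].
Qed.

Let mpull i : measurable_fun setT (pull i).
Proof.
apply: measurable_fun_ifT; first exact: measurable_mem.
  by apply: nondecreasing_measurable => // x y; exact: first_crossing_homo.
rewrite (_ : (fun x => _) = fun x =>
    if x \in pull_true then cword lam [:: true] x else cword lam [:: false] x); last first.
  by apply/funext => x; case: ifP.
apply: measurable_fun_ifT; first exact: measurable_mem.
  exact: measurable_cword.
exact: measurable_cword.
Qed.

Let pull0 i y : 0 <= y <= 1 -> quarter y -> pull i (cword lam w y) = lap i y.
Proof.
move=> y01 qy; have := cword_first_visit (leq0n k) y01 qy; rewrite drop0 subn0 => h.
by rewrite /pull mem_set.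
Qed.

Let pullS i j y : (j < k)%N -> 0 <= y <= 1 -> quarter y ->
  pull i (cword lam (drop j.+1 w) y) = cword lam (drop j w) y.
Proof.
move=> jk y01 qy; have h := cword_first_visit jk y01 qy.
rewrite /pull memNset; last first.
  move=> /(first_visit_uniq h)/eqP; apply/negP; rewrite neq_ltn; apply/orP; left.
  by rewrite ltn_subrL (leq_ltn_trans _ jk).
rewrite (drop_nth false jk) [RHS]/(cbranch lam (nth false w j) (cword lam (drop j.+1 w) y)).
congr (cbranch lam _ _); apply/idP/idP.
  rewrite inE => -[s /= /andP[sk ws] /(first_visit_uniq h) E].
  have jE : (k.-1 - s)%N = j by lia.
  by rewrite -jE.
move=> wj; rewrite inE; exists (k - j.+1)%N => //=.
have -> : (k.-1 - (k - j.+1))%N = j by lia.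
by rewrite wj andbT; lia.
Qed.

(** The branches [pull i] differ only on [first_visit k], which contains almost all of level 1 and
    therefore has mass at least [1 / k.+1]; there each lap supplies one preimage. *)
Lemma tower_folding : (1 < N)%N -> ((ln N%:R / k.+1%:R)%:E <= folding_entropy f nu)%E.
Proof.
move=> N1.
have mS : measurable (quarter `&` `[0, 1]%classic).
  by apply: measurableI => //; exact: measurable_itv.
have nu0Q : nu0 (quarter `&` `[0, 1]%classic) = 1%E.
  transitivity (nu0 quarter).
    apply: (@probability_eq_on _ _ _ nu0 `[0, 1]%classic) => // x h.
    by split => [[]|].
  by rewrite -probability_fineK// nu0_quarter.
(* [nu0] is carried by the central interval, and for its points [cword_first_visit] gives the visit
   times. *)
have on_quarter (A C : set B) : measurable A -> measurable C ->
    (forall x, 0 <= x <= 1 -> quarter x -> A x <-> C x) -> fine (nu0 A) = fine (nu0 C).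
  move=> mA mC AC; congr fine; apply: (probability_eq_on mS) => // x [qx].
  by rewrite /= in_itv/= => x01; exact: AC.
have mpp i A : measurable A -> measurable (pull i @^-1` A).
  by move=> mA; rewrite -[X in measurable X]setTI; exact: mpull.
have nu_pull A : measurable A ->
    fine (nu A) = N%:R^-1 * \sum_i fine (nu (pull i @^-1` A)).
  move=> mA.
  have E i : fine (nu (pull i @^-1` A)) = k.+1%:R^-1 * (fine (nu0 (lap i @^-1` A)) +
      \sum_(j < k) fine (nu0 (cword lam (drop j w) @^-1` A))).
    rewrite towerE; last exact: mpp.
    rewrite big_ord_recl/= drop0; congr (_ * (_ + _)).
      apply: on_quarter; first by apply: (measurable_preimage_cword lam8 w); exact: mpp.
        exact: measurable_preimage_lap.
      by move=> x x01 qx; rewrite /= pull0.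
    apply: eq_bigr => j _; apply: on_quarter; [by apply: mcword; exact: mpp|exact: mcword|].
    by move=> x x01 qx; rewrite /preimage/= pullS.
  rewrite (eq_bigr _ (fun i _ => E i)) -mulr_sumr mulrCA towerE//; congr (_ * _).
  rewrite big_split/= mulrDr -nu0S// sumr_const card_ord.
  rewrite -(mulr_natl (\sum_(j < k) _)) mulKf// big_ord_recr/= addrC.
  by rewrite drop_size.
have mpK i : measurable [set x | f (pull i x) = x].
  rewrite (_ : [set x | _] = (fun x : B => f (pull i x) - x : B) @^-1` [set 0%R]).
    rewrite -[X in measurable X]setTI; apply: measurable_funB => //.
    exact: (measurableT_comp mf (mpull i)).
  apply/seteqP; split => x /=; first by move=> ->; rewrite subrr.
  by move/eqP; rewrite subr_eq0 => /eqP.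
have pullK i : nu [set x | f (pull i x) = x] = 1%E.
  rewrite -probability_fineK// towerE// (eq_bigr (fun=> 1)).
    by rewrite sumr_const card_ord mulVf.
  move=> [j jk] _; transitivity (fine (nu0 setT)); last by rewrite probability_setT.
  apply: on_quarter => //; first exact: mcword.
  move=> x x01 qx; split => // _ /=.
  case: j jk => [|j] jk; first by rewrite drop0 pull0// f_lap.
  by rewrite pullS// (drop_nth false jk) [cword _ _ _]/(cbranch lam _ _) fK// cword01.
have mI i : measurable (`[l i, r i]%classic : set B) by exact: measurable_itv.
have mfv : measurable (first_visit k) by [].
apply: (@le_trans _ _ ((ln N%:R)%:E * nu (first_visit k))%E); last first.
  apply: (folding_entropy_ge mf tower_invariant N1 mpull nu_pull pullK mfv mI).
    move=> i j ij; apply/seteqP; split => // x [] /=; rewrite !in_itv/= => /andP[h1 h2] /andP[h3 h4].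
    have [h|h] := lap_disj ij.
      by have := le_lt_trans (le_trans h3 h2) h; rewrite ltxx.
    by have := le_lt_trans (le_trans h1 h4) h; rewrite ltxx.
  move=> i x xk; rewrite /= in_itv/= /pull mem_set//; exact: first_crossing_itv.
rewrite -(probability_fineK nu mfv) -EFinM lee_fin ler_wpM2l ?ln_ge0 ?ler1n//.
rewrite towerE// big_ord_recl/= drop0 (on_quarter _ setT)//.
- rewrite probability_setT mulrDr mulr1 lerDl mulr_ge0 ?invr_ge0//.
  by apply: sumr_ge0 => j _; rewrite fine_ge0.
- exact: (measurable_preimage_cword lam8 w).
- move=> x x01 qx; split => // _ /=.
  by have := cword_first_visit (leq0n k) x01 qx; rewrite drop0 subn0.
Qed.

End tower.

(** * The Champernowne sequence *)

Section champernowne.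
Local Open Scope nat_scope.
Implicit Types (u v w : seq bool).

Fixpoint words n : seq (seq bool) :=
  if n is n'.+1 then map (cons false) (words n') ++ map (cons true) (words n')
  else [:: [::]].

(** The values are successive prefixes of one infinite sequence, so their cylinders are nested. *)
Fixpoint champernowne n : seq bool :=
  if n is n'.+1 then champernowne n' ++ flatten (words n) else [::].

(** The place after the last letter counts too: this gives [(size w).+1] places, one for each level
    of the tower, and changes nothing for nonempty [u]. *)
Fixpoint occurrences u w : nat :=
  (take (size u) w == u) + (if w is _ :: w' then occurrences u w' else 0).

Lemma occurrencesE u w :
  occurrences u w = \sum_(j < (size w).+1) (take (size u) (drop j w) == u).
Proof.
elim: w => [|b w IH]; first by rewrite /= big_ord_recl big_ord0.
by rewrite big_ord_recl /= IH.
Qed.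

(** Occurrences across the junction only add to the count. An empty [u] would be counted twice at
    the junction. *)
Lemma occurrences_cat u v w : u != [::] ->
  occurrences u v + occurrences u w <= occurrences u (v ++ w).
Proof.
move=> u0; elim: v => [|b v IH]; first by rewrite /= eq_sym (negbTE u0).
have E b' v' : occurrences u (b' :: v') = (take (size u) (b' :: v') == u) + occurrences u v' by [].
rewrite cat_cons !E -addnA leq_add//.
case: eqP => // uE; rewrite lt0b; apply/eqP.
by rewrite -cat_cons takel_cat// -{1}uE size_take_min geq_minr.
Qed.

Lemma occurrences_flatten u (s : seq (seq bool)) : u != [::] ->
  \sum_(v <- s) occurrences u v <= occurrences u (flatten s).
Proof.
move=> u0; elim: s => [|v s IH]; first by rewrite big_nil.
by rewrite big_cons /=; apply: leq_trans (occurrences_cat _ _ u0); rewrite leq_add2l.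
Qed.

Lemma sum_words (F : seq bool -> nat) n :
  \sum_(v <- words n.+1) F v = \sum_(v <- words n) (F (false :: v) + F (true :: v)).
Proof. by rewrite /= big_cat !big_map big_split. Qed.

Lemma size_words n : size (words n) = 2 ^ n.
Proof. by elim: n => //= n IH; rewrite size_cat !size_map IH addnn -mul2n expnS. Qed.

Lemma size_flatten_words n : size (flatten (words n)) = n * 2 ^ n.
Proof.
have wn : all (fun v => size v == n) (words n).
  elim: n => //= n IH; rewrite all_cat !all_map.
  by rewrite (eq_all (a2 := fun v => size v == n)) ?IH// => v /=; rewrite eqSS.
rewrite size_flatten sumnE big_map big_seq (eq_bigr (fun=> n)) => [|v /(allP wn)/eqP//].
by rewrite -big_seq big_const_seq count_predT size_words iter_addn_0.
Qed.

Lemma prefix_words u n : size u <= n ->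
  (\sum_(v <- words n) (take (size u) v == u)) * 2 ^ size u = 2 ^ n.
Proof.
elim: u n => [|b u IH] [|n] //= un.
- by rewrite big_cons big_nil.
- rewrite expn0 muln1 (eq_bigr (fun=> 1)) => [|v _]; last by rewrite take0.
  by rewrite -(size_words n.+1) big_const_seq count_predT iter_addn_0 mul1n.
rewrite -[_ ++ _]/(words n.+1) sum_words expnS mulnCA [2 ^ n.+1]expnS -(IH n)//.
congr (2 * (_ * _)); apply: eq_bigr => v _ /=.
by rewrite !eqseq_cons; case: b => /=; rewrite ?addn0.
Qed.

(** At each of the [n.+1 - size u] places, [u] occurs in a fraction [2^-(size u)] of all words.
    Truncated subtraction settles the case of a long [u]. *)
Lemma occurrences_words u n :
  (n.+1 - size u) * 2 ^ n <= (\sum_(v <- words n) occurrences u v) * 2 ^ size u.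
Proof.
elim: n => [|n IH].
  rewrite /= big_cons big_nil !addn0 expn0 muln1.
  case: u => [|b u] //=.
have E : \sum_(v <- words n.+1) occurrences u v =
    \sum_(v <- words n.+1) (take (size u) v == u) + 2 * \sum_(v <- words n) occurrences u v.
  rewrite !sum_words big_distrr/= -big_split/=; apply: eq_bigr => v _.
  rewrite /=; lia.
rewrite E mulnDl -mulnA.
have [un|un] := leqP (size u) n.+1.
  rewrite prefix_words// subSn// mulSn leq_add2l expnS mulnCA leq_mul2l/=.
  exact: IH.
by rewrite (_ : n.+2 - size u = 0) ?mul0n//; lia.
Qed.

Lemma size_champernowne_ge n : n * 2 ^ n <= size (champernowne n).
Proof. by case: n => //= n; rewrite size_cat -[_ ++ _]/(words n.+1) size_flatten_words leq_addl. Qed.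

(** Ignoring occurrences that straddle two words loses at most [size u] places per word, and there
    are fewer than [2^(n + 1)] words of lengths 1 to [n]. *)
Lemma champernowne_occurrences u n : u != [::] ->
  size (champernowne n) <= occurrences u (champernowne n) * 2 ^ size u + size u * (2 ^ n.+1).
Proof.
move=> u0; elim: n => //= n IH.
rewrite -[_ ++ map _ _]/(words n.+1) size_cat size_flatten_words.
have h1 := occurrences_cat (champernowne n) (flatten (words n.+1)) u0.
have h2 := occurrences_flatten (words n.+1) u0.
have h3 := occurrences_words u n.+1.
have h4 : (\sum_(v <- words n.+1) occurrences u v) * 2 ^ size u <=
    occurrences u (flatten (words n.+1)) * 2 ^ size u by rewrite leq_mul2r h2 orbT.
have h5 : (occurrences u (champernowne n) + occurrences u (flatten (words n.+1))) * 2 ^ size u <=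
    occurrences u (champernowne n ++ flatten (words n.+1)) * 2 ^ size u.
  by rewrite leq_mul2r h1 orbT.
rewrite mulnDl in h5.
have h6 : n.+1 * 2 ^ n.+1 <= (n.+2 - size u) * 2 ^ n.+1 + size u * 2 ^ n.+1.
  by rewrite -mulnDl leq_mul2r; apply/orP; right; lia.
have h7 : size u * 2 ^ n.+2 = size u * 2 ^ n.+1 + size u * 2 ^ n.+1.
  by rewrite [2 ^ n.+2]expnS; lia.
lia.
Qed.

(** The previous error is of relative order [1 / n], because the length is at least [n * 2^n].
    Clearing denominators keeps the bound on the frequency of [u] in [nat]. *)
Lemma champernowne_frequency u n : u != [::] ->
  n * (size (champernowne n)).+1 <=
  n * (occurrences u (champernowne n) * 2 ^ size u) +
  (2 * size u + 1) * (size (champernowne n)).+1.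
Proof.
move=> u0; have h1 := champernowne_occurrences n u0; have h2 := size_champernowne_ge n.
set k := size _ in h1 h2 *; set o := occurrences _ _ in h1 *.
have p1 : 0 < 2 ^ n by rewrite expn_gt0.
have h3 : k.+1 <= o * 2 ^ size u + (2 * size u + 1) * 2 ^ n.
  by rewrite expnS in h1; nia.
have h4 : (2 * size u + 1) * (n * 2 ^ n) <= (2 * size u + 1) * k.+1.
  by rewrite leq_mul2l; apply/orP; right; lia.
have h5 : n * k.+1 <= n * (o * 2 ^ size u + (2 * size u + 1) * 2 ^ n).
  by rewrite leq_mul2l h3 orbT.
by nia.
Qed.

End champernowne.

Section champernowne_point.
Context {R : realType} (lam : R) (lam8 : 8 <= lam).

Lemma champernowne_point : exists x : R, forall n,
  cword lam (champernowne n) 0 <= x <= cword lam (champernowne n) 1.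
Proof.
have unit0 : 0 <= (0 : R) <= 1 by rewrite lexx ler01.
have unit1 : 0 <= (1 : R) <= 1 by rewrite lexx ler01.
pose a n := cword lam (champernowne n) 0; pose b n := cword lam (champernowne n) 1.
have aS n : a n <= a n.+1 /\ b n.+1 <= b n.
  have [/andP[h1 h2] /andP[h3 h4]] := (cword01 lam8 (flatten (words n.+1)) unit0,
    cword01 lam8 (flatten (words n.+1)) unit1).
  by split; rewrite /a /b [champernowne n.+1]/= cword_cat; apply: cword_homo.
have ab n : a n <= b n by apply: cword_homo.
have ndA : nondecreasing_seq a by apply/nondecreasing_seqP => n; have [] := aS n.
have niB : nonincreasing_seq b by apply/nonincreasing_seqP => n; have [] := aS n.
have amb m n : a m <= b n.
  have [mn|nm] := leqP m n; first exact: le_trans (ndA _ _ mn) (ab n).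
  exact: le_trans (ab m) (niB _ _ (ltnW nm)).
have cva : cvgn a by apply: nondecreasing_is_cvgn => //; exists (b 0%N) => _ [n _ <-].
exists (limn a) => n; apply/andP; split; first exact: nondecreasing_cvgn_le.
by apply: limr_le => //; apply: nearW => m; exact: amb.
Qed.

End champernowne_point.

(** * Regularity of the interval map *)

Section smoothness.
Context {R : realType}.
Implicit Types (f g : R -> R) (n : nat).

Fixpoint Ck n f : Prop :=
  if n is n'.+1 then exists2 f', forall x : R, is_derive x 1 f (f' x) & Ck n' f'
  else continuous f.

Lemma is_derive_continuous f (x l : R) : is_derive x 1 f l -> {for x, continuous f}.
Proof. by move=> [fx _]; exact/differentiable_continuous/derivable1_diffP. Qed.

Lemma Ck_continuous n f : Ck n f -> continuous f.
Proof. by case: n => [//|n] [f' ff' _] x; exact: is_derive_continuous. Qed.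

Lemma CkW n f : Ck n.+1 f -> Ck n f.
Proof.
elim: n f => [|n IH] f; first exact: Ck_continuous.
by move=> [f' ff' /IH f'n]; exists f'.
Qed.

Lemma Ck_cst n (c : R) : Ck n (fun=> c).
Proof.
elim: n c => [|n IH] c /=; first exact: cst_continuous.
by exists (fun=> 0) => // x; exact: is_derive_cst.
Qed.

Lemma Ck_id n : Ck n id.
Proof.
case: n => [|n] /=; first by move=> x.
by exists (fun=> 1); [move=> x; exact: is_derive_id|exact: Ck_cst].
Qed.

Lemma CkD n f g : Ck n f -> Ck n g -> Ck n (fun x => f x + g x).
Proof.
elim: n f g => [|n IH] f g /=; first by move=> cf cg x; apply: cvgD; [exact: cf|exact: cg].
move=> [f' ff' f'n] [g' gg' g'n]; exists (fun x => f' x + g' x); last exact: IH.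
by move=> x; apply: is_deriveD.
Qed.

Lemma CkM n f g : Ck n f -> Ck n g -> Ck n (fun x => f x * g x).
Proof.
elim: n f g => [|n IH] f g; first by move=> cf cg x; apply: cvgM; [exact: cf|exact: cg].
move=> cf cg; have [fn gn] := (CkW cf, CkW cg).
case: cf cg => [f' ff' f'n] [g' gg' g'n].
exists (fun x => f' x * g x + f x * g' x); last by apply: CkD; exact: IH.
move=> x; have := ff' x; have := gg' x => h1 h2; apply: is_derive_eq.
by rewrite !/GRing.scale/= addrC mulrC [f x * _]mulrC; ring.
Qed.

Lemma Ck_comp n f g : Ck n f -> Ck n g -> Ck n (fun x => f (g x)).
Proof.
elim: n f g => [|n IH] f g.
  by move=> cf cg x; apply: (@continuous_comp _ _ _ g f); [exact: cg|exact: cf].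
move=> [f' ff' f'n] cg; have gn := CkW cg.
case: cg => [g' gg' g'n].
exists (fun x => f' (g x) * g' x); last by apply: CkM => //; exact: IH.
by move=> x; apply: (@is_derive1_comp _ f g).
Qed.

(** Used where formulas are glued: at the corner of [ramp] and at the origin of [osc]. *)
Lemma is_derive0_quadratic f (x : R) :
  (\forall y \near x, `|f y - f x| <= (y - x) ^+ 2) -> is_derive x 1 f 0.
Proof.
move=> fq; apply/is_derive1_caratheodory.
exists (fun y => (f y - f x) / (y - x)); split.
- move=> y; have [->|yx] := eqVneq y x; first by rewrite !subrr mulr0.
  by rewrite divfK// subr_eq0.
- rewrite /prop_for /continuous_at !subrr mul0r; apply/norm_cvg0P.
  apply: (@squeeze_cvgr _ _ _ _ (fun=> 0) (fun y => `|y - x|)).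
  + near=> y; rewrite normr_ge0/= normrM normfV.
    have [->|yx] := eqVneq y x; first by rewrite !subrr normr0 mul0r.
    rewrite ler_pdivrMr ?normr_gt0 ?subr_eq0// -expr2 real_normK ?num_real//.
    near: y; exact: fq.
  + exact: cvg_cst.
  + apply/norm_cvg0P; apply: cvg_trans (_ : (y - x) @[y --> x] --> x - x) _; last by rewrite subrr.
    by apply: cvgB => //; exact: cvg_cst.
- by rewrite subrr mul0r.
Unshelve. all: by end_near. Qed.

Lemma is_derive_quotient f (x l : R) : is_derive x 1 f l ->
  (fun y => (f y - f x) / (y - x)) @ x^' --> l.
Proof.
move=> /is_derive1_caratheodory[g [fg cg <-]].
apply: cvg_trans (_ : g @ x^' --> g x); last exact: cvg_within_filter cg.
apply: near_eq_cvg; near=> y.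
have yx : y - x != 0 by rewrite subr_eq0; near: y; exact: nbhs_dnbhs_neq.
by rewrite fg mulfK.
Unshelve. all: by end_near. Qed.

Lemma Ck_derivatives n f : Ck n f -> exists D : nat -> R -> R,
  [/\ D 0%N = f, forall i, (i < n)%N -> forall x : R, is_derive x 1 (D i) (D i.+1 x) &
      forall i, (i <= n)%N -> continuous (D i)].
Proof.
elim: n f => [|n IH] f; first by move=> cf; exists (fun=> f); split=> //.
move=> cf; have f0 := Ck_continuous cf; case: cf => [f' ff' /IH[D [D0 DD Dc]]].
exists (fun i => if i is i'.+1 then D i' else f); split=> //.
- by move=> [_ x|i /DD//]; rewrite D0; exact: ff'.
- by move=> [//|i /Dc].
Qed.

Lemma continuous_bounded (a b : R) f : a <= b -> continuous f ->
  exists2 C, 0 <= C & forall x, x \in `[a, b] -> `|f x| <= C.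
Proof.
move=> ab cf; have cn : {within `[a, b], continuous (fun x => `|f x|)}.
  by apply: continuous_subspaceT => x; apply: cvg_norm; exact: cf.
have [c _ h] := EVT_max ab cn; by exists `|f c|.
Qed.

Lemma derivative_bounded_lipschitz (a b C : R) f f' :
  (forall x : R, is_derive x 1 f (f' x)) -> (forall x, x \in `[a, b] -> `|f' x| <= C) ->
  {in `[a, b] &, forall x y, `|f x - f y| <= C * `|x - y|}.
Proof.
move=> ff' f'C x y xab yab; wlog xy : x y xab yab / y <= x.
  by move=> W; have [/W|/ltW/W] := leP y x; [exact|rewrite distrC [`|x - y|]distrC; exact].
have [|c cxy ->] := @MVT_segment R f f' y x xy (fun z _ => ff' z).
  by apply: continuous_subspaceT => z; exact: is_derive_continuous (ff' z).
rewrite normrM ler_wpM2r//; apply: f'C; move: cxy xab yab.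
rewrite !in_itv/= => /andP[h1 h2] /andP[_ h3] /andP[h4 _].
by rewrite (le_trans h4)//= (le_trans h2).
Qed.

(** Turns Lipschitz into Hoelder bounds at bounded distance: the power is at least [d] for
    [0 < d <= 1] and at least 1 for [d > 1]. *)
Lemma le_powR_bounded (d e s : R) : 0 <= d -> d <= e -> 1 <= e -> 0 <= s <= 1 ->
  d <= e * d `^ s.
Proof.
move=> d0 de e1 /andP[s0 s1].
have [->|dn0] := eqVneq d 0; first by rewrite mulr_ge0 ?powR_ge0 ?(le_trans _ e1).
have [d1|d1] := leP d 1.
  apply: (@le_trans _ _ (d `^ s)); last by rewrite ler_peMl ?powR_ge0.
  by apply: ger1_powR => //; rewrite lt_neqAle eq_sym dn0 d0.
apply: (le_trans de); rewrite ler_peMr ?(le_trans _ e1)//.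
by rewrite -(powRr0 d); apply: ler_powR => //; exact: ltW.
Qed.

(** The extra derivative makes the one of order [Num.truncn r] Lipschitz, hence Hoelder of the
    required exponent on a bounded interval. *)
Lemma Ck_Cr_on (r a b : R) f : 1 <= r -> a <= b -> Ck (Num.truncn r).+1 f -> Cr_on r a b f.
Proof.
move=> r1 ab /Ck_derivatives[D [D0 DD Dc]].
have /andP[tr1 tr2] := truncn_itv (le_trans ler01 r1).
exists D; split.
- by move=> x _; rewrite D0.
- move=> i ik x _; apply: cvg_within_filter; apply: is_derive_quotient; apply: DD.
  exact: ltnW.
- by apply: continuous_subspaceT; exact: Dc.
have [C C0 hC] := continuous_bounded ab (Dc _ (leqnn _)).
exists (C * (1 + (b - a))) => x y xab yab.
have := derivative_bounded_lipschitz (DD _ (ltnSn _)) hC xab yab.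
move=> /le_trans; apply; rewrite -mulrA ler_wpM2l//; apply: le_powR_bounded => //.
- move: xab yab; rewrite !in_itv/= ler_norml => /andP[? ?] /andP[? ?]; lra.
- by rewrite lerDl subr_ge0.
- by rewrite subr_ge0 tr1/= lerBlDr; rewrite -natr1 addrC in tr2; exact: ltW.
Qed.

End smoothness.

(** * The cutoff function and the oscillating function *)

Section oscillation.
Context {R : realType}.
Implicit Types (n q : nat) (t x c : R).

Lemma is_derive_exprn n x : is_derive x 1 (fun y => y ^+ n.+1) (n.+1%:R * x ^+ n).
Proof.
have := @is_deriveX R R id n.+1 x 1 1 (is_derive_id x 1).
rewrite (_ : id ^+ n.+1 = (fun y => y ^+ n.+1)); last by apply/funext => y; rewrite exprfctE.
move=> h; apply: is_derive_eq; by rewrite /GRing.scale/= mulr1.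
Qed.

Definition ramp n x : R := Num.max 0 x ^+ n.

Lemma Ck_ramp n : Ck n (ramp n.+1).
Proof.
elim: n => [|n IH].
  rewrite (_ : ramp 1 = fun x => Num.max 0 x); last first.
    by apply/funext => x; rewrite /ramp expr1.
  by move=> x; apply: continuous_max; [exact: cst_continuous|].
exists (fun x => n.+2%:R * ramp n.+1 x); last by apply: CkM => //; exact: Ck_cst.
move=> x; have [x0|x0|x0] := ltgtP x 0.
- rewrite /ramp max_l ?ltW// expr0n mulr0.
  apply: (@near_eq_is_derive R R R (cst 0)).
  near=> y; rewrite /ramp max_l ?expr0n//; apply/ltW.
  by near: y; exact: lt_nbhsl.
- apply: (@near_eq_is_derive R R R (fun y => y ^+ n.+2)).
    near=> y; rewrite /ramp max_r//; apply/ltW.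
    by near: y; exact: lt_nbhsr.
  by rewrite /ramp max_r ?ltW//; exact: is_derive_exprn.
- rewrite x0 /ramp maxxx expr0n mulr0; apply: is_derive0_quadratic.
  near=> y; rewrite maxxx expr0n !subr0.
  have y1 : `|y| <= 1.
    apply/ltW; near: y; have := @nbhsx_ballx _ R 0 1 ltr01.
    by apply: filterS => z; rewrite /ball/= sub0r normrN.
  have [y0|y0] := leP y 0; first by rewrite expr0n normr0 sqr_ge0.
  rewrite (ger0_norm (exprn_ge0 _ (ltW y0))); rewrite gtr0_norm// in y1.
  by rewrite -[n.+2]add2n exprD ler_piMr ?sqr_ge0// exprn_ile1// (ltW y0).
Unshelve. all: by end_near. Qed.

(* [64 x ^ 2 - 1] is nonpositive for [|x| <= 1/8] and at least 1 for [|x| >= 1/4]. *)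
Definition bump n x : R := ramp n.+1 (1 - ramp n.+1 (64 * x ^+ 2 - 1)).

Lemma Ck_bump n : Ck n (bump n).
Proof.
have Cid := @Ck_id R n; have Ccst := @Ck_cst R n; have Cr := Ck_ramp n.
have C1 : Ck n (fun x : R => 1 + -1 * ramp n.+1 (64 * (x * x) + -1)).
  apply: CkD => //; apply: CkM => //; apply: (Ck_comp Cr).
  by apply: CkD => //; apply: CkM => //; apply: CkM.
by have := Ck_comp Cr C1; congr (Ck n _); apply/funext => x; rewrite /bump mulN1r expr2.
Qed.

Lemma bump01 n x : 0 <= bump n x <= 1.
Proof.
have r0 z : 0 <= ramp n.+1 z by rewrite exprn_ge0// le_max lexx.
rewrite r0/= exprn_ile1// ?le_max ?lexx// ge_max ler01/=.
by rewrite lerBlDr lerDl.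
Qed.

Lemma bump1 n x : `|x| <= 1 / 8 -> bump n x = 1.
Proof.
move=> x8; have x2 : 64 * x ^+ 2 - 1 <= 0.
  have : `|x| ^+ 2 <= (1 / 8) ^+ 2 by rewrite ler_pXn2r ?nnegrE.
  by rewrite real_normK ?num_real//; lra.
by rewrite /bump /ramp [Num.max 0 (64 * _ - 1)]max_l// expr0n subr0 max_r ?expr1n.
Qed.

Lemma bump0 n x : 1 / 4 <= `|x| -> bump n x = 0.
Proof.
move=> x4; have x2 : 1 <= 64 * x ^+ 2 - 1.
  have : (1 / 4) ^+ 2 <= `|x| ^+ 2 by rewrite ler_pXn2r ?nnegrE//; lra.
  by rewrite real_normK ?num_real//; lra.
rewrite /bump /ramp [Num.max 0 (64 * _ - 1)]max_r; last by lra.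
by rewrite max_l ?expr0n// subr_le0 exprn_ege1.
Qed.

(* The phase [c] treats sine and cosine together, which makes the class stable
   under differentiation.  At [t = 0] the junk value [0^-1 = 0] is harmless, since
   [0 ^+ q = 0]. *)
Definition osc q c t : R := t ^+ q * sin (t^-1 + c).

Lemma osc_le q c t : `|osc q c t| <= `|t| ^+ q.
Proof.
rewrite normrM normrX ler_piMr ?exprn_ge0// ler_norml sin_geN1 sin_le1//.
Qed.

(** Differentiation leaves the powers [q - 1] and [q - 2], the latter because [1 / t] has derivative
    [- 1 / t^2]; so each derivative costs two powers. *)
Lemma Ck_osc n q c : (2 * n < q)%N -> Ck n (osc q c).
Proof.
elim: n q c => [|n IH] q c qn.
  move=> x; have [->|x0] := eqVneq x 0.
    have q0 : (0 < q)%N by [].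
    rewrite /continuous_at {2}/osc expr0n gtn_eqF// mul0r; apply/norm_cvg0P.
    apply: (@squeeze_cvgr _ _ _ _ (fun=> 0) (fun y => `|y ^+ q|)).
    - by apply: nearW => y; rewrite normr_ge0/= normrX osc_le.
    - exact: cvg_cst.
    - apply/norm_cvg0P; have := @exprn_continuous R q 0.
      by rewrite /continuous_at expr0n gtn_eqF.
  apply: cvgM; first exact: exprn_continuous.
  apply: (@continuous_comp _ _ _ (fun y : R => y^-1 + c) (@sin R)); last exact: continuous_sin.
  by apply: cvgD; [exact: inv_continuous|exact: cvg_cst].
(* The cosine from the chain rule is a sine with phase advanced by [pi / 2]. *)
exists (fun t => q%:R * osc q.-1 c t + -1 * osc q.-2 (c + pi / 2) t); last first.
  have [h1 h2] : (2 * n < q.-1)%N /\ (2 * n < q.-2)%N by lia.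
  by apply: CkD; apply: CkM; by [exact: Ck_cst|exact: IH].
case: q qn => [//|[|[|q]]] qn; rewrite ?(mulnS 2)//= in qn *.
move=> x; have [->|x0] := eqVneq x 0.
  rewrite /osc !exprS !mul0r !mulr0 addr0.
  apply: is_derive0_quadratic; near=> y.
  rewrite expr0n mul0r !subr0.
  have y1 : `|y| <= 1.
    apply/ltW; near: y; have := @nbhsx_ballx _ R 0 1 ltr01.
    by apply: filterS => z; rewrite /ball/= sub0r normrN.
  apply: (le_trans (osc_le q.+3 c y)).
  rewrite -addn2 addnC exprD real_normK ?num_real// ler_piMr ?sqr_ge0// exprn_ile1//.
have dV : is_derive x 1 (fun y : R => y^-1) (- x ^- 2 *: 1) by apply: (is_deriveV x0).
have dc : is_derive x 1 (fun y : R => y^-1 + c) (- x ^- 2 *: 1 + 0) by apply: is_deriveD.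
have ds : is_derive x 1 (fun y : R => sin (y^-1 + c)) (cos (x^-1 + c) * (- x ^- 2 *: 1 + 0)).
  by apply: (@is_derive1_comp _ sin).
have dx := is_derive_exprn q.+2 x.
have := is_deriveM dx ds; rewrite -[X in is_derive _ _ X]/(osc q.+3 c) => h.
apply: is_derive_eq; rewrite /osc addrA sinDpihalf /GRing.scale/=.
by rewrite !exprS; field.
Unshelve. all: by end_near. Qed.

End oscillation.

Section interval_map.
Context {R : realType}.
Variables (n p : nat) (lam xinf : R).
Hypotheses (np : (2 * n < p)%N) (lam8 : 8 <= lam).

(** The bumps vanish outside disjoint open intervals of radius 1/4 and equal 1 within 1/8 of their
    centres. As [lam >= 8], the images of [cbranch] lie in this inner zone, where the map is
    affine. *)
Definition interval_map (x : R) : R :=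
  bump n x * (lam * x) + bump n (x - 1 / 2) * (xinf + osc p 0 (x - 1 / 2)) +
  bump n (x - 1) * (lam * (x - 1) + 1).

Lemma Ck_interval_map : Ck n interval_map.
Proof.
have Cid := @Ck_id R n; have Ccst := @Ck_cst R n.
have Cs c : Ck n (fun x : R => x - c) by apply: CkD.
have Cb c : Ck n (fun x : R => bump n (x - c)) by exact: (Ck_comp (Ck_bump n) (Cs c)).
apply: CkD; first apply: CkD.
- by apply: CkM; [exact: Ck_bump|exact: CkM].
- apply: CkM => //; apply: CkD => //.
  exact: (Ck_comp (Ck_osc 0 np) (Cs _)).
- apply: CkM => //; apply: CkD => //; exact: CkM.
Qed.

Lemma interval_map_cbranch b y : 0 <= y <= 1 -> interval_map (cbranch lam b y) = y.
Proof.
move=> /andP[y0 y1]; have l8 := lam8.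
have lam0 : 0 < lam by lra.
have i8 : lam^-1 <= 1 / 8 by rewrite invf_ple ?posrE//; lra.
have i0 : 0 < lam^-1 by rewrite invr_gt0.
have [z0 z8] : 0 <= y / lam /\ y / lam <= 1 / 8.
  by split; [rewrite mulr_ge0// ltW|nra].
have [w0 w8] : 0 <= (1 - y) / lam /\ (1 - y) / lam <= 1 / 8.
  by split; [rewrite mulr_ge0// ?subr_ge0// ltW|nra].
case: b; rewrite /interval_map /=.
- rewrite [bump n (1 - _)]bump0; last by rewrite ger0_norm; lra.
  rewrite [bump n (1 - _ - 1 / 2)]bump0; last by rewrite ger0_norm; lra.
  rewrite bump1; last by rewrite ler_norml; lra.
  by field; rewrite gt_eqF.
- rewrite bump1; last by rewrite ler_norml; lra.
  rewrite bump0; last by rewrite ler0_norm; lra.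
  rewrite bump0; last by rewrite ler0_norm; lra.
  by field; rewrite gt_eqF.
Qed.

Lemma interval_map_half t : 0 <= t <= 1 / 8 ->
  interval_map (1 / 2 + t) = xinf + t ^+ p * sin t^-1.
Proof.
move=> /andP[t0 t8]; rewrite /interval_map.
rewrite bump0; last by rewrite ger0_norm; lra.
rewrite (_ : 1 / 2 + t - 1 / 2 = t); last by ring.
rewrite bump1; last by rewrite ger0_norm.
rewrite bump0; last by rewrite ler0_norm; lra.
by rewrite /osc addr0; ring.
Qed.

(** The map need not preserve [[0, 1]]; a global bound provides a larger invariant interval. *)
Lemma interval_map_bounded x : 0 <= xinf <= 1 -> `|interval_map x| <= 2 * lam + 4.
Proof.
move=> /andP[x0 x1]; have l8 := lam8.
have bb y (v c : R) : 0 <= c -> (`|y| <= 1 / 4 -> `|v| <= c) -> `|bump n y * v| <= c.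
  move=> c0 vc; have [y4|/ltW y4] := leP `|y| (1 / 4).
    have /andP[b0 b1] := bump01 n y.
    by rewrite normrM ger0_norm//; apply: le_trans (vc y4); rewrite ler_piMl.
  by rewrite bump0// mul0r normr0.
have t1 := bb x (lam * x) (lam / 4).
have t2 := bb (x - 1 / 2) (xinf + osc p 0 (x - 1 / 2)) 2.
have t3 := bb (x - 1) (lam * (x - 1) + 1) (lam / 4 + 1).
apply: (le_trans (ler_normD _ _)).
have {}t1 : `|bump n x * (lam * x)| <= lam / 4.
  apply: t1; first lra.
  by rewrite !ler_norml => /andP[? ?]; apply/andP; split; nra.
have {}t2 : `|bump n (x - 1 / 2) * (xinf + osc p 0 (x - 1 / 2))| <= 2.
  apply: t2 => // h; apply: (le_trans (ler_normD _ _)).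
  have := le_trans (osc_le p 0 (x - 1 / 2)) (exprn_ile1 p (normr_ge0 _) (le_trans h _)).
  by rewrite [`|xinf|]ger0_norm// => /(_ ltac:(lra)); lra.
have {}t3 : `|bump n (x - 1) * (lam * (x - 1) + 1)| <= lam / 4 + 1.
  apply: t3; first lra.
  by rewrite !ler_norml => /andP[? ?]; apply/andP; split; nra.
have := ler_normD (bump n x * (lam * x)) (bump n (x - 1 / 2) * (xinf + osc p 0 (x - 1 / 2))).
lra.
Qed.

End interval_map.

Section extrema_of_sin_inv.
Context {R : realType}.

Let pi2s (s : nat) : pi *+ 2 *+ s = 2 * s%:R * pi :> R.
Proof. by rewrite -mulrnA -(mulr_natl pi) natrM. Qed.

(** Together with [crest], the points where [sin (1 / t)] is -1 and 1 within one period; they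
    decrease as [s] grows. *)
Definition trough (s : nat) : R := (pi *+ 2 *+ s + (pi + pi / 2))^-1.
Definition crest (s : nat) : R := (pi *+ 2 *+ s + pi / 2)^-1.

Lemma sin_trough s : sin (trough s)^-1 = -1 :> R.
Proof.
rewrite invrK addrC (periodicn (@sinD2pi R)) addrC.
by have := @sinDpi R (pi / 2); rewrite sin_pihalf.
Qed.

Lemma sin_crest s : sin (crest s)^-1 = 1 :> R.
Proof. by rewrite invrK addrC (periodicn (@sinD2pi R)) sin_pihalf. Qed.

(** Since [pi < 4], the inverse of [trough s] is below [8 (s + 1) <= 16 N]; this is the origin of
    the constant 16. *)
Lemma trough_ge s N : (s < 2 * N)%N -> (16 * N%:R)^-1 <= trough s.
Proof.
move=> sN; have := @pihalf_lt2 R; have := @pi_ge2 R; have s0 : 0 <= s%:R :> R by [].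
have N1 : s%:R + 1 <= 2 * N%:R :> R by rewrite -natrM natr1 ler_nat.
move=> p2 p4; rewrite /trough pi2s.
rewrite lef_pV2 ?posrE; nra.
Qed.

Lemma trough_le_crest s : 0 < trough s /\ trough s <= crest s.
Proof.
have := @pi_gt0 R => p0; have s0 := mulrn_wge0 s (mulrn_wge0 2 (ltW p0)).
by split; [rewrite invr_gt0|rewrite lef_pV2 ?posrE]; lra.
Qed.

Lemma crest_le s : (2 <= s)%N -> crest s <= 1 / 8.
Proof.
move=> s2; have := @pi_ge2 R; have s0 : 2 <= s%:R :> R by rewrite ler_nat.
move=> p2; rewrite /crest pi2s mul1r.
rewrite lef_pV2 ?posrE; nra.
Qed.

Lemma crest_lt_trough s s' : (s < s')%N -> crest s' < trough s.
Proof.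
move=> ss'; have := @pi_gt0 R => p0.
have s1 : s%:R + 1 <= s'%:R :> R by rewrite natr1 ler_nat.
have s0 : 0 <= s%:R :> R by [].
rewrite /trough /crest !pi2s.
rewrite ltf_pV2 ?posrE; nra.
Qed.

End extrema_of_sin_inv.

Section interval_map_laps.
Context {R : realType}.
Variables (n p : nat) (lam xinf : R).
Hypothesis lam8 : 8 <= lam.

(** At both extrema the oscillation is at least [(16 N)^-p], hence at least the length of the
    cylinder; from [xinf] inside the cylinder it reaches both ends. *)
Lemma interval_map_laps w (N s : nat) : (2 <= N)%N -> (N <= s < 2 * N)%N ->
  (16 * N%:R) ^+ p <= lam ^+ size w ->
  cword lam w 0 <= xinf <= cword lam w 1 ->
  interval_map n p lam xinf (1 / 2 + trough s) <= cword lam w 0 /\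
  cword lam w 1 <= interval_map n p lam xinf (1 / 2 + crest s).
Proof.
move=> N2 /andP[Ns sN] Np /andP[w0 w1]; have l8 := lam8.
have [l0 lr] := @trough_le_crest R s.
have r8 : crest s <= 1 / 8 :> R by apply: crest_le; exact: leq_trans Ns.
have lb : (16 * N%:R)^-1 <= trough s :> R by exact: trough_ge.
have r0 : 0 < crest s :> R by exact: lt_le_trans lr.
rewrite !interval_map_half; last first.
- by rewrite (ltW l0) (le_trans lr).
- by rewrite (ltW r0).
rewrite sin_trough sin_crest mulr1 mulrN1.
have wB := cwordB lam8 w 1 0; rewrite subr0 mul1r in wB.
have N0 : 0 < 16 * N%:R :> R by rewrite mulr_gt0// ltr0n (leq_trans _ N2).
have lamN : (lam ^+ size w)^-1 <= trough s ^+ p.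
  apply: le_trans (_ : ((16 * N%:R) ^+ p)^-1 <= _).
    by rewrite lef_pV2// posrE exprn_gt0//; lra.
  rewrite -exprVn; apply: lerXn2r => //; rewrite nnegrE; last exact: ltW.
  by rewrite invr_ge0 ltW.
have rp : trough s ^+ p <= crest s ^+ p :> R by apply: lerXn2r => //; rewrite nnegrE ltW.
rewrite -wB in lamN.
split; lra.
Qed.

End interval_map_laps.

(** * Weak* convergence *)

Lemma segment_uniform_continuity (R : realType) (a b e : R) (phi : R -> R) :
  {within `[a, b], continuous phi} -> 0 < e -> exists2 d : R, 0 < d &
  forall x y, a <= x <= b -> a <= y <= b -> `|x - y| < d -> `|phi x - phi y| < e.
Proof.
move=> /subspace_continuousP cphi e0.
have ballW (z s : R) : 0 < s -> \forall x \near z, `|z - x| < s.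
  by move=> s0; exact: (@nbhsx_ballx _ R z s s0).
have /compact_near_coveringP/near_covering_withinP cov := @segment_compact R a b.
have := cov _ (0^'+) (fun d x => forall y, a <= y <= b -> `|x - y| < d -> `|phi x - phi y| < e)
  (at_right_proper_filter 0).
case; last first.
  move=> d /= d0 H; exists (d / 2); first by rewrite divr_gt0.
  move=> x y xab yab xy; apply: (H (d / 2)) => //=; rewrite ?divr_gt0 ?in_itv//=.
  by rewrite sub0r normrN ger0_norm ?divr_ge0 ?ltW//; lra.
move=> x xab; have := cphi x xab; move=> /cvgrPdist_lt/(_ (e / 2)).
rewrite divr_gt0// => /(_ isT)/nbhs_ballP[s /= s0 H].
have s20 : 0 < s / 2 by rewrite divr_gt0.
exists ([set x' | `|x - x'| < s / 2], [set d | d < s / 2]).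
  split => /=; first exact: ballW.
  exact: nbhs_right_lt.
move=> [x' d] [/= xx' ds] x'ab y yab xy.
have h1 : `|phi x - phi x'| < e / 2 by apply: (H x') => //; rewrite /ball/=; lra.
have h2 : `|phi x - phi y| < e / 2.
  apply: (H y); last by rewrite /= in_itv.
  rewrite /ball/= (_ : x - y = (x - x') + (x' - y)); last by ring.
  by apply: (le_lt_trans (ler_normD _ _)); lra.
rewrite (_ : phi x' - phi y = (phi x - phi y) - (phi x - phi x')); last by ring.
by apply: (le_lt_trans (ler_normB _ _)); lra.
Qed.

Section integral_lower_bound.
Context {R : realType}.
Local Notation B := (measurableTypeR R).
Variables (P : probability B R) (D : set B) (phi : B -> R) (M e : R).
Hypotheses (mD : measurable D) (PD : P D = 1%E).
Hypothesis mphi : measurable_fun D phi.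
Hypothesis phiM : forall x, D x -> `|phi x| <= M.
Variables (I : finType) (A : I -> set B) (v : I -> R).
Hypothesis mA : forall u, measurable (A u).
Hypothesis AD : forall u, A u `<=` D.
Hypothesis A_disj : forall u u' x, A u x -> A u' x -> u = u'.
Hypothesis vM : forall u, `|v u| <= M.
Hypothesis e0 : 0 <= e.
Hypothesis Av : forall u x, A u x -> `|phi x - v u| <= e.

Lemma bounded_integrable : P.-integrable D (EFin \o phi).
Proof.
apply: measurable_bounded_integrable => //.
  exact: (le_lt_trans (probability_le1 P mD) (ltry 1)).
exists M; split; first exact: num_real.
by move=> y My x Dx; apply: le_trans (phiM Dx) (ltW My).
Qed.

(** Shifting [phi] by [M + e] makes it nonnegative, so the part of [D] outside the [A u] can be
    discarded; the shift is recovered because the target masses [c u] sum to 1. *)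
Lemma integral_lower_bound (c : I -> R) (d : R) : 0 <= M -> 0 <= d ->
  \sum_u c u = 1 -> (forall u, c u - d <= fine (P (A u))) ->
  \sum_u c u * v u - e - 2 * M * d * #|I|%:R <= \int[P]_(x in D) phi x.
Proof.
move=> M0 d0 c1 cP.
pose h x := phi x + (M + e).
have hge0 x : D x -> 0 <= h x.
  by have := e0; clear PD cP; move=> e0' /phiM; rewrite ler_norml /h => /andP[? _]; lra.
have mh : measurable_fun D h by apply: measurable_funD => //; exact: measurable_cst.
have int_c : P.-integrable D (EFin \o (fun=> M + e)).
  by apply: finite_measure_integrable_cst.
have int_h : \int[P]_(x in D) h x = \int[P]_(x in D) phi x + (M + e).
  rewrite RintegralD//; last exact: bounded_integrable.
  rewrite Rintegral_cst//; congr (_ + _).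
  by transitivity ((M + e) * fine (P D)) => //; rewrite PD mulr1.
have hfin : (\int[P]_(x in D) (h x)%:E)%E \is a fin_num.
  apply: integrable_fin_num => //.
  by have := integrableD mD bounded_integrable int_c.
have hsum : (\sum_u ((v u + M) * fine (P (A u)))%:E <= \int[P]_(x in D) (h x)%:E)%E.
  pose U := \big[setU/set0]_(u <- index_enum I) A u.
  have UD : U `<=` D by rewrite /U; elim/big_ind: _ => //; first by move=> X Y hX hY x [/hX|/hY].
  have mU : measurable U by apply: bigsetU_measurable.
  apply: (@le_trans _ _ (\int[P]_(x in U) (h x)%:E)%E); last first.
    by apply: ge0_subset_integral => //; exact/measurable_EFinP.
  rewrite ge0_integral_bigsetU//; last 4 first.
  - exact: index_enum_uniq.
  - by apply/trivIsetP => u u' _ _ /eqP uu'; rewrite -subset0 => x [/A_disj h1 /h1].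
  - by apply/measurable_EFinP; exact: measurable_funS mh.
  - by move=> x /UD/hge0; rewrite lee_fin.
  apply: lee_sum => u _; rewrite EFinM fineK ?fin_num_measure//.
  rewrite -integral_cst//; apply: ge0_le_integral => //.
  - move=> x Ax; rewrite lee_fin; have := vM u; rewrite ler_norml => /andP[? _]; clear PD cP hfin int_h; lra.
  - by apply/measurable_EFinP; apply: measurable_funS mh.
  - move=> x /Av; rewrite lee_fin /h ler_norml => /andP[? ?]; clear PD cP hfin int_h; lra.
have := fine_le _ hfin hsum; rewrite sumEFin => /(_ isT) /=.
rewrite -[fine (\int[P]_(x in D) _)]/(\int[P]_(x in D) h x) int_h.
apply: contraTT; rewrite -!ltNge => /[dup] hlt.
have : \sum_u (c u * v u + M * c u - 2 * M * d) <= \sum_u (v u + M) * fine (P (A u)).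
  apply: ler_sum => u _; have := vM u; rewrite ler_norml => /andP[v1 v2].
  have := cP u => cPu.
  have h1 : (v u + M) * (c u - d) <= (v u + M) * fine (P (A u)) by rewrite ler_wpM2l//; lra.
  have h2 : (v u + M) * d <= 2 * M * d by rewrite ler_wpM2r//; lra.
  lra.
rewrite sumrB big_split/= -mulr_sumr c1 sumr_const -(mulr_natr (2 * M * d)).
lra.
Qed.

End integral_lower_bound.

Section integral_estimate.
Context {R : realType}.
Local Notation B := (measurableTypeR R).

(** The lower bound applied to [phi] and to its opposite. *)
Lemma integral_estimate (P : probability B R) (D : set B) (phi : B -> R) (M e d : R)
    (I : finType) (A : I -> set B) (v c : I -> R) :
  measurable D -> P D = 1%E -> measurable_fun D phi ->
  (forall x, D x -> `|phi x| <= M) -> (forall u, measurable (A u)) ->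
  (forall u, A u `<=` D) -> (forall u u' x, A u x -> A u' x -> u = u') ->
  (forall u, `|v u| <= M) -> 0 <= e -> (forall u x, A u x -> `|phi x - v u| <= e) ->
  0 <= M -> 0 <= d -> \sum_u c u = 1 -> (forall u, c u - d <= fine (P (A u))) ->
  `|\int[P]_(x in D) phi x - \sum_u c u * v u| <= e + 2 * M * d * #|I|%:R.
Proof.
move=> mD PD mphi phiM mA AD dA vM e0 Av M0 d0 c1 cP.
have h1 := integral_lower_bound mD PD mphi phiM mA AD dA vM e0 Av M0 d0 c1 cP.
have h2 : \sum_u c u * - v u - e - 2 * M * d * #|I|%:R <= \int[P]_(x in D) (- 1 * phi x).
  apply: (@integral_lower_bound _ P D (fun x => - 1 * phi x) M e mD PD _ _ I A (fun u => - v u)) => //.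
  - by apply: measurable_funM => //; exact: measurable_cst.
  - by move=> x /phiM; rewrite mulN1r normrN.
  - by move=> u; rewrite normrN.
  - by move=> u x /Av; rewrite mulN1r -opprD normrN.
have int_phi : P.-integrable D (EFin \o phi) by exact: (bounded_integrable P mD mphi phiM).
rewrite RintegralZl// in h2.
have : \sum_u c u * - v u = - \sum_u c u * v u.
  by rewrite -sumrN; apply: eq_bigr => u _; rewrite mulrN.
move=> E; rewrite E in h2; clear PD cP; rewrite ler_norml; apply/andP; split; lra.
Qed.

Lemma cvg_initial_topology (S : choiceType) (T : topologicalType) (g : S -> T)
    (u : nat -> S) (s : S) :
  g (u n) @[n --> \oo] --> g s -> (u : nat -> initial_topology g) @ \oo --> (s : initial_topology g).
Proof.
move=> us A [_ [[C oC <-] Cs] CA].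
by have := us C (open_nbhs_nbhs (conj oC Cs)); apply: (@filterS _ \oo _) => n; exact: CA.
Qed.

Lemma cvg_prod_topology (I : Type) (T : I -> topologicalType) (u : nat -> prod_topology T)
    (s : prod_topology T) :
  (forall i, u n i @[n --> \oo] --> s i) -> u @ \oo --> s.
Proof.
move=> us; apply/cvg_sup => i.
exact: (@cvg_initial_topology _ _ (fun f : prod_topology T => f i) u s (us i)).
Qed.

Variables (lam : R) (lam8 : 8 <= lam).
Local Notation K u := (`[cword lam u 0, cword lam u 1]%classic : set B).

Lemma cword_inj u u' x x' : size u = size u' -> 0 <= x <= 1 -> 0 <= x' <= 1 ->
  cword lam u x = cword lam u' x' -> u = u'.
Proof.
move=> + x01 x'01; elim: u u' => [|b u IH] [|b' u'] //= [su] E.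
have y01 := cword01 lam8 u x01; have y'01 := cword01 lam8 u' x'01.
have bb' : b = b' by rewrite -(right_half_cbranch lam8 b y01) E right_half_cbranch.
rewrite -bb' in E *; congr (_ :: _); apply: IH => //.
have l0 : lam != 0 by rewrite gt_eqF// (lt_le_trans _ lam8).
have il0 : lam^-1 != 0 by rewrite invr_eq0.
move: E; case: (b) => /=; last by move/(mulIf il0).
by move/addrI/oppr_inj/(mulIf il0)/addrI/oppr_inj.
Qed.

Lemma cylinder_disjoint u u' x : size u = size u' -> K u x -> K u' x -> u = u'.
Proof.
move=> su; rewrite /= !in_itv/= => /(cword_surj lam8)[y y01 xy] /(cword_surj lam8)[y' y'01 xy'].
by apply: (cword_inj su y01 y'01); rewrite -xy.
Qed.

Variables (a b : R) (f : B -> B) (a0 : a <= 0) (b1 : 1 <= b).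
Variables (nu : nat -> weak_star_invariant a b f) (mu : weak_star_invariant a b f).
Hypothesis nuK : forall n u, u != [::] ->
  2^-1 ^+ size u - (2 * size u + 1)%:R / n.+1%:R <= fine ((nu n : invariant_prob a b f) (K u)).
Hypothesis muK : forall u, 2^-1 ^+ size u <= fine ((mu : invariant_prob a b f) (K u)).

(** A test function is almost constant on cylinders of a large fixed length [l], so the integrals
    against [nu n] and [mu] are both close to the same finite sum [S]. *)
Lemma cylinder_cvg_weak_star : nu @ \oo --> mu.
Proof.
apply: cvg_initial_topology; apply: cvg_prod_topology => -[phi cphi].
rewrite /integrals /=; apply/cvgrPdist_le => e e0.
have ab : a <= b by have := b1; have := a0; lra.
have mab : measurable (`[a, b]%classic : set B) by exact: measurable_itv.
have mphi : measurable_fun (`[a, b]%classic : set B) phi.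
  by apply: subspace_continuous_measurable_fun.
have [M M0 phiM] : exists2 M, 0 <= M & forall x, a <= x <= b -> `|phi x| <= M.
  have cn : {within `[a, b], continuous (fun x => `|phi x|)}.
    by move=> x; apply: cvg_norm; exact: cphi.
  by have [c _ h] := EVT_max ab cn; exists `|phi c|.
have [d d0 phid] := segment_uniform_continuity cphi (divr_gt0 e0 (ltr0n R 4)).
have [l l0 ld] : exists2 l, (0 < l)%N & (lam ^+ l)^-1 < d.
  exists (Num.truncn d^-1).+1 => //; rewrite invf_plt ?posrE ?exprn_gt0 ?(lt_le_trans _ lam8)//.
  apply: (lt_le_trans (truncnS_gt _)).
  apply: (@le_trans _ _ ((2 ^ (Num.truncn d^-1).+1)%:R)); first by rewrite ler_nat ltnW// ltn_expl.
  rewrite natrX; apply: lerXn2r; rewrite ?nnegrE//; have := lam8; lra.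
have Kab (u : l.-tuple bool) x : K u x -> a <= x <= b /\ `|x - cword lam u 0| < d.
  rewrite /= in_itv/= => /andP[x1 x2].
  have [/andP[h1 _] /andP[_ h2]] : (0 <= cword lam u 0 <= 1) /\ (0 <= cword lam u 1 <= 1).
    by split; apply: cword01; rewrite ?lexx ?ler01.
  have := cwordB lam8 u 1 0; rewrite subr0 mul1r size_tuple => h3.
  split; first by apply/andP; split; have := a0; have := b1; lra.
  by rewrite ger0_norm ?subr_ge0//; apply: le_lt_trans ld; rewrite -h3 lerD2r.
have c1 : \sum_(u : l.-tuple bool) (2^-1 ^+ l : R) = 1.
  rewrite sumr_const card_tuple card_bool exprVn -(mulr_natl (2 ^- l)) natrX divff//.
pose S := \sum_(u : l.-tuple bool) (2^-1 ^+ l : R) * phi (cword lam u 0).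
have est (P : invariant_prob a b f) (dl : R) : 0 <= dl ->
    (forall u : l.-tuple bool, 2^-1 ^+ l - dl <= fine (P (K u))) ->
    `|\int[P]_(x in `[a, b]) phi x - S| <= e / 4 + 2 * M * dl * #|{: l.-tuple bool}|%:R.
  move=> dl0 PK.
  apply: (@integral_estimate P `[a, b]%classic phi M (e / 4) dl (l.-tuple bool)
    (fun u => K u) (fun u => phi (cword lam u 0)) (fun=> 2^-1 ^+ l)) => //.
  - exact: prob_carried.
  - by move=> u x /Kab[]; rewrite /= in_itv.
  - move=> u u' x Ku Ku'; apply/val_inj/(cylinder_disjoint _ Ku Ku').
    by rewrite !size_tuple.
  - move=> u; apply: phiM; have [|] := @Kab u (cword lam u 0) => //.
    by rewrite /= in_itv/= lexx cword_homo.
  - by rewrite divr_ge0 ?ltW.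
  - move=> u x Kux; have [xab xd] := Kab u x Kux.
    apply/ltW/phid => //; have [|] := @Kab u (cword lam u 0) => //.
    by rewrite /= in_itv/= lexx cword_homo.
have hmu := est mu 0 (lexx _) ltac:(by move=> u; rewrite subr0 -{1}(size_tuple u)).
rewrite mulr0 mul0r addr0 in hmu.
have e40 : 0 < e / 4 by rewrite divr_gt0.
(* Once [l] is fixed, the error due to the masses is a constant divided by [n.+1]. *)
near=> n.
have hnu := est (nu n) ((2 * l + 1)%:R / n.+1%:R) (divr_ge0 _ _) _.
have {hnu} : `|\int[nu n : invariant_prob a b f]_(x in `[a, b]) phi x - S| <= e / 4 + e / 4.
  apply: (le_trans (hnu _ _ _)) => //.
    move=> u; have := @nuK n u; rewrite size_tuple; apply.
    by rewrite -size_eq0 size_tuple -lt0n.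
  rewrite lerD2l mulrAC mulrA ler_pdivrMr//.
  set C := 2 * M * _ * _; rewrite -ler_pdivrMl// mulrC.
  apply: (@le_trans _ _ n%:R); last by rewrite ler_nat.
  near: n; exact: nbhs_infty_ger.
move=> hnu.
rewrite (_ : _ - _ = (\int[mu : invariant_prob a b f]_(x in `[a, b]) phi x - S) -
  (\int[nu n : invariant_prob a b f]_(x in `[a, b]) phi x - S)); last by ring.
apply: (le_trans (ler_normB _ _)).
clear - hmu hnu e40; lra.
Unshelve. all: by end_near. Qed.

End integral_estimate.

(** * Conclusion *)

Lemma cantor_cylinder_ge (R : realType) (lam : R) (mu : probability (measurableTypeR R) R) :
  8 <= lam -> mu `[0, 1]%classic = 1%E ->
  (forall A, measurable A -> fine (mu A) =
    (fine (mu (cbranch lam false @^-1` A)) + fine (mu (cbranch lam true @^-1` A))) / 2) ->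
  forall u, 2^-1 ^+ size u <= fine (mu `[cword lam u 0, cword lam u 1]%classic).
Proof.
move=> lam8 mu01 muS; elim=> [|b u IH]; first by rewrite expr0 /= mu01.
have mpre c (x y : R) : measurable ((cbranch lam c : measurableTypeR R -> measurableTypeR R) @^-1` `[x, y]%classic).
  by apply: (measurable_preimage_cword lam8 [:: c]); exact: measurable_itv.
have h : fine (mu `[cword lam u 0, cword lam u 1]%classic) <=
    fine (mu (cbranch lam b @^-1` `[cword lam (b :: u) 0, cword lam (b :: u) 1]%classic)).
  apply: fine_le; rewrite ?fin_num_measure//; try exact: mpre; try exact: measurable_itv.
  apply: le_measure; rewrite ?inE//; try exact: mpre; try exact: measurable_itv.
  move=> x; rewrite /= !in_itv/= => /andP[x0 x1].
  by rewrite !cbranch_homo.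
rewrite muS; last exact: measurable_itv.
rewrite exprS mulrC ler_wpM2r ?invr_ge0//; apply: (le_trans IH); apply: (le_trans h).
by case: (b); rewrite ?lerDr ?lerDl fine_ge0.
Qed.

Section champernowne_tower.
Context {R : realType}.
Local Notation B := (measurableTypeR R).
Variables (n p L : nat) (xinf : R).
Local Notation lam := (L%:R ^+ p : R).
Hypotheses (np : (2 * n < p)%N) (L16 : (16 <= L)%N) (lnL : 9 <= ln (L%:R : R)).
Hypothesis xinfP : forall m,
  cword lam (champernowne m) 0 <= xinf <= cword lam (champernowne m) 1.
Local Notation f := (interval_map n p lam xinf : B -> B).

Lemma scale_ge8 : 8 <= lam.
Proof.
have L1 : 16 <= L%:R :> R by rewrite ler_nat.
case: p np => // q _; rewrite exprS; have : 1 <= L%:R ^+ q :> R by rewrite exprn_ege1//; lra.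
nra.
Qed.

Lemma continuous_interval_map : continuous (f : R -> R).
Proof. exact: Ck_continuous (Ck_interval_map lam xinf np). Qed.

Lemma measurable_interval_map : measurable_fun setT f.
Proof. by apply: continuous_measurable_fun; exact: continuous_interval_map. Qed.

Lemma champernowne_tower m : exists nu : probability B R,
  [/\ invariant_measure f nu, nu `[0, 1]%classic = 1%E,
      forall u : seq bool, u != [::] ->
        2^-1 ^+ size u - (2 * size u + 1)%:R / m.+1%:R <=
        fine (nu `[cword lam u 0, cword lam u 1]%classic),
      (3%:E <= ks_entropy f nu)%E & (3%:E <= folding_entropy f nu)%E].
Proof.
have lam8 := scale_ge8; have mf := measurable_interval_map; have cf := continuous_interval_map.
have fK := @interval_map_cbranch R n p lam xinf lam8.
(* The index [m.+1] ensures [k >= 2], on which the bound for [(k - 1) / (k + 1)] depends. *)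
set w := champernowne m.+1; pose k := size w.
have k2 : (2 <= k)%N.
  apply: leq_trans (size_champernowne_ge m.+1).
  by rewrite expnS; have := expn_gt0 2 m; nia.
have [q kq] : exists q, k = q.+2 by exists (k - 2)%N; lia.
pose N := (L ^ q.+1)%N.
have L0 : (0 < L)%N by exact: leq_trans L16.
have N2 : (2 <= N)%N.
  by rewrite /N expnS (@leq_mul 2 1)// ?(leq_trans _ L16)// expn_gt0 L0.
have N0 : (0 < N)%N by exact: leq_trans N2.
(* The periods numbered [N] to [2 N - 1] give [N] disjoint laps at distance of order [1 / N] from
   1/2. *)
pose l (i : 'I_N) : R := 1 / 2 + trough (N + i).
pose r (i : 'I_N) : R := 1 / 2 + crest (N + i).
have Ni (i : 'I_N) : (N <= N + i < 2 * N)%N by rewrite leq_addr mul2n -addnn ltn_add2l ltn_ord.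
have lr i : [/\ 1 / 4 < l i, l i <= r i & r i < 3 / 4].
  have [h1 h2] := @trough_le_crest R (N + i).
  have h3 : crest (N + i) <= 1 / 8 :> R.
    by apply: crest_le; rewrite (leq_trans N2)// leq_addr.
  by rewrite /l /r; split; lra.
have lap_disj i j : i != j -> r i < l j \/ r j < l i.
  rewrite neq_ltn /l /r => /orP[ij|ji]; [right|left]; rewrite ltrD2l;
  by apply: crest_lt_trough; rewrite ltn_add2l.
(* The factor [L >= 16] given up in [N = L^(k - 1)] absorbs the constant 16. *)
have NL : (16 * N%:R) ^+ p <= lam ^+ size w.
  have NLq : 16 * N%:R <= L%:R ^+ q.+2 :> R.
    by rewrite /N natrX [leRHS]exprS ler_wpM2r ?exprn_ge0// ler_nat.
  have N16 : 0 <= 16 * N%:R :> R by rewrite mulr_ge0.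
  by rewrite -[size w]/k kq exprAC; apply: lerXn2r; rewrite ?nnegrE ?(le_trans N16).
have flr i : f (l i) <= cword lam w 0 /\ cword lam w 1 <= f (r i).
  exact: (interval_map_laps n lam8 N2 (Ni i) NL (xinfP _)).
(* With [k = q + 2] the quotient is [(q + 1) / (q + 3)] times [ln L], at least [9 / 3]. *)
have lnN : 3 <= ln N%:R / k.+1%:R :> R.
  rewrite ler_pdivlMr ?ltr0n// /N natrX lnXn ?ltr0n// kq.
  rewrite -(mulr_natl (ln L%:R)) -(natr1 q) -[q.+3]addn3 natrD.
  have q0 : 0 <= q%:R :> R by [].
  have := ler_wpM2l (addr_ge0 q0 ler01) lnL; lra.
have [nu0 [nu01 nu0S]] := lap_measure lam8 cf w N0 lr.
have [nu nuE] := tower_measure mf w nu0.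
exists nu; split.
- exact: (tower_invariant lam8 fK mf cf N0 lr flr nu01 nu0S nuE).
- exact: (tower_unit lam8 fK mf cf N0 lr flr nu01 nu0S nuE).
- move=> u u0.
  apply: le_trans (tower_cylinder lam8 fK mf cf N0 lr flr nu01 nu0S nuE u).
  rewrite -natr_sum -occurrencesE.
  have := champernowne_frequency m.+1 u0; rewrite -/w -/k.
  move: (occurrences u w) => o H.
  have p2 : 0 < (2 ^ size u)%:R :> R by rewrite ltr0n expn_gt0.
  have m0 : 0 < m.+1%:R :> R by rewrite ltr0n.
  have k0 : 0 < k.+1%:R :> R by rewrite ltr0n.
  have {H} : m.+1%:R * k.+1%:R <= m.+1%:R * (o%:R * (2 ^ size u)%:R) +
      (2 * size u + 1)%:R * k.+1%:R :> R by rewrite -!natrM -natrD ler_nat.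
  rewrite exprVn -natrX.
  have p1 : 1 <= (2 ^ size u)%:R :> R by rewrite ler1n expn_gt0.
  move: p2 m0 k0 p1 (ler0n R (2 * size u + 1)).
  move: (2 ^ size u)%:R m.+1%:R k.+1%:R o%:R (2 * size u + 1)%:R => P M K O C p0 m0 k0 p1 c0 H.
  have [Kn Mn] : K != 0 /\ M != 0 by rewrite !gt_eqF.
  rewrite lerBlDr (_ : K^-1 * O + C / M = (O * M + C * K) / (M * K)); last by field; rewrite Kn Mn.
  rewrite ler_pdivlMr ?mulr_gt0// ler_pdivrMl//.
  have := ler_wpM2r (mulr_ge0 c0 (ltW k0)) p1; clear nu01 nu0S nuE flr; lra.
- apply: le_trans (tower_entropy lam8 fK mf cf N0 lr lap_disj flr nu01 nu0S nuE).
  by rewrite lee_fin.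
- apply: le_trans (tower_folding lam8 fK mf cf N0 lr lap_disj flr nu01 nu0S nuE N2).
  by rewrite lee_fin.
Qed.

End champernowne_tower.

Lemma probability_segmentW (R : realType) (P : probability (measurableTypeR R) R) (a b : R) :
  a <= 0 -> 1 <= b -> P `[0, 1]%classic = 1%E -> P [set` `[a, b]] = 1%E.
Proof.
move=> a0 b1 P01; have mI (x y : R) : measurable (`[x, y]%classic : set (measurableTypeR R)).
  exact: measurable_itv.
apply/eqP; rewrite eq_le probability_le1//= -P01; apply: le_measure; rewrite ?inE//.
by move=> x; rewrite /= !in_itv/= => /andP[x0 x1]; rewrite (le_trans a0)//= (le_trans x1).
Qed.

Theorem theorem1p5 (R : realType) (r : R) (hr : 1 < r) :
  exists (a b : R) (f : measurableTypeR R -> measurableTypeR R),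
    [/\ a < b,
        measurable_fun setT f,
        {homo f : x / x \in `[a, b]} &
        Cr_on r a b f] /\
    exists mu : weak_star_invariant a b f,
      [/\ ergodic f mu,
          (0 < ks_entropy f mu)%E,
          ~ upper_semicontinuous_at
              (fun nu : weak_star_invariant a b f => ks_entropy f nu) mu &
          ~ upper_semicontinuous_at
              (fun nu : weak_star_invariant a b f => folding_entropy f nu) mu].
Proof.
(* One derivative beyond the integer part of [r] serves [Ck_Cr_on], and [p] is the least exponent
   above [2 * n] that [Ck_osc] accepts. *)
pose n := (Num.truncn r).+1; pose p := (2 * n).+1.
have np : (2 * n < p)%N by exact: ltnSn.
have [L L16 lnL] : exists2 L, (16 <= L)%N & 9 <= ln (L%:R : R).
  exists ((Num.truncn (expR 9 : R)).+1 + 16)%N; first exact: leq_addl.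
  rewrite -ler_expR lnK ?posrE ?ltr0n// natrD.
  apply: (le_trans (ltW (truncnS_gt _))); by rewrite lerDl.
pose lam : R := L%:R ^+ p.
have lam8 : 8 <= lam := scale_ge8 np L16.
have [xinf xinfP] := champernowne_point lam8.
have xinf01 : 0 <= xinf <= 1 by exact: (xinfP 0%N).
pose f : measurableTypeR R -> measurableTypeR R := interval_map n p lam xinf.
have mf : measurable_fun setT f := measurable_interval_map L xinf np.
have fK := @interval_map_cbranch R n p lam xinf lam8 : forall b y, _ -> f _ = _.
pose b : R := 2 * lam + 4.
have [a0 b1] : - b <= 0 /\ 1 <= b by rewrite /b; split; lra.
have ab : - b < b by lra.
have [mu [mu01 muS mu_approx]] := cantor_measure lam8 fK mf.
pose mu' : weak_star_invariant (- b) b f :=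
  InvariantProb (probability_segmentW a0 b1 mu01) (cantor_invariant lam8 fK mf mu01 muS).
have [nu nuP] := choice (champernowne_tower np L16 lnL xinfP).
have nuI m : invariant_measure f (nu m) by have [] := nuP m.
have nu01 m : nu m `[0, 1]%classic = 1%E by have [] := nuP m.
pose nu' m : weak_star_invariant (- b) b f :=
  InvariantProb (probability_segmentW a0 b1 (nu01 m)) (nuI m).
have nu_mu : nu' @ \oo --> mu'.
  apply: (cylinder_cvg_weak_star lam8 a0 b1) => [m u u0|u].
    by have [_ _ + _ _] := nuP m; exact.
  exact: (cantor_cylinder_ge lam8 mu01 muS).
(* The value 3 separates both functionals: at [mu'] they are at most [3 ln 2] and 2, along [nu'] at
   least 3. *)
have not_usc (h : weak_star_invariant (- b) b f -> \bar R) :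
    (h mu' < 3%:E)%E -> (forall m, (3%:E <= h (nu' m))%E) -> ~ upper_semicontinuous_at h mu'.
  move=> hmu hnu usc; have [m] := @filter_ex _ \oo _ _ (nu_mu _ (usc 3 hmu)).
  by rewrite /= ltNge hnu.
have ln2 : ln 2 < 1 :> R.
  by rewrite -ltr_expR lnK ?posrE//; have := @expR_gt1Dx R 1 (oner_neq0 _).
exists (- b), b, f; split.
  split => //.
    move=> x _; rewrite in_itv/= -ler_norml; exact: interval_map_bounded.
  by apply: Ck_Cr_on; [exact: ltW|exact: ltW|exact: Ck_interval_map].
exists mu'; split.
- exact: (cantor_ergodic lam8 fK mf mu01 muS mu_approx).
- exact: (cantor_entropy_gt0 lam8 fK mf mu01 muS).
- apply: not_usc => [|m]; last by have [] := nuP m.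
  apply: (le_lt_trans (cantor_entropy_le lam8 fK mf mu01 muS mu_approx)).
  by rewrite lte_fin -[ltRHS]mulr1 ltr_pM2l.
- apply: not_usc => [|m]; last by have [] := nuP m.
  apply: (le_lt_trans (cantor_folding_le2 lam8 fK mf mu01 muS)).
  by rewrite lte_fin ltr_nat.
Qed.
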